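(* Let $X\in\mathcal C$. Then: 1) $X$ is of type $2$ if and only if, in a suitable contact chart, it takes the form $X=a\,\partial_p+b\,\partial_q$ with $X(b/a)=0$; 2) $X$ is of type $3$ if and only if, in a suitable contact chart, it takes the form $X=a\,\partial_p+b\,\partial_q$ with $X(b/a)\neq0$.
   Context: Everything is $C^\infty$ and local. $J^1(\tau)$ is the 5-dimensional manifold of 1-jets of functions $z=z(x,y)$, with coordinates $(x,y,z,p,q)$; $U=dz-p\,dx-q\,dy$ and $\mathcal C=\{U=0\}$ is the contact distribution. A contact chart is a local coordinate system $(x,y,z,p,q)$ on $J^1(\tau)$ in which $\mathcal C=\{dz-p\,dx-q\,dy=0\}$. ''$X\in\mathcal C$'' means that the vector field $X$ is a local section of $\mathcal C$; $X$ is nowhere zero. $X(T)$ is the Lie derivative of $T$ along $X$. The type of $X\in\mathcal C$ is the rank, assumed constant, of the system of 1-forms $U,X(U),X^2(U),X^3(U)$ (iterated Lie derivatives); it is $2$, $3$ or $4$ and depends only on the direction of $X$ and on $\mathcal C$. Here $a,b$ are smooth functions with $a$ nowhere zero, and ''$\neq0$'' means nowhere zero on the local domain.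
   Formalization: ''Type'' here requires constant rank of each system U,...,X^j(U), j≤3, not only of all four forms; otherwise part 2 fails: X=∂_p+(p²/2)∂_q has rank 3 everywhere, but U,X(U),X²(U) have rank 2 at p=0, so no chart there gives X(b/a)≠0. *)

(* Defs.v *)
From HB Require Import structures.
From mathcomp Require Import all_boot all_order all_algebra.
From mathcomp Require Import all_classical all_reals all_analysis.

Set Implicit Arguments.
Unset Strict Implicit.
Unset Printing Implicit Defensive.
Import Order.TTheory GRing.Theory Num.Theory numFieldNormedType.Exports.
Local Open Scope classical_set_scope.
Local Open Scope ring_scope.

Section Smooth.
Context {R : realType} {n : nat} {W : normedModType R}.
Implicit Types (f : 'rV[R]_n.+1 -> W) (O : set 'rV[R]_n.+1).

Definition partial (i : 'I_n.+1) f : 'rV[R]_n.+1 -> W :=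
  fun m => 'D_(delta_mx 0 i) f m.

Definition partials (s : seq 'I_n.+1) f := foldr partial f s.

(* C^oo on O (used for open O only): all iterated partial derivatives exist
   and are continuous on O *)
Definition smooth_on O f : Prop :=
  forall s : seq 'I_n.+1, forall m, O m ->
    {for m, continuous (partials s f)} /\
    forall i, derivable (partials s f) m (delta_mx 0 i).

End Smooth.

Section Contact.
Context {R : realType}.

(* J^1(tau) is taken in its standard coordinates (x, y, z, p, q), i.e. as
   (an open subset of) R^5.  Vector fields and 1-forms are given by the row of
   their components in the standard frame and coframe. *)
Definition J1 : Type := 'rV[R]_5.
Definition vfield := J1 -> 'rV[R]_5.
Definition oneform := J1 -> 'rV[R]_5.

Definition ix : 'I_5 := @Ordinal 5 0 isT.
Definition iy : 'I_5 := @Ordinal 5 1 isT.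
Definition iz : 'I_5 := @Ordinal 5 2 isT.
Definition ip : 'I_5 := @Ordinal 5 3 isT.
Definition iq : 'I_5 := @Ordinal 5 4 isT.

Definition pairing (w v : 'rV[R]_5) : R := \sum_(i < 5) w 0 i * v 0 i.

Definition ext_d (f : J1 -> R) : oneform :=
  fun m => \row_(i < 5) partial i f m.

Definition vapply (X : vfield) (f : J1 -> R) : J1 -> R :=
  fun m => 'D_(X m) f m.

(* (L_X w)_j = X(w_j) + w([e_j, X]) for the constant field e_j, since
   [e_j, X] is the j-th partial derivative of X *)
Definition lie_form (X : vfield) (w : oneform) : oneform :=
  fun m => \row_(j < 5)
    (vapply X (fun t => w t 0 j) m + pairing (w m) (partial j X m)).

(* dz - p dx - q dy for the five functions (x, y, z, p, q) = phi *)
Definition contact_form (phi : J1 -> 'rV[R]_5) : oneform :=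
  fun m => ext_d (fun t => phi t 0 iz) m
           - phi m 0 ip *: ext_d (fun t => phi t 0 ix) m
           - phi m 0 iq *: ext_d (fun t => phi t 0 iy) m.

Definition U : oneform := contact_form id.

Definition contact (m : J1) : set 'rV[R]_5 :=
  [set v | pairing (U m) v = 0].

(* the rank at m of U, X(U), ..., X^(k-1)(U) *)
Definition lie_rank (X : vfield) (k : nat) (m : J1) : nat :=
  \rank (\matrix_(i < k) iter i (lie_form X) U m).

(* Constancy of the rank is required of each of the systems
   U, ..., X^j(U) with j <= 3, not only of the full one.  For rank 2 this adds
   nothing, U and X(U) being independent when X is a nowhere zero section of
   the contact distribution.  For rank 3 it excludes degenerations such as
   X = d/dp + (p^2/2) d/dq, where X^2(U) = - p dy vanishes on p = 0 although
   U, X(U), X^2(U), X^3(U) have rank 3 everywhere. *)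
Definition of_type (k : nat) (O : set J1) (X : vfield) : Prop :=
  exists r : nat -> nat, r 3%N = k /\
    forall m, O m -> forall j, (j <= 3)%N -> lie_rank X j.+1 m = r j.

(* phi : V -> phi(V) is a local coordinate system with inverse psi, and
   dz - p dx - q dy written in these coordinates has the contact distribution
   as its kernel. *)
Record contact_chart (V : set J1) (phi psi : J1 -> J1) : Prop := {
  chart_open : open V;
  chart_open_image : open (phi @` V);
  chart_smooth : smooth_on V phi;
  chart_inv_smooth : smooth_on (phi @` V) psi;
  chart_invK : forall m, V m -> psi (phi m) = m;
  chart_contact : forall m, V m ->
    [set v | pairing (contact_form phi m) v = 0] = contact m }.

(* the i-th coordinate vector field of the chart phi with inverse psi *)
Definition coord_field (phi psi : J1 -> J1) (i : 'I_5) : vfield :=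
  fun m => 'D_(delta_mx 0 i) psi (phi m).

(* Around m, inside O, there is a contact chart in which
   X = a d/dp + b d/dq, with a nowhere zero and P satisfied by the values of
   X(b/a). *)
Definition normal_form_at (O : set J1) (X : vfield) (P : R -> Prop)
    (m : J1) : Prop :=
  exists (V : set J1) (phi psi : J1 -> J1) (a b : J1 -> R),
    [/\ V m, V `<=` O & contact_chart V phi psi] /\
    [/\ smooth_on V a, smooth_on V b & forall t, V t -> a t != 0] /\
    (forall t, V t ->
       X t = a t *: coord_field phi psi ip t + b t *: coord_field phi psi iq t) /\
    (forall t, V t -> P (vapply X (fun u => b u / a u) t)).

End Contact.

(* Main.v *)
From HB Require Import structures.
Require Import Defs.
From mathcomp Require Import all_boot all_order all_algebra.
From mathcomp Require Import all_classical all_reals all_analysis.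
From mathcomp Require Import ring lra.
Set Implicit Arguments.
Unset Strict Implicit.
Unset Printing Implicit Defensive.
Import Order.TTheory GRing.Theory Num.Theory numFieldNormedType.Exports.
Local Open Scope classical_set_scope.
Local Open Scope ring_scope.

(** A form L_X^i(U), the i-th Lie derivative of the contact form U, vanishes on
X. When X has type 2 or 3, the first k of these forms, with k = 2 or 3, are
independent and span a system that is invariant under X and annihilates X.

From the normal form to the type. If X = a d/dp + b d/dq in a contact chart,
then X kills dx, dy and dz, and with c = b / a the form dz - p dx - q dy, a
multiple of U, is sent to - a (dx + c dy), while dx + c dy is sent to X(c) dy.
The coordinates of U, X(U), X^2(U) on these three forms are triangular, with
diagonal entries that vanish nowhere except for a factor X(c) in the last one;
hence the rank 3 where X(c) <> 0, and 2 everywhere if X(c) = 0 identically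
[chart_lie_rank, chart_lie_rank2].

From the type to the normal form. Complete the k forms to a coframe near m, and
let Y be a field of the dual frame that the k forms annihilate, independent of
X; there is one because k <= 3. Move a 3-dimensional submanifold through m along
the flow of Y, then along the flow of X. The values of the k forms on the
coordinate field of the first of these two flow parameters vanish on the
hypersurface swept by Y, and satisfy a linear system of differential equations
along X, so they vanish everywhere [characteristic_box]. In the coordinates so
obtained, X is a coordinate field and U involves neither of the two flow
parameters: U is a combination of the differentials of the three other
coordinates, which are first integrals of X [chart_exists]. After a division by
a non-zero coefficient, U becomes a multiple of dz - p dx - q dy, with x, y, z
killed by X. Since dU is non-degenerate on the contact distribution, the five
functions have independent differentials [contact_functions_free]: they form a
contact chart, in which X is a combination of d/dp and d/dq, and a suitable
order of x and y makes the coefficient of d/dp non-zero [first_integrals_chart].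
The value of X(b / a) then follows from the first part.

Type 3 leaves one more case to exclude: the ranks could be 2 for the first three
forms and 3 for all four. The construction with k = 2 would then give a chart
with X(b / a) = 0, in which all four forms have rank 2.

The analysis behind this is the smooth dependence of flows on parameters
[flow_exists] and the inverse function theorem [inverse_function]. The first is
obtained from Picard iterates: the derivatives of the iterates satisfy linear
integral equations, whose iterates converge geometrically once their
coefficients do [linear_iterates_Cg], so that regularity is gained one
derivative at a time. *)

(** * Derivatives along lines and functions with continuous partial derivatives *)

Section Line.
Context {R : realType}.

(** Differentiability as an estimate that makes sense at h = 0 as well: in
this form expansions can be added, composed and bounded without dividing by h.
*)
Lemma is_derive_eps {V W : normedModType R} (f : V -> W) (t v : V) (l : W) :
  (forall e, 0 < e -> exists2 d, 0 < d &
     forall h, `|h| < d -> `|f (t + h *: v) - f t - h *: l| <= e * `|h|) ->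
  is_derive t v f l.
Proof.
move=> H; suff cv : h^-1 *: ((f \o shift t) (h *: v) - f t) @[h --> 0^'] --> l.
  by apply: DeriveDef; [apply/cvg_ex; exists l | apply/cvg_lim].
apply/cvgrPdist_le => e /H[d d0 Hd]; near=> h.
have h0 : h != 0 by near: h; exact: nbhs_dnbhs_neq.
have hd : `|h| < d by near: h; exact: dnbhs0_lt.
have -> : l - h^-1 *: ((f \o shift t) (h *: v) - f t)
        = - (h^-1 *: (f (t + h *: v) - f t - h *: l)).
  by rewrite [in RHS]scalerBr scalerA mulVf// scale1r opprB /= [_ + t]addrC.
rewrite normrN normrZ normfV mulrC ler_pdivrMr ?normr_gt0//; exact: Hd.
Unshelve. all: by end_near. Qed.

Lemma derive_eps {V W : normedModType R} (f : V -> W) (t v : V) : derivable f t v ->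
  forall e, 0 < e -> exists2 d, 0 < d &
     forall h, `|h| < d -> `|f (t + h *: v) - f t - h *: 'D_v f t| <= e * `|h|.
Proof.
move=> df e e0; have /cvgrPdist_le /(_ _ e0) := df.
rewrite near_withinE => -[d /= d0 Hd]; exists d => // h hd.
have [->|h0] := eqVneq h 0.
  by rewrite !scale0r addr0 subr0 subrr !normr0 mulr0.
have := Hd h; rewrite /ball_/= sub0r normrN => /(_ hd h0).
rewrite -/('D_v f t) => He.
have -> : f (t + h *: v) - f t - h *: 'D_v f t
  = - (h *: ('D_v f t - h^-1 *: (f (h *: v + t) - f t))).
  by rewrite scalerBr scalerA divff// scale1r opprB [_ + t]addrC.
by rewrite normrN normrZ mulrC ler_wpM2r.
Qed.

Lemma is_derive_line {V W : normedModType R} (f : V -> W) (m v : V) (h s : R) :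
  derivable f (m + (s * h) *: v) v ->
  is_derive s 1 (fun r => f (m + (r * h) *: v)) (h *: 'D_v f (m + (s * h) *: v)).
Proof.
move=> df; apply: is_derive_eps => e e0.
have h1 : 0 < `|h| + 1 by rewrite ltr_wpDl.
have [d d0 Hd] := derive_eps df (divr_gt0 e0 h1).
exists (d / (`|h| + 1)); first exact: divr_gt0.
move=> k kd; have := Hd (k * h); rewrite normrM.
have kh : `|k| * `|h| < d.
  apply: le_lt_trans (_ : `|k| * (`|h| + 1) < d).
    by rewrite ler_wpM2l// lerDl.
  by rewrite -ltr_pdivlMr.
move=> /(_ kh).
have -> : m + ((s + k *: 1) * h) *: v = m + (s * h) *: v + (k * h) *: v.
  by rewrite -[k *: 1]/(k * 1) mulr1 mulrDl scalerDl addrA.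
rewrite scalerA => /le_trans; apply.
have -> : e / (`|h| + 1) * (`|k| * `|h|) = e * `|k| * (`|h| / (`|h| + 1)) by ring.
by rewrite ler_piMr ?mulr_ge0 ?(ltW e0)// ler_pdivrMr// mul1r lerDl.
Qed.

Lemma MVT_line {V : normedModType R} (f : V -> R) (m v : V) (h : R) :
  (forall s, 0 <= s <= 1 -> derivable f (m + (s * h) *: v) v) ->
  exists2 s, 0 <= s <= 1 &
    f (m + h *: v) - f m = h * 'D_v f (m + (s * h) *: v).
Proof.
move=> df; pose g r := f (m + (r * h) *: v).
have dg (s : R) : s \in `[0%R, 1%R] ->
    is_derive s 1 g (h *: 'D_v f (m + (s * h) *: v)).
  by rewrite in_itv/= => /df; exact: is_derive_line.
have dg' (s : R) : s \in `]0%R, 1%R[ ->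
    is_derive s 1 g (h *: 'D_v f (m + (s * h) *: v)).
  by move=> s01; apply: dg; move: s01; rewrite !in_itv/= => /andP[/ltW-> /ltW->].
have cg : {within `[0, 1], continuous g}.
  by apply: derivable_within_continuous => s /dg[].
have [c c01] := MVT_segment ler01 dg' cg.
rewrite subr0 mulr1 /g mul1r mul0r scale0r addr0 => E.
by exists c => //; move: c01; rewrite in_itv.
Qed.

End Line.

Lemma continuous_sum {R : realType} {T : topologicalType} (I : Type) (r : seq I)
    (P : pred I) (F : I -> T -> R) (x : T) :
  (forall i, {for x, continuous (F i)}) ->
  {for x, continuous (fun t => \sum_(i <- r | P i) F i t)}.
Proof.
move=> cF; elim: r => [|i r IH].
  rewrite (_ : (fun _ => _) = cst 0); first exact: cvg_cst.
  by apply/funext => t; rewrite big_nil.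
have [Pi|Pi] := boolP (P i); last first.
  by rewrite (_ : (fun _ => _) = fun t => \sum_(i <- r | P i) F i t)//;
    apply/funext => t; rewrite big_cons (negbTE Pi).
rewrite (_ : (fun _ => _) = F i \+ fun t => \sum_(i <- r | P i) F i t).
  by apply: continuousD; [exact: cF | exact: IH].
by apply/funext => t; rewrite big_cons Pi.
Qed.

Section RowNorm.
Context {R : realType} {n : nat}.
Implicit Types v t m : 'rV[R]_n.

Lemma norm_coord_le v i : `|v 0 i| <= `|v|.
Proof. by rewrite [leRHS]/Num.norm/= mx_normrE; exact: (le_bigmax _ _ (0, i)). Qed.

Lemma row_norm_le v r : 0 <= r -> (forall i, `|v 0 i| <= r) -> `|v| <= r.
Proof.
move=> r0 H; rewrite /Num.norm/= mx_normrE; apply: bigmax_le => // -[i j] _ /=.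
by rewrite ord1.
Qed.

Lemma row_norm_lt v r : 0 < r -> (forall i, `|v 0 i| < r) -> `|v| < r.
Proof.
move=> r0 H; rewrite /Num.norm/= mx_normrE; apply: bigmax_lt => // -[i j] _ /=.
by rewrite ord1.
Qed.

End RowNorm.

Section RowBall.
Context {R : realType} {n : nat}.
Implicit Types v t m : 'rV[R]_n.

Lemma ball_row m r t : ball m r t <-> 0 < r /\ forall i, `|m 0 i - t 0 i| < r.
Proof.
rewrite -ball_normE /ball_/=; split=> [mr|[r0 H]].
  split=> [|i]; first exact: le_lt_trans mr.
  by apply: le_lt_trans mr; have := norm_coord_le (m - t) i; rewrite !mxE.
by apply: row_norm_lt => // i; rewrite !mxE.
Qed.

(** Balls of the sup norm are boxes, so they contain the points reached by
changing the coordinates one at a time. *)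
Lemma ball_mix m r x y t : ball m r x -> ball m r y ->
  (forall i, exists2 s, 0 <= s <= 1 & t 0 i = x 0 i + s * (y 0 i - x 0 i)) ->
  ball m r t.
Proof.
move=> /ball_row[r0 Hx] /ball_row[_ Hy] H; apply/ball_row; split=> // i.
have [s /andP[s0 s1] ->] := H i.
have := Hx i; have := Hy i; rewrite !ltr_norml => /andP[? ?] /andP[? ?].
have [xy|xy] := leP (x 0 i) (y 0 i); first by apply/andP; split; nra.
by apply/andP; split; nra.
Qed.

End RowBall.

Section C1.
Context {R : realType} {n : nat}.
Implicit Types (f : 'rV[R]_n.+1 -> R) (m x y t : 'rV[R]_n.+1).

(** Changing the coordinates one at a time gives a path from x to y inside the
ball, and the mean value theorem controls each step. The constants c i are
meant to be the partial derivatives at one point, or 0 for a Lipschitz bound.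
*)
Lemma C1_estimate f m r (c eps : 'I_n.+1 -> R) :
  (forall t, ball m r t -> forall i, derivable f t (delta_mx 0 i) /\
      `|partial i f t - c i| <= eps i) ->
  forall x y, ball m r x -> ball m r y ->
  `|f y - f x - \sum_i c i * (y 0 i - x 0 i)| <=
    \sum_i eps i * `|y 0 i - x 0 i|.
Proof.
move=> H x y mx my.
pose p k : 'rV[R]_n.+1 := \row_i if (i < k)%N then y 0 i else x 0 i.
have p0 : p 0%N = x by apply/rowP => i; rewrite !mxE.
have pn : p n.+1 = y by apply/rowP => i; rewrite !mxE ltn_ord.
suff step k : (k <= n.+1)%N ->
   `|f (p k) - f x - \sum_(i < n.+1 | (i < k)%N) c i * (y 0 i - x 0 i)| <=
    \sum_(i < n.+1 | (i < k)%N) eps i * `|y 0 i - x 0 i|.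
  have := step n.+1 (leqnn _); rewrite pn.
  by rewrite (eq_bigl xpredT) 1?[in leRHS](eq_bigl xpredT) => // i; rewrite ltn_ord.
elim: k => [_|k IH kn]; first by rewrite p0 subrr !big_pred0 ?subr0 ?normr0.
have {IH} := IH (ltnW kn); pose j := Ordinal kn.
rewrite [X in _ <= X -> _]/= => IH.
have jE (i : 'I_n.+1) : ((i < k.+1) && (i != j) = (i < k))%N.
  rewrite ltnS leq_eqVlt -(inj_eq val_inj)/=.
  by case: (ltngtP i k).
rewrite (bigD1 j)//= (eq_bigl _ _ jE).
rewrite [in leRHS](bigD1 j)//= [in leRHS](eq_bigl _ _ jE).
have pk : p k.+1 = p k + (y 0 j - x 0 j) *: delta_mx 0 j.
  apply/rowP => i; rewrite !mxE eqxx/= -(inj_eq val_inj)/= ltnS leq_eqVlt.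
  case: (ltngtP i k) => [_|_|ik]/=; rewrite ?mulr0 ?addr0//.
  by rewrite mulr1 (_ : i = j) ?subrKC//; exact: val_inj.
have mid s : 0 <= s <= 1 -> ball m r (p k + (s * (y 0 j - x 0 j)) *: delta_mx 0 j).
  move=> s01; apply: (ball_mix mx my) => i; rewrite !mxE eqxx/= -(inj_eq val_inj)/=.
  case: (ltngtP i k) => [_|_|ik]/=; rewrite ?mulr0 ?addr0.
  - by exists 1; rewrite ?ler01 ?lexx// mul1r subrKC.
  - by exists 0; rewrite ?ler01 ?lexx// mul0r addr0.
  - by exists s => //; rewrite mulr1 (_ : i = j)//; exact: val_inj.
have [s s01] := MVT_line (fun s hs => (H _ (mid s hs) j).1).
rewrite -pk => E; have /(_ j)[_ Hj] := H _ (mid s s01).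
rewrite -[f (p k.+1)](subrK (f (p k))) E.
set D := \sum_(i < n.+1 | (i < k)%N) _ in IH *.
set d := y 0 j - x 0 j in Hj *.
rewrite -/(partial j f _); set q := partial j f _ in Hj *.
have -> : d * q + f (p k) - f x - (c j * d + D) =
   (q - c j) * d + (f (p k) - f x - D) by ring.
apply: le_trans (ler_normD _ _) (lerD _ IH).
by rewrite normrM ler_wpM2r.
Qed.

(** Continuity at m of the partial derivatives makes the errors of the
preceding estimate arbitrarily small on small balls. *)
Lemma C1_differentiable f m :
  (\forall t \near m, forall i, derivable f t (delta_mx 0 i)) ->
  (forall i, {for m, continuous (partial i f)}) ->
  differentiable f m /\ forall v, 'd f m v = \sum_i v 0 i * partial i f m.
Proof.
move=> df cf.
pose L (v : 'rV[R]_n.+1) : R := \sum_i v 0 i * partial i f m.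
have LD : GRing.linear_for *:%R L.
  move=> a u v; rewrite /L scaler_sumr -big_split; apply: eq_bigr => i _ /=.
  by rewrite !mxE mulrDl -[_ *: _]/(_ * _) mulrA.
pose L' : {linear 'rV[R]_n.+1 -> R} := HB.pack L (GRing.isLinear.Build _ _ _ _ L LD).
have Lc : continuous L'.
  move=> v; apply: continuous_sum => i.
  apply: (@continuousM _ _ (fun v : 'rV[R]_n.+1 => v 0 i) (cst _)).
    exact: coord_continuous.
  exact: cst_continuous.
suff dL e : 0 < e -> \forall v \near (0 : 'rV[R]_n.+1),
    `|f (v + m) - (f m + L v)| <= e * `|v|.
  have E : 'd f m = L' :> (_ -> _).
    by apply: diff_unique => //; apply/eqaddoP => e /dL.
  split; last by move=> v; rewrite E.
  by apply/diff_locallyP; rewrite E; split => //; apply/eqaddoP => e /dL.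
move=> e0; pose e' := e / n.+1%:R.
have e'0 : 0 < e' by rewrite divr_gt0.
have /nbhs_ballP[r /= r0 Hr] : \forall t \near m, forall i,
    derivable f t (delta_mx 0 i) /\ `|partial i f t - partial i f m| <= e'.
  near=> t => i; split; first by move: i; near: t.
  rewrite distrC; move: i; near: t; apply: filter_forall => i.
  by have /cvgrPdist_le := cf i; exact.
apply/nbhs_ballP; exists r => //= v; rewrite -ball_normE/ball_/= sub0r normrN => vr.
have mv : ball m r (v + m).
  by rewrite -ball_normE/ball_/= opprD addrCA subrr addr0 normrN.
have := C1_estimate Hr (ballxx m r0) mv.
have -> : \sum_i partial i f m * ((v + m) 0 i - m 0 i) = L v.
  by apply: eq_bigr => i _; rewrite !mxE addrK mulrC.
rewrite opprD addrA => /le_trans; apply.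
apply: le_trans (_ : \sum_(i < n.+1) e' * `|v| <= _).
  by apply: ler_sum => i _; rewrite !mxE addrK ler_wpM2l ?norm_coord_le ?ltW.
by rewrite sumr_const card_ord -mulr_natl mulrA mulrC [_ * e']mulrC divfK// mulrC.
Unshelve. all: by end_near. Qed.

End C1.

Section Chain.
Context {R : realType}.

Lemma derive_sum_coord {d} (X : 'rV[R]_d.+1 -> R) y w : differentiable X y ->
  'D_w X y = \sum_j w 0 j * partial j X y.
Proof.
move=> dX; rewrite deriveE// {1}(row_sum_delta w) linear_sum.
by apply: eq_bigr => j _; rewrite linearZ/= -deriveE.
Qed.

(** Phi need only have a derivative in the direction v: the chain rule is
applied to the curve r |-> Phi (t + r v). *)
Lemma is_derive_comp {V : normedModType R} {d} (X : 'rV[R]_d.+1 -> R)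
    (Phi : V -> 'rV[R]_d.+1) t v (l : 'I_d.+1 -> R) :
  differentiable X (Phi t) ->
  (forall j, is_derive t v (fun s => Phi s 0 j) (l j)) ->
  is_derive t v (fun s => X (Phi s)) (\sum_j l j * partial j X (Phi t)).
Proof.
move=> dX dP.
have dPhi : derivable Phi t v.
  by apply/derivable_mxP => i j; rewrite ord1; case: (dP j).
have EPhi : 'D_v Phi t = \row_j l j.
  rewrite derive_mx//; apply/rowP => j; rewrite !mxE.
  by case: (dP j).
pose c r := Phi (t + (r * 1) *: v).
have dPhi0 : derivable Phi (t + (0 * 1) *: v) v by rewrite mul0r scale0r addr0.
have c0 : c 0 = Phi t by rewrite /c mul0r scale0r addr0.
have [dc Ec] := is_derive_line dPhi0.
rewrite -/c in dc Ec; move: Ec; rewrite mul0r scale0r addr0 scale1r EPhi => Ec.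
have dc' : differentiable c 0 by apply/derivable1_diffP.
have dX' : differentiable X (c 0) by rewrite c0.
have dXc : derivable (X \o c) 0 1.
  by apply: diff_derivable; exact: differentiable_comp.
have EXc : 'D_1 (X \o c) 0 = \sum_j l j * partial j X (Phi t).
  rewrite deriveE; last exact: differentiable_comp.
  rewrite diff_comp//= -(deriveE _ dc') Ec -(deriveE _ dX') derive_sum_coord// c0.
  by apply: eq_bigr => j _; rewrite mxE.
apply: is_derive_eps => e /(derive_eps dXc)[r r0 Hr]; exists r => // h /Hr.
rewrite EXc /= /c mul0r scale0r addr0 add0r mulr1.
by rewrite -[h *: (1 : R^o)]/(h * 1) mulr1.
Qed.

(** Two applications of the mean value theorem turn the second difference
quotient into a mixed derivative at a nearby point. The quotient is symmetric
in u and v, whence the symmetry of second derivatives. *)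
Lemma schwarz_quotient {V : normedModType R} (f : V -> R) m u v r C eps :
  (forall a b, `|a| < r -> `|b| < r -> let t := m + a *: u + b *: v in
     [/\ derivable f t u, derivable ('D_u f) t v &
         `|'D_v ('D_u f) t - C| <= eps]) ->
  forall h, 0 < h < r ->
  `|f (m + h *: u + h *: v) - f (m + h *: u) - f (m + h *: v) + f m - h * h * C|
    <= h * h * eps.
Proof.
move=> H h /andP[h0 hr].
have small s : 0 <= s <= 1 -> `|s * h| < r.
  move=> /andP[s0 s1]; rewrite ger0_norm ?mulr_ge0 ?(ltW h0)//.
  by apply: le_lt_trans hr; rewrite ler_piMl// ltW.
have hr' : `|h| < r by rewrite gtr0_norm.
have r0 : `|0 : R| < r by rewrite normr0 (lt_trans h0).
pose g t := f (t + h *: v) - f t.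
have dg s : 0 <= s <= 1 -> is_derive (m + (s * h) *: u) u g
   ('D_u f (m + (s * h) *: u + h *: v) - 'D_u f (m + (s * h) *: u)).
  move=> s01; have [d1 _ _] := H _ _ (small s s01) hr'.
  have [d2 _ _] := H _ _ (small s s01) r0.
  rewrite scale0r addr0 in d2.
  apply: is_derive_eps => e e0.
  have [r1 r10 H1] := derive_eps d1 (divr_gt0 e0 (ltr0n _ 2)).
  have [r2 r20 H2] := derive_eps d2 (divr_gt0 e0 (ltr0n _ 2)).
  exists (Num.min r1 r2) => [|k]; first by rewrite lt_min r10.
  rewrite lt_min => /andP[/H1 {}H1 /H2 {}H2].
  rewrite /g scalerBr.
  rewrite -[m + _ + k *: u + h *: v]addrA [k *: u + _]addrC addrA.
  set x1 := f _ in H1 *; set x2 := f _ in H1 *; set x3 := k *: _ in H1 *.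
  set y1 := f _ in H2 *; set y2 := f _ in H2 *; set y3 := k *: _ in H2 *.
  have -> : x1 - y1 - (x2 - y2) - (x3 - y3) = (x1 - x2 - x3) - (y1 - y2 - y3) by ring.
  by rewrite (le_trans (ler_normB _ _))// (splitr e) mulrDl lerD.
have [s s01] := MVT_line (fun s hs => (dg s hs).(ex_derive)).
rewrite (dg s s01).(derive_val) {2}/g => E.
have dD s' : 0 <= s' <= 1 -> derivable ('D_u f) (m + (s * h) *: u + (s' * h) *: v) v.
  by move=> s'01; have [] := H _ _ (small s s01) (small s' s'01).
have [s' s'01 E'] := MVT_line dD.
have [_ _ HC] := H _ _ (small s s01) (small s' s'01).
rewrite E' /g in E.
have -> : f (m + h *: u + h *: v) - f (m + h *: u) - f (m + h *: v) + f m
   = f (m + h *: u + h *: v) - f (m + h *: u) - (f (m + h *: v) - f m) by ring.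
have hh : 0 <= h * h by rewrite mulr_ge0 ?ltW.
by rewrite E mulrA -mulrBr normrM ger0_norm// ler_wpM2l.
Qed.

Lemma schwarz {V : normedModType R} (f : V -> R) m u v :
  (\forall t \near m, [/\ derivable f t u, derivable f t v,
     derivable ('D_u f) t v & derivable ('D_v f) t u]) ->
  {for m, continuous ('D_v ('D_u f))} -> {for m, continuous ('D_u ('D_v f))} ->
  'D_v ('D_u f) m = 'D_u ('D_v f) m.
Proof.
move=> df c1 c2; apply/eqP; rewrite -subr_eq0 -normr_le0.
apply/ler_addgt0Pr => e e0; rewrite add0r.
have e2 : 0 < e / 2 by rewrite divr_gt0.
move/cvgrPdist_le : c1 => /(_ _ e2) c1; move/cvgrPdist_le : c2 => /(_ _ e2) c2.
set A := 'D_v _ m in c1 *; set B := 'D_u _ m in c2 *.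
have /nbhs_ballP[r /= r0 Hr] : \forall t \near m,
   [/\ derivable f t u, derivable f t v, derivable ('D_u f) t v &
     derivable ('D_v f) t u] /\
   `|A - 'D_v ('D_u f) t| <= e / 2 /\ `|B - 'D_u ('D_v f) t| <= e / 2.
  exact: (filterI df (filterI c1 c2)).
clear df c1 c2.
pose K := `|u| + `|v| + 1.
have K0 : 0 < K by rewrite ltr_wpDl// addr_ge0.
have Hb a b : `|a| < r / K -> `|b| < r / K -> ball m r (m + a *: u + b *: v).
  move=> ha hb; rewrite -ball_normE/ball_/= -addrA opprD addrA subrr sub0r normrN.
  rewrite (le_lt_trans (ler_normD _ _))// !normrZ.
  apply: le_lt_trans (_ : r / K * (`|u| + `|v|) < r).
    by rewrite mulrDr lerD// ler_wpM2r// ltW.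
  by rewrite mulrAC ltr_pdivrMr// ltr_pM2l// /K ltrDl.
pose h := r / K / 2.
have rK : 0 < r / K by rewrite divr_gt0.
have h0r : 0 < h < r / K by rewrite divr_gt0//= ltr_pdivrMr// mulr_natr mulr2n ltrDl.
have h0 : 0 < h by case/andP: h0r.
have Q1 : `|f (m + h *: u + h *: v) - f (m + h *: u) - f (m + h *: v) + f m
    - h * h * A| <= h * h * (e / 2).
  apply: schwarz_quotient h0r => a b ha hb t.
  have [[d1 _ d2 _] [d3 _]] := Hr _ (Hb a b ha hb).
  by rewrite distrC in d3; exact: And3 d1 d2 d3.
have Q2 : `|f (m + h *: v + h *: u) - f (m + h *: v) - f (m + h *: u) + f m
    - h * h * B| <= h * h * (e / 2).
  apply: schwarz_quotient h0r => a b ha hb t.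
  have [[_ d1 _ d2] [_ d3]] := Hr _ (Hb b a hb ha).
  rewrite distrC in d3; rewrite /t -addrA [a *: v + _]addrC addrA.
  exact: And3 d1 d2 d3.
rewrite -[m + h *: v + _]addrA [h *: v + _]addrC addrA in Q2.
rewrite [_ - f (m + h *: v) - _]addrAC in Q2.
move: (f _ - _ - _ + _) Q1 Q2 => D Q1 Q2 {Hr Hb}.
clearbody A B h.
have hh : 0 < h * h by rewrite mulr_gt0.
have : h * h * `|A - B| <= h * h * e.
  rewrite -[h * h in leLHS]gtr0_norm// -normrM.
  have -> : h * h * (A - B) = (D - h * h * B) - (D - h * h * A) by ring.
  apply: le_trans (ler_normB _ _) _.
  by rewrite (splitr e) [leRHS]mulrDr; exact: lerD.
by rewrite ler_pM2l.
Qed.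

End Chain.

(** * Families of functions differentiable r times *)

Lemma near_eq_continuous {T U : topologicalType} (f g : T -> U) (x : T) :
  (\forall t \near x, f t = g t) -> {for x, continuous f} -> {for x, continuous g}.
Proof.
move=> fg cf; rewrite /prop_for/continuous_at -(nbhs_singleton fg).
by apply: cvg_trans cf; apply: near_eq_cvg; apply: filterS fg => t ->.
Qed.

Lemma continuous_row {R : realType} {T : topologicalType} {m : nat}
    (F : T -> 'rV[R]_m) (x : T) :
  {for x, continuous F} <-> forall j, {for x, continuous (fun t => F t 0 j)}.
Proof.
split=> [cF j|cF].
  apply: (@continuous_comp _ _ _ F (fun v : 'rV[R]_m => v 0 j)) => //.
  exact: coord_continuous.
apply/cvgrPdist_le => e e0; near=> t; apply: row_norm_le; first exact: ltW.
move=> j; rewrite !mxE; move: j; near: t; apply: filter_forall => j.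
by have /cvgrPdist_le := cF j; exact.
Unshelve. all: by end_near. Qed.

Lemma partials_rcons {R : realType} {n : nat} {W : normedModType R} s i
    (f : 'rV[R]_n.+1 -> W) : partials (rcons s i) f = partials s (partial i f).
Proof. by rewrite /partials foldr_rcons. Qed.

Section Classes.
Context {R : realType} {n : nat} {I : Type}.
Implicit Types (F G : I -> 'rV[R]_n.+1 -> R) (B : set 'rV[R]_n.+1).

(** The rules of calculus for functions of class C^r only use that the zeroth
order class contains the constants and is stable under sums and products. They
are proved once for continuous functions, for bounded continuous functions and
for geometrically convergent sequences. *)
Record C0_class B (P : (I -> 'rV[R]_n.+1 -> R) -> Prop) : Prop := {
  C0_open : open B;
  C0_ext : forall F G, (forall k t, B t -> F k t = G k t) -> P F -> P G;
  C0_cont : forall F, P F -> forall k t, B t -> {for t, continuous (F k)};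
  C0_cst : forall c, P (fun _ _ => c);
  C0_add : forall F G, P F -> P G -> P (fun k t => F k t + G k t);
  C0_mul : forall F G, P F -> P G -> P (fun k t => F k t * G k t) }.

(** Members of the family are differentiated separately, while P is a
condition on the family as a whole, such as a bound uniform in k. *)
Fixpoint Cr B (P : (I -> 'rV[R]_n.+1 -> R) -> Prop) r F : Prop :=
  P F /\ if r is r'.+1 then
    (forall k t i, B t -> derivable (F k) t 'e_i) /\
    (forall i, Cr B P r' (fun k => partial i (F k)))
  else True.

Definition Cinf B P F := forall r, Cr B P r F.

Context {B : set 'rV[R]_n.+1} {P : (I -> 'rV[R]_n.+1 -> R) -> Prop}.
Hypothesis HP : C0_class B P.

Lemma near_open t : B t -> \forall s \near t, B s.
Proof. by move=> Bt; have := HP.(C0_open); rewrite openE => /(_ _ Bt). Qed.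

Lemma Cr0 r F : Cr B P r F -> P F.
Proof. by case: r => [|r] []. Qed.

Lemma CrS r F : Cr B P r.+1 F -> Cr B P r F.
Proof.
elim: r F => [|r IH] F; first by case.
by move=> [PF [dF pF]]; split=> //; split=> // i; apply: IH; exact: pF.
Qed.

Lemma Cr_ext r F G : (forall k t, B t -> F k t = G k t) -> Cr B P r F -> Cr B P r G.
Proof.
elim: r F G => [|r IH] F G FG [PF HF]; split=> //; try exact: HP.(C0_ext) FG PF.
have nFG k t : B t -> \forall s \near t, F k s = G k s.
  by move=> /near_open Bt; near=> s; apply: FG; near: s.
case: HF => dF pF; split=> [k t i Bt|i].
  by apply: near_eq_derivable (dF k t i Bt); exact: nFG.
by apply: IH (pF i) => k t Bt; apply: near_eq_derive; exact: nFG.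
Unshelve. all: by end_near. Qed.

Lemma Cr_cst c r : Cr B P r (fun _ _ => c).
Proof.
elim: r c => [|r IH] c; split=> //; try exact: HP.(C0_cst).
split=> [k t i _|i]; first exact: derivable_cst.
by apply: Cr_ext (IH 0) => k t _; rewrite /partial derive_cst.
Qed.

Lemma CrD r F G : Cr B P r F -> Cr B P r G -> Cr B P r (fun k t => F k t + G k t).
Proof.
elim: r F G => [|r IH] F G [PF HF] [PG HG]; split=> //; try exact: HP.(C0_add).
case: HF HG => dF pF [dG pG]; split=> [k t i Bt|i].
  by apply: derivableD; [exact: dF | exact: dG].
apply: Cr_ext (IH _ _ (pF i) (pG i)) => k t Bt.
by rewrite /partial deriveD//; [exact: dF | exact: dG].
Qed.

Lemma CrM r F G : Cr B P r F -> Cr B P r G -> Cr B P r (fun k t => F k t * G k t).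
Proof.
elim: r F G => [|r IH] F G HF HG.
  by case: HF HG => PF _ [PG _]; split=> //; exact: HP.(C0_mul).
have [PF [dF pF]] := HF; have [PG [dG pG]] := HG.
split; first exact: HP.(C0_mul).
split=> [k t i Bt|i].
  by apply: derivableM; [exact: dF | exact: dG].
apply: Cr_ext (CrD (IH _ _ (CrS HF) (pG i)) (IH _ _ (CrS HG) (pF i))) => k t Bt.
by rewrite /partial deriveM//; [exact: dF | exact: dG].
Qed.

Lemma CrN r F : Cr B P r F -> Cr B P r (fun k t => - F k t).
Proof.
move=> HF; apply: Cr_ext (CrM (Cr_cst (-1) r) HF) => k t _.
by rewrite mulN1r.
Qed.

Lemma Cr_sum r (J : Type) (s : seq J) (Q : pred J) (F : J -> I -> 'rV[R]_n.+1 -> R) :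
  (forall j, Cr B P r (F j)) ->
  Cr B P r (fun k t => \sum_(j <- s | Q j) F j k t).
Proof.
move=> HF; elim: s => [|j s IH].
  by apply: Cr_ext (Cr_cst 0 r) => k t _; rewrite big_nil.
have [Qj|Qj] := boolP (Q j).
  by apply: Cr_ext (CrD (HF j) IH) => k t _; rewrite big_cons Qj.
by apply: Cr_ext IH => k t _; rewrite big_cons (negbTE Qj).
Qed.

Lemma Cr_prod r (J : Type) (s : seq J) (Q : pred J) (F : J -> I -> 'rV[R]_n.+1 -> R) :
  (forall j, Cr B P r (F j)) ->
  Cr B P r (fun k t => \prod_(j <- s | Q j) F j k t).
Proof.
move=> HF; elim: s => [|j s IH].
  by apply: Cr_ext (Cr_cst 1 r) => k t _; rewrite big_nil.
have [Qj|Qj] := boolP (Q j).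
  by apply: Cr_ext (CrM (HF j) IH) => k t _; rewrite big_cons Qj.
by apply: Cr_ext IH => k t _; rewrite big_cons (negbTE Qj).
Qed.

Lemma Cr_partial i r F : Cr B P r.+1 F -> Cr B P r (fun k => partial i (F k)).
Proof. by case=> _ [_]; exact. Qed.

Lemma Cr_partials s r F : Cr B P (size s + r) F ->
  Cr B P r (fun k => partials s (F k)).
Proof.
elim/last_ind: s F => [//|s i IH] F; rewrite size_rcons addSn => /(Cr_partial i) HF.
by apply: Cr_ext (IH _ HF) => k t _; rewrite /partials foldr_rcons.
Qed.

Lemma CinfP F : Cinf B P F <-> forall s, P (fun k => partials s (F k)) /\
  forall k t i, B t -> derivable (partials s (F k)) t 'e_i.
Proof.
split=> [HF s|HF r].
  by have := Cr_partials (HF (size s + 1)%N); rewrite /= => -[? []].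
elim: r F HF => [|r IH] F HF; first by split=> //; have [] := HF [::].
have [PF dF] := HF [::]; split=> //; split=> // i.
apply: IH => s; have [Ps ds] := HF (rcons s i); split=> [|k t j].
  by rewrite (_ : (fun _ => _) = fun k => partials (rcons s i) (F k))//;
    apply/funext => k; rewrite partials_rcons.
by rewrite -partials_rcons; exact: ds.
Qed.

Lemma Cinf_partial i F : Cinf B P F -> Cinf B P (fun k => partial i (F k)).
Proof. by move=> HF r; exact: Cr_partial. Qed.

End Classes.

Arguments Cr_cst {R n I B P} HP c r.

(** * The algebra of smooth functions *)

Definition C0 {R : realType} {n} {I : Type} (B : set 'rV[R]_n.+1)
    (F : I -> 'rV[R]_n.+1 -> R) :=
  forall k t, B t -> {for t, continuous (F k)}.

Lemma C0_is_class {R : realType} {n} {I : Type} (B : set 'rV[R]_n.+1) :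
  open B -> C0_class B (@C0 R n I B).
Proof.
move=> oB; split=> //.
- move=> F G FG CF k t Bt; have nFG : \forall s \near t, F k s = G k s.
    have := oB; rewrite openE => /(_ _ Bt) nB; near=> s; apply: FG; near: s; exact: nB.
  exact: near_eq_continuous nFG (CF k t Bt).
- by move=> c k t _; exact: cst_continuous.
- by move=> F G CF CG k t Bt; apply: continuousD; [exact: CF|exact: CG].
- by move=> F G CF CG k t Bt; apply: continuousM; [exact: CF|exact: CG].
Unshelve. all: by end_near. Qed.

Section Smooth.
Context {R : realType} {n : nat}.
Implicit Types (f g : 'rV[R]_n.+1 -> R) (B O : set 'rV[R]_n.+1).

Lemma smooth_Cinf B f : open B ->
  smooth_on B f <-> Cinf B (C0 B) (fun _ : unit => f).
Proof.
move=> oB; rewrite (CinfP (C0_is_class oB)); split=> [sf s|sf s m Bm].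
  by split=> [k t /(sf s)[]//|k t i /(sf s)[]].
by have [c d] := sf s; split=> [|i]; [exact: (c tt)|exact: (d tt)].
Qed.

Lemma smooth_partial B f i : smooth_on B f -> smooth_on B (partial i f).
Proof. by move=> sf s; have := sf (rcons s i); rewrite partials_rcons. Qed.

Lemma smooth_derivable B f t i : smooth_on B f -> B t -> derivable f t 'e_i.
Proof. by move=> /(_ [::] t) H /H[]. Qed.

Lemma smooth_continuous B f t : smooth_on B f -> B t -> {for t, continuous f}.
Proof. by move=> /(_ [::] t) H /H[]. Qed.

Lemma smooth_differentiable B f t : open B -> smooth_on B f -> B t -> differentiable f t.
Proof.
move=> oB sf Bt; have := oB; rewrite openE => /(_ _ Bt) nB.
have [] // := @C1_differentiable R n f t.
  by near=> s => i; apply: smooth_derivable sf _; near: s; exact: nB.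
by move=> i; apply: smooth_continuous (smooth_partial i sf) Bt.
Unshelve. all: by end_near. Qed.

End Smooth.

Section Compose.
Context {R : realType} {n d : nat} {I : Type}.
Context {B : set 'rV[R]_n.+1} {P : (I -> 'rV[R]_n.+1 -> R) -> Prop}.
Hypothesis HP : C0_class B P.

(** The chain rule expresses a derivative of X o Phi through derivatives of
Phi and the compositions partial j X o Phi, to which the induction on r
applies. *)
Lemma Cr_comp (O : set 'rV[R]_d.+1) (X : 'rV[R]_d.+1 -> R)
    (Phi : I -> 'rV[R]_n.+1 -> 'rV[R]_d.+1) r :
  open O -> smooth_on O X -> (forall k t, B t -> O (Phi k t)) ->
  (forall s, P (fun k t => partials s X (Phi k t))) ->
  (forall j, Cr B P r (fun k t => Phi k t 0 j)) ->
  Cr B P r (fun k t => X (Phi k t)).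
Proof.
move=> oO sX PhiO PX; elim: r X sX PX => [|r IH] X sX PX HPhi; split=> //.
- exact: (PX [::]).
- exact: (PX [::]).
have dXP k t i : B t -> is_derive t 'e_i (fun u => X (Phi k u))
    (\sum_j 'D_('e_i) (fun u => Phi k u 0 j) t * partial j X (Phi k t)).
  move=> Bt; apply: is_derive_comp.
    by apply: smooth_differentiable sX _ => //; exact: PhiO.
  by move=> j; apply: derivableP; have [_ [dPhi _]] := HPhi j; exact: dPhi.
split=> [k t i Bt|i]; first by case: (dXP k t i Bt).
apply: (@Cr_ext _ _ _ _ _ HP r (fun k t => \sum_j
    partial i (fun u => Phi k u 0 j) t * partial j X (Phi k t))).
  by move=> k t Bt; rewrite [RHS]/partial (dXP k t i Bt).(derive_val).
apply: (Cr_sum HP) => j; apply: (CrM HP); first exact: Cr_partial (HPhi j).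
apply: IH => [|s|l]; first exact: smooth_partial.
  by have := PX (rcons s j); rewrite partials_rcons.
exact: CrS (HPhi l).
Qed.

End Compose.

Section SmoothOps.
Context {R : realType} {n : nat}.
Context {B : set 'rV[R]_n.+1}.
Hypothesis oB : open B.
Implicit Types (f g : 'rV[R]_n.+1 -> R).

Let HB I := @C0_is_class R n I B oB.

Lemma smooth_ext f g : (forall t, B t -> f t = g t) -> smooth_on B f -> smooth_on B g.
Proof.
move=> fg /(smooth_Cinf _ oB) sf; apply/(smooth_Cinf _ oB) => r.
by apply: Cr_ext (sf r) => // _ t /fg.
Qed.

Lemma smooth_cst c : smooth_on B (fun=> c : R).
Proof. by apply/(smooth_Cinf _ oB) => r; exact: Cr_cst. Qed.

Lemma smoothD f g : smooth_on B f -> smooth_on B g -> smooth_on B (fun t => f t + g t).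
Proof.
move=> /(smooth_Cinf _ oB) sf /(smooth_Cinf _ oB) sg; apply/(smooth_Cinf _ oB) => r.
exact: (CrD (HB _)).
Qed.

Lemma smoothM f g : smooth_on B f -> smooth_on B g -> smooth_on B (fun t => f t * g t).
Proof.
move=> /(smooth_Cinf _ oB) sf /(smooth_Cinf _ oB) sg; apply/(smooth_Cinf _ oB) => r.
exact: (CrM (HB _)).
Qed.

Lemma smoothN f : smooth_on B f -> smooth_on B (fun t => - f t).
Proof.
move=> /(smooth_Cinf _ oB) sf; apply/(smooth_Cinf _ oB) => r.
exact: (CrN (HB _)).
Qed.

Lemma smoothB f g : smooth_on B f -> smooth_on B g -> smooth_on B (fun t => f t - g t).
Proof. by move=> sf /smoothN; exact: smoothD. Qed.

Lemma smooth_sum (J : Type) (s : seq J) (Q : pred J) (F : J -> 'rV[R]_n.+1 -> R) :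
  (forall j, smooth_on B (F j)) -> smooth_on B (fun t => \sum_(j <- s | Q j) F j t).
Proof.
move=> sF; apply/(smooth_Cinf _ oB) => r; apply: (Cr_sum (HB _)) => j.
by move/(smooth_Cinf _ oB): (sF j).
Qed.

Lemma smooth_prod (J : Type) (s : seq J) (Q : pred J) (F : J -> 'rV[R]_n.+1 -> R) :
  (forall j, smooth_on B (F j)) -> smooth_on B (fun t => \prod_(j <- s | Q j) F j t).
Proof.
move=> sF; apply/(smooth_Cinf _ oB) => r; apply: (Cr_prod (HB _)) => j.
by move/(smooth_Cinf _ oB): (sF j).
Qed.

Lemma smoothV f : (forall t, B t -> f t != 0) -> smooth_on B f ->
  smooth_on B (fun t => (f t)^-1).
Proof.
move=> f0 /(smooth_Cinf _ oB) sf; apply/(smooth_Cinf _ oB) => r.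
have cV : C0 B (fun (_ : unit) t => (f t)^-1).
  by move=> k t Bt; apply: continuousV; [exact: f0 | exact: ((sf 0%N).1 tt)].
elim: r => [|r IH]; split=> //; have [_ [df pf]] := sf r.+1.
have dV t i : B t -> is_derive t 'e_i (fun t => (f t)^-1)
    (- ((f t)^-1 * (f t)^-1) * partial i f t).
  move=> Bt; have fi := df tt t i Bt; split; first exact: derivableV (f0 _ Bt) fi.
  apply: etrans (deriveV (f0 _ Bt) fi) _.
  by rewrite expr2 invfM.
split=> [k t i Bt|i]; first by case: (dV t i Bt).
apply: (Cr_ext (HB _) _ (CrM (HB _) (CrN (HB _) (CrM (HB _) IH IH)) (pf i))) => k t Bt.
by rewrite [RHS]/partial (dV t i Bt).(derive_val).
Qed.

Lemma smooth_coord j : smooth_on B (fun t : 'rV[R]_n.+1 => t 0 j).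
Proof.
apply/(smooth_Cinf _ oB) => r.
have cj : C0 B (fun (_ : unit) (t : 'rV[R]_n.+1) => t 0 j).
  by move=> _ t _; exact: coord_continuous.
have dj t i : is_derive t 'e_i (fun t : 'rV[R]_n.+1 => t 0 j) ((i == j)%:R).
  apply: is_derive_eps => e e0; exists 1 => // h _.
  rewrite !mxE eqxx/= eq_sym; set c := (_ == _)%:R.
  rewrite -[h *: c]/(h * c) [t 0 j + _]addrC addrK subrr normr0.
  by rewrite mulr_ge0// ltW.
case: r => [|r]; split=> //; split=> [k t i _|i]; first by case: (dj t i).
by apply: Cr_ext (Cr_cst (HB _) ((i == j)%:R) r) => // k t _; rewrite /partial (dj t i).(derive_val).
Qed.

Lemma smooth_det k (A : 'rV[R]_n.+1 -> 'M[R]_k) :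
  (forall i j, smooth_on B (fun t => A t i j)) -> smooth_on B (fun t => \det (A t)).
Proof.
move=> sA; apply: smooth_sum => s; apply: smoothM; first exact: smooth_cst.
exact: smooth_prod.
Qed.

(** By Cramer's rule, the entries of the inverse are quotients of polynomials
in the entries. *)
Lemma smooth_invmx k (A : 'rV[R]_n.+1 -> 'M[R]_k) :
  (forall t, B t -> A t \in unitmx) ->
  (forall i j, smooth_on B (fun t => A t i j)) ->
  forall i j, smooth_on B (fun t => invmx (A t) i j).
Proof.
move=> uA sA i j.
apply: (@smooth_ext (fun t => (\det (A t))^-1 * cofactor (A t) j i)).
  by move=> t Bt; rewrite /invmx uA// !mxE.
apply: smoothM.
  by apply: smoothV => [t /uA|]; [rewrite unitmxE unitfE | exact: smooth_det].
apply: smoothM; first exact: smooth_cst.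
apply: smooth_det => a b.
by rewrite (_ : (fun _ => _) = fun t => A t (lift j a) (lift i b))//;
  apply/funext => t; rewrite !mxE.
Qed.

Lemma smooth_comp d (O : set 'rV[R]_d.+1) (X : 'rV[R]_d.+1 -> R)
    (Phi : 'rV[R]_n.+1 -> 'rV[R]_d.+1) :
  open O -> smooth_on O X -> (forall t, B t -> O (Phi t)) ->
  (forall j, smooth_on B (fun t => Phi t 0 j)) ->
  smooth_on B (fun t => X (Phi t)).
Proof.
move=> oO sX PhiO sPhi; apply/(smooth_Cinf _ oB) => r.
apply: (@Cr_comp _ _ _ _ _ _ (HB _) O X (fun _ => Phi)) => // [s k t Bt|j].
- apply: (@continuous_comp _ _ _ Phi (partials s X)).
    apply/continuous_row => j.
    exact: smooth_continuous (sPhi j) Bt.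
  by have [] := sX s (Phi t) (PhiO t Bt).
- by have /(smooth_Cinf _ oB) := sPhi j; exact.
Qed.

Lemma smooth_rowP m (F : 'rV[R]_n.+1 -> 'rV[R]_m) :
  smooth_on B F <-> forall j, smooth_on B (fun t => F t 0 j).
Proof.
split=> [sF j|sF].
  have E s : forall t, B t -> partials s (fun u => F u 0 j) t = (partials s F t) 0 j.
    elim: s => [//|i s IH] t Bt /=; rewrite {1}/partial.
    rewrite (@near_eq_derive _ _ _ _ (fun u => partials s F u 0 j)); last first.
      by move: Bt; have := oB; rewrite openE => oB' /oB'; apply: filterS.
    by rewrite [in RHS]/partial derive_mx ?mxE//; have [_] := sF s t Bt; exact.
  move=> s t Bt; have nE : \forall u \near t, partials s F u 0 j = partials s (fun u => F u 0 j) u.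
    by move: (Bt); have := oB; rewrite openE => oB' /oB'; apply: filterS => u /E.
  have [cF dF] := sF s t Bt; split=> [|i].
    apply: near_eq_continuous nE _.
    by have /continuous_row := cF; exact.
  by apply: near_eq_derivable nE _; move/derivable_mxP : (dF i); exact.
have Ej s j : (fun t => (\row_j partials s (fun u => F u 0 j) t) 0 j) =
    partials s (fun u => F u 0 j) by apply/funext => t; rewrite mxE.
have E s : forall t, B t -> partials s F t = \row_j partials s (fun u => F u 0 j) t.
  elim: s => [|i s IH] t Bt /=; first by apply/rowP => j; rewrite mxE.
  rewrite {1}/partial (@near_eq_derive _ _ _ _ (fun u => \row_j partials s (fun u => F u 0 j) u)); last first.
    by move: Bt; have := oB; rewrite openE => oB' /oB'; apply: filterS.
  rewrite derive_mx; last first.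
    apply/derivable_mxP => a j; rewrite ord1 Ej.
    by have [_] := sF j s t Bt; exact.
  by apply/rowP => j; rewrite !mxE Ej.
move=> s t Bt; have nE : \forall u \near t, \row_j partials s (fun u => F u 0 j) u = partials s F u.
  by move: (Bt); have := oB; rewrite openE => oB' /oB'; apply: filterS => u /E.
split=> [|i].
  apply: near_eq_continuous nE _; apply/continuous_row => j.
  rewrite Ej; by have [] := sF j s t Bt.
apply: near_eq_derivable nE _; apply/derivable_mxP => a j.
by rewrite ord1 Ej; have [_] := sF j s t Bt; exact.
Qed.

End SmoothOps.

Lemma smooth_sub {R : realType} {n} {W : normedModType R} (O O' : set 'rV[R]_n.+1)
   (F : 'rV[R]_n.+1 -> W) : O' `<=` O -> smooth_on O F -> smooth_on O' F.
Proof. by move=> OO sF s m /OO; exact: sF. Qed.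

(** * Bounded families and geometrically convergent sequences *)

Lemma continuous_eps {R : realType} {T : topologicalType} {V : normedModType R}
    (f : T -> V) (x : T) :
  {for x, continuous f} <->
  forall e, 0 < e -> \forall t \near x, `|f x - f t| <= e.
Proof. by split=> [/cvgrPdist_le|H]//; exact/cvgrPdist_le. Qed.

Lemma near_ball {R : realType} {V : normedModType R} (P : set V) (t : V) :
  (\forall s \near t, P s) -> exists2 r, 0 < r & forall s, ball t r s -> P s.
Proof. by move=> /nbhs_ballP[r r0 H]; exists r. Qed.

Section Bounded.
Context {R : realType} {n : nat} {I : Type}.

Definition Cb (B : set 'rV[R]_n.+1) (F : I -> 'rV[R]_n.+1 -> R) :=
  C0 B F /\ forall k, exists C, forall t, B t -> `|F k t| <= C.

Lemma Cb_is_class (B : set 'rV[R]_n.+1) : open B -> C0_class B (Cb B).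
Proof.
move=> oB; have H := C0_is_class (I := I) oB; split=> //.
- move=> F G FG [cF bF]; split; first exact: H.(C0_ext) FG cF.
  by move=> k; have [C FC] := bF k; exists C => t Bt; rewrite -FG//; exact: FC.
- by move=> F [].
- move=> c; split; first exact: H.(C0_cst).
  by move=> k; exists `|c|.
- move=> F G [cF bF] [cG bG]; split; first exact: H.(C0_add).
  move=> k; have [C FC] := bF k; have [D GD] := bG k; exists (C + D) => t Bt.
  by rewrite (le_trans (ler_normD _ _))// lerD// ?FC ?GD.
- move=> F G [cF bF] [cG bG]; split; first exact: H.(C0_mul).
  move=> k; have [C FC] := bF k; have [D GD] := bG k; exists (C * D) => t Bt.
  by rewrite normrM ler_pM// ?FC ?GD.
Qed.

End Bounded.

Section Geometric.
Context {R : realType} {n : nat}.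
Implicit Types (B : set 'rV[R]_n.+1) (F G : nat -> 'rV[R]_n.+1 -> R).

Local Notation q := (3 / 4 : R).

(** Bounding both F and its increments makes the class stable under products.
The rate exceeds 1/2 to leave room for the errors that coefficients converging
at the same rate add to a contraction by 1/2. *)
Definition Cg B F :=
  C0 B F /\ exists2 C, 0 <= C &
    forall k t, B t -> `|F k t| <= C /\ `|F k.+1 t - F k t| <= C * q ^+ k.

Lemma q_ge0 k : 0 <= q ^+ k. Proof. by rewrite exprn_ge0. Qed.

Lemma Cg_is_class B : open B -> C0_class B (Cg B).
Proof.
move=> oB; have H := C0_is_class (I := nat) oB; split=> //.
- move=> F G FG [cF [C C0 bF]]; split; first exact: H.(C0_ext) FG cF.
  by exists C => // k t Bt; rewrite -!FG//; exact: bF.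
- by move=> F [].
- move=> c; split; first exact: H.(C0_cst).
  by exists `|c| => // k t _; rewrite subrr normr0 mulr_ge0// q_ge0.
- move=> F G [cF [C C0 bF]] [cG [D D0 bG]]; split; first exact: H.(C0_add).
  exists (C + D) => [|k t Bt]; first exact: addr_ge0.
  have [F1 F2] := bF k t Bt; have [G1 G2] := bG k t Bt; split.
    by rewrite (le_trans (ler_normD _ _))// lerD.
  rewrite opprD addrACA mulrDl.
  by rewrite (le_trans (ler_normD _ _))// lerD.
- move=> F G [cF [C C0 bF]] [cG [D D0 bG]]; split; first exact: H.(C0_mul).
  exists (C * D + C * D) => [|k t Bt]; first by rewrite addr_ge0// mulr_ge0.
  have [F1 F2] := bF k t Bt; have [G1 G2] := bG k t Bt.
  have [F3 _] := bF k.+1 t Bt; split.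
    rewrite normrM (@le_trans _ _ (C * D))//; first by rewrite ler_pM.
    by rewrite lerDl mulr_ge0.
  have -> : F k.+1 t * G k.+1 t - F k t * G k t =
    F k.+1 t * (G k.+1 t - G k t) + (F k.+1 t - F k t) * G k t by ring.
  have -> : (C * D + C * D) * q ^+ k = C * (D * q ^+ k) + C * q ^+ k * D by ring.
  by rewrite (le_trans (ler_normD _ _))// !normrM lerD// ler_pM.
Qed.

Definition glim F t : R := limn (fun k => F k t).

Lemma q_cvg0 (C : R) : (fun k => C * q ^+ k) @ \oo --> (0 : R).
Proof. by apply: cvg_geometric; rewrite ger0_norm// ltr_pdivrMr// mul1r ltr_nat. Qed.

(** Adding 4 C q ^+ k to f k gives a nonincreasing sequence, subtracting it a
nondecreasing one, and both have the limit of f. *)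
Lemma geometric_cvg (f : nat -> R) C :
  (forall k, `|f k| <= C /\ `|f k.+1 - f k| <= C * q ^+ k) ->
  f @ \oo --> limn f /\ forall k, `|f k - limn f| <= 4 * C * q ^+ k.
Proof.
move=> H.
pose a k := f k + 4 * C * q ^+ k; pose b k := f k - 4 * C * q ^+ k.
have na : nonincreasing_seq a.
  apply/nonincreasing_seqP => k; rewrite /a exprSr.
  by have [_] := H k; rewrite ler_norml => /andP[? ?]; lra.
have nb : nondecreasing_seq b.
  apply/nondecreasing_seqP => k; rewrite /b exprSr.
  by have [_] := H k; rewrite ler_norml => /andP[? ?]; lra.
have C0 : 0 <= C by have [+ _] := H 0%N; apply: le_trans.
have la : has_lbound (range a).
  exists (- C) => _ [k _ <-]; rewrite /a.
  have [+ _] := H k; rewrite ler_norml => /andP[? ?].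
  have : 0 <= 4 * C * q ^+ k by rewrite mulr_ge0 ?q_ge0// mulr_ge0.
  lra.
have ca : cvgn a by exact: nonincreasing_is_cvgn.
have fE : f = fun k => a k - 4 * C * q ^+ k by apply/funext => k; rewrite /a addrK.
have cf : f @ \oo --> limn a.
  by rewrite fE -[X in _ --> X]subr0; apply: cvgB => //; exact: q_cvg0.
have fl : limn f = limn a by apply/cvg_lim.
have cb : b @ \oo --> limn a.
  by rewrite -[X in _ --> X]subr0; apply: cvgB => //; exact: q_cvg0.
have lb : limn b = limn a by apply/cvg_lim.
rewrite fl; split=> // k.
have := nonincreasing_cvgn_ge na ca k.
have := nondecreasing_cvgn_le nb (cvgP _ cb) k.
by rewrite lb /a /b ler_distl => ? ?; apply/andP; split; lra.
Qed.

Lemma Cg_glim B F : Cg B F -> exists2 C, 0 <= C &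
  forall t, B t -> [/\ (F ^~ t) @ \oo --> glim F t, `|glim F t| <= C &
    forall k, `|F k t - glim F t| <= C * q ^+ k].
Proof.
move=> [_ [C C0 HC]]; exists (5 * C) => [|t Bt]; first by rewrite mulr_ge0.
have [c H] := geometric_cvg (fun k => HC k t Bt); split=> // [|k].
  have [F0 _] := HC 0%N t Bt; have := H 0%N; rewrite expr0 mulr1 => H0.
  rewrite -[glim F t](subKr (F 0%N t)) (le_trans (ler_normB _ _))//.
  by rewrite (_ : 5 * C = C + 4 * C) ?lerD//; ring.
by rewrite (le_trans (H k))// ler_wpM2r ?q_ge0// ler_wpM2r// ler_nat.
Qed.

Lemma Cg_glim_continuous B F : open B -> Cg B F -> C0 B (fun _ : unit => glim F).
Proof.
move=> oB HF _ t Bt; have [C C0 HC] := Cg_glim HF.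
apply/continuous_eps => e e0.
have e3 : 0 < e / 3 by rewrite divr_gt0.
have [k _ Hk] : \forall k \near \oo, `|C * q ^+ k| <= e / 3.
  by have /cvgr0Pnorm_le := @q_cvg0 C; exact.
have {Hk} Hk := Hk k (leqnn k).
have qC : C * q ^+ k <= e / 3 by rewrite (le_trans (ler_norm _)).
have nB : \forall s \near t, B s by have := oB; rewrite openE => /(_ _ Bt).
have /continuous_eps /(_ _ e3) cF := HF.1 k t Bt.
near=> s.
have Bs : B s by near: s.
have Fs : `|F k t - F k s| <= e / 3 by near: s.
have [_ _ /(_ k) Ht] := HC t Bt; have [_ _ /(_ k) Hs] := HC s Bs.
have -> : glim F t - glim F s = - (F k t - glim F t) + (F k t - F k s) + (F k s - glim F s) by ring.
rewrite (le_trans (ler_normD _ _))// (_ : e = e / 3 + e / 3 + e / 3); last by field.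
rewrite lerD ?(le_trans Hs)// (le_trans (ler_normD _ _))// lerD// normrN.
exact: le_trans Ht qC.
Unshelve. all: by end_near. Qed.

(** The mean value theorem for F k and the uniform convergence of its
derivatives bound the error of the first-order expansion of F k independently
of k; the bound passes to the limit. *)
Lemma Cg_glim_derive B F i : open B -> Cg B F ->
  (forall k t, B t -> derivable (F k) t 'e_i) ->
  Cg B (fun k => partial i (F k)) ->
  forall t, B t -> is_derive t 'e_i (glim F) (glim (fun k => partial i (F k)) t).
Proof.
move=> oB HF dF HpF t Bt.
have [C C0 HC] := Cg_glim HF; have [D D0 HD] := Cg_glim HpF.
set g := glim (fun k => partial i (F k)) in HD *.
have cg := @Cg_glim_continuous _ _ oB HpF tt t Bt.
apply: is_derive_eps => e e0.
move/continuous_eps : cg => /(_ _ e0) cg.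
have nB : \forall s \near t, B s by have := oB; rewrite openE => /(_ _ Bt).
have [r r0 Hr] := near_ball (filterI nB cg).
exists r => // h hr.
have inr s : 0 <= s <= 1 -> ball t r (t + (s * h) *: 'e_i).
  move=> /andP[s0 s1]; rewrite -ball_normE/ball_/= opprD addrA subrr sub0r normrN.
  apply: row_norm_lt => // j; rewrite !mxE eqxx/= normrM.
  apply: le_lt_trans hr; rewrite normrM (@le_trans _ _ (`|s| * `|h|))//.
    by rewrite ler_piMr ?mulr_ge0//; case: (_ == _); rewrite ?normr1 ?normr0.
  by rewrite ler_piMl// ger0_norm.
have Bh : B (t + h *: 'e_i).
  by rewrite -[h]mul1r; apply: (Hr _ (inr 1 _)).1; rewrite ler01 lexx.
have est k : `|F k (t + h *: 'e_i) - F k t - h * g t| <= e * `|h| + D * q ^+ k * `|h|.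
  have [s s01 ->] := MVT_line (fun s hs => dF k _ (Hr _ (inr s hs)).1).
  have [Bs gs] := Hr _ (inr s s01).
  rewrite -mulrBr normrM mulrC -mulrDl ler_wpM2r//.
  have [_ _ /(_ k) Hk] := HD _ Bs.
  set u := t + _ in Bs gs Hk *.
  rewrite -/(partial i (F k) u).
  rewrite /= distrC in gs; rewrite -(subrKA (g u)) addrC.
  exact: le_trans (ler_normD _ _) (lerD gs Hk).
have [c1 _ _] := HC _ Bh; have [c2 _ _] := HC _ Bt.
have cl : (fun k => `|F k (t + h *: 'e_i) - F k t - h * g t|) @ \oo -->
   `|glim F (t + h *: 'e_i) - glim F t - h * g t|.
  by apply: cvg_norm; apply: cvgB; [exact: cvgB | exact: cvg_cst].
have cr : (fun k => e * `|h| + D * q ^+ k * `|h|) @ \oo --> e * `|h|.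
  rewrite -[X in _ --> X]addr0; apply: cvgD; first exact: cvg_cst.
  by rewrite -(mul0r `|h|); apply: cvgM; [exact: q_cvg0 | exact: cvg_cst].
by apply: ler_cvg_to cl cr _; exact: nearW.
Qed.

(** At each order the derivatives converge uniformly, so that differentiation
commutes with the limit. *)
Lemma Cinf_glim B F : open B -> Cinf B (Cg B) F ->
  Cinf B (Cb B) (fun _ : unit => glim F) /\
  forall s t, B t -> partials s (glim F) t = glim (fun k => partials s (F k)) t.
Proof.
move=> oB /(CinfP (Cg_is_class oB)) HF.
have nB t : B t -> \forall s \near t, B s by move=> Bt; have := oB; rewrite openE => /(_ _ Bt).
have dl s i t : B t -> is_derive t 'e_i (glim (fun k => partials s (F k)))
    (glim (fun k => partials (i :: s) (F k)) t).
  move=> Bt; have [Cs ds] := HF s; have [Cis _] := HF (i :: s).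
  by apply: Cg_glim_derive Bt => // k u Bu; exact: ds.
have E s : forall t, B t -> partials s (glim F) t = glim (fun k => partials s (F k)) t.
  elim: s => [//|i s IH] t Bt /=; rewrite {1}/partial.
  rewrite (@near_eq_derive _ _ _ _ (glim (fun k => partials s (F k)))).
    exact: (dl s i t Bt).(derive_val).
  by near=> u; apply: IH; near: u; exact: nB.
split=> //; apply/(CinfP (Cb_is_class oB)) => s.
have nE t : B t -> \forall u \near t, glim (fun k => partials s (F k)) u = partials s (glim F) u.
  by move=> Bt; near=> u; rewrite E//; near: u; exact: nB.
have [Cs ds] := HF s; split.
  split=> [k t Bt|_].
    exact: near_eq_continuous (nE t Bt) (@Cg_glim_continuous _ _ oB Cs tt t Bt).
  have [C C0 HC] := Cg_glim Cs; exists C => t Bt; rewrite E//.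
  by have [] := HC t Bt.
move=> k t i Bt; apply: near_eq_derivable (nE t Bt) _.
by case: (dl s i t Bt).
Unshelve. all: by end_near. Qed.

End Geometric.

(** * Integration along a coordinate *)

Section Primitive.
Context {R : realType}.

Lemma continuous_integral_primitive (g : R -> R) (eta : R) :
  (forall s : R, `|s| <= eta -> {for s, continuous g}) ->
  exists2 G : R -> R, G 0 = 0 & forall s : R, `|s| < eta -> is_derive s 1 G (g s).
Proof.
move=> cg; pose F x := \int[lebesgue_measure]_(t in `[- eta, x]) g t.
exists (fun x => F x - F 0) => [|s]; first by rewrite subrr.
rewrite ltr_norml => /andP[es se].
have ci : lebesgue_measure.-integrable `[- eta, eta] (EFin \o g).
  apply: continuous_compact_integrable; first exact: segment_compact.
  apply: continuous_in_subspaceT => x; rewrite inE/= in_itv/= => /andP[x1 x2].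
  by apply: cg; rewrite ler_norml x1.
have cs : {for s, continuous g} by apply: cg; rewrite ler_norml !ltW.
have [dF EF] := continuous_FTC1_closed se ci es cs.
have dFs : is_derive s 1 F (g s) by split; [exact: dF | rewrite -derive1E].
have := is_deriveB dFs (is_derive_cst (F 0) s 1); rewrite subr0.
by apply.
Qed.

Lemma derive0_line (F : R -> R) (x : R) : (forall s : R, `|s| <= `|x| -> is_derive s 1 F 0) ->
  F x = F 0.
Proof.
move=> dF.
have dF' s : 0 <= s <= 1 -> is_derive (0 + (s * x) *: (1 : R^o)) 1 F 0.
  move=> /andP[s0 s1]; rewrite add0r -[_ *: _]/(_ * _) mulr1; apply: dF.
  by rewrite normrM ger0_norm// ler_piMl.
have [s s01] := MVT_line (fun s hs => (dF' s hs).(ex_derive)).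
rewrite (dF' s s01).(derive_val) mulr0 add0r -[x *: _]/(_ * _) mulr1.
by move/eqP; rewrite subr_eq0 => /eqP.
Qed.

(** Integrals give primitives on compact subintervals. Normalized to vanish at
0, they agree where two of them are defined, and glue. *)
Lemma continuous_primitive (g : R -> R) (delta : R) :
  (forall s : R, `|s| < delta -> {for s, continuous g}) ->
  exists G : R -> R, G 0 = 0 /\ forall s : R, `|s| < delta -> is_derive s 1 G (g s).
Proof.
move=> cg; have [d0|d0] := ltP 0 delta; last first.
  exists (fun=> 0); split=> // s sd.
  by have := le_lt_trans (normr_ge0 _) (lt_le_trans sd d0); rewrite ltxx.
have /choice[H HP] : forall eta, exists H : R -> R, eta < delta ->
    H 0 = 0 /\ forall s : R, `|s| < eta -> is_derive s 1 H (g s).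
  move=> eta; have [ed|de] := ltP eta delta; last by exists (fun=> 0).
  have [G G0 dG] := @continuous_integral_primitive g eta
    (fun s hs => cg s (le_lt_trans hs ed)).
  by exists G.
pose eta (x : R) := (`|x| + delta) / 2.
have eta1 x : `|x| < delta -> eta x < delta by rewrite /eta; lra.
have eta2 x : `|x| < delta -> `|x| < eta x by rewrite /eta; lra.
exists (fun x => H (eta x) x); split=> [|s sd].
  by have [] := HP _ (eta1 0 _); rewrite ?normr0.
have nE : \forall x \near s, H (eta s) x = H (eta x) x.
  have : \forall x \near s, `|x| < eta s.
    apply/nbhs_ballP; exists (eta s - `|s|); first by rewrite /= subr_gt0 eta2.
    move=> x; rewrite -ball_normE/ball_/= => sx.
    rewrite -[x](subKr s) (le_lt_trans (ler_normB _ _))//; lra.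
  apply: filterS => x xs.
  have xd : `|x| < delta := lt_trans xs (eta1 s sd).
  have [H0 dH] := HP _ (eta1 s sd); have [H0' dH'] := HP _ (eta1 x xd).
  apply/eqP; rewrite -subr_eq0; apply/eqP.
  apply: etrans (@derive0_line (fun y => H (eta s) y - H (eta x) y) x _) _; last first.
    by rewrite H0 H0' subrr.
  move=> y yx.
  have := is_deriveB (dH y (le_lt_trans yx xs)) (dH' y (le_lt_trans yx (eta2 x xd))).
  by rewrite subrr; apply.
have [_ dH] := HP _ (eta1 s sd).
exact: near_eq_is_derive nE (dH s (eta2 s sd)).
Qed.

End Primitive.

Section ClassInf.
Context {R : realType} {n : nat} {I : Type}.
Context {B : set 'rV[R]_n.+1} {P : (I -> 'rV[R]_n.+1 -> R) -> Prop}.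
Hypothesis HP : C0_class B P.

Lemma Cinf_ext F G : (forall k t, B t -> F k t = G k t) ->
  Cinf B P F -> Cinf B P G.
Proof. by move=> FG HF r; exact: (Cr_ext HP) FG (HF r). Qed.

Lemma Cinf_cst c : Cinf B P (fun _ _ => c).
Proof. by move=> r; exact: Cr_cst. Qed.

Lemma CinfD F G : Cinf B P F -> Cinf B P G -> Cinf B P (fun k t => F k t + G k t).
Proof. by move=> HF HG r; exact: (CrD HP). Qed.

Lemma CinfM F G : Cinf B P F -> Cinf B P G -> Cinf B P (fun k t => F k t * G k t).
Proof. by move=> HF HG r; exact: (CrM HP). Qed.

Lemma Cinf_sum (J : Type) (s : seq J) (Q : pred J) (F : J -> I -> 'rV[R]_n.+1 -> R) :
  (forall j, Cinf B P (F j)) -> Cinf B P (fun k t => \sum_(j <- s | Q j) F j k t).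
Proof. by move=> HF r; apply: (Cr_sum HP) => j; exact: HF. Qed.

End ClassInf.

Section Integral.
Context {R : realType} {n : nat} (delta : R) (a : 'I_n.+1).
Implicit Types (f g : 'rV[R]_n.+1 -> R) (t : 'rV[R]_n.+1).
Local Notation B := (ball (0 : 'rV[R]_n.+1) delta).

(** A primitive is chosen, instead of an integral, because only its derivative
and its value at 0 matter. *)
Definition primitive (g : R -> R) : R -> R := xget (fun=> 0)
  [set G | G 0 = 0 /\ forall s : R, `|s| < delta -> is_derive s 1 G (g s)].

Lemma primitiveP (g : R -> R) : (forall s : R, `|s| < delta -> {for s, continuous g}) ->
  primitive g 0 = 0 /\
  forall s : R, `|s| < delta -> is_derive s 1 (primitive g) (g s).
Proof.
move=> /continuous_primitive[G HG]; rewrite /primitive.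
by case: xgetP => [H -> //|/(_ G)].
Qed.

(** The formula exhibits the point with coordinate a moved to s as a point of
the line through t directed by e_a. *)
Definition move_to t (s : R) : 'rV[R]_n.+1 := t + (s - t 0 a) *: 'e_a.

(** The integral of f on the segment from the hyperplane t_a = 0 to t in the
direction a. *)
Definition integral f t : R := primitive (fun s => f (move_to t s)) (t 0 a).

Lemma ball0_row t : B t <-> 0 < delta /\ forall i, `|t 0 i| < delta.
Proof.
split=> [/ball_row[d0 H]|[d0 H]]; [split=> // i|apply/ball_row; split=> // i].
  by have := H i; rewrite !mxE sub0r normrN.
by rewrite !mxE sub0r normrN.
Qed.

Lemma move_toE t s i : move_to t s 0 i = if i == a then s else t 0 i.
Proof.
rewrite !mxE eqxx/=; case: eqVneq => [->|]; last by rewrite mulr0 addr0.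
by rewrite mulr1 addrC subrK.
Qed.

Lemma ball_move_to t (s : R) : B t -> `|s| < delta -> B (move_to t s).
Proof.
move=> /ball0_row[d0 H] sd; apply/ball0_row; split=> // i.
by rewrite move_toE; case: ifP.
Qed.

Lemma move_to_self t : move_to t (t 0 a) = t.
Proof. by rewrite /move_to subrr scale0r addr0. Qed.

Lemma move_to_shift t h s : move_to (t + h *: 'e_a) s = move_to t s.
Proof.
apply/rowP => i; rewrite !move_toE !mxE eqxx/=.
by case: eqVneq => // _; rewrite mulr0 addr0.
Qed.

(** The mean value theorem on the segment joining t to the hyperplane t_a = 0.
*)
Lemma bound_from_base f t (C : R) :
  (forall s, 0 <= s <= 1 -> derivable f (move_to t (s * t 0 a)) 'e_a /\
     `|partial a f (move_to t (s * t 0 a))| <= C) ->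
  f (move_to t 0) = 0 -> `|f t| <= `|t 0 a| * C.
Proof.
move=> H f0.
have E s : move_to t 0 + (s * t 0 a) *: 'e_a = move_to t (s * t 0 a).
  by rewrite /move_to sub0r -addrA -scalerDl addrC [_ + s * _]addrC addrC.
have dl s : 0 <= s <= 1 -> derivable f (move_to t 0 + (s * t 0 a) *: 'e_a) 'e_a.
  by move=> /H[+ _]; rewrite E.
have [s s01] := MVT_line dl.
rewrite -[X in _ + X]mul1r [1 * _]mul1r -[t 0 a in LHS]mul1r E mul1r move_to_self f0 subr0 => ->.
by rewrite normrM ler_wpM2l// E; exact: (H s s01).2.
Qed.

Section Continuous.
Context (f : 'rV[R]_n.+1 -> R).
Hypothesis cf : forall t, B t -> {for t, continuous f}.

Lemma integral_lineP t : B t ->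
  primitive (fun s => f (move_to t s)) 0 = 0 /\
  forall s : R, `|s| < delta ->
  is_derive s 1 (primitive (fun s => f (move_to t s))) (f (move_to t s)).
Proof.
move=> Bt; apply: primitiveP => s sd.
apply: (@continuous_comp _ _ _ (move_to t) f); last exact/cf/ball_move_to.
apply/continuous_row => i.
have [ia|ia] := eqVneq i a.
  rewrite (_ : (fun _ => _) = id); first exact: cvg_id.
  by apply/funext => u; rewrite move_toE ia eqxx.
rewrite (_ : (fun _ => _) = cst (t 0 i)); first exact: cst_continuous.
by apply/funext => u; rewrite move_toE (negbTE ia).
Qed.

Lemma is_derive_integral t : B t -> is_derive t 'e_a (integral f) (f t).
Proof.
move=> Bt; have /ball0_row[d0 /(_ a) ta] := Bt.
have [_ /(_ _ ta)] := integral_lineP Bt.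
rewrite move_to_self => -[dp Ep].
apply: is_derive_eps => e /(derive_eps dp)[r r0 Hr]; exists r => // h /Hr.
rewrite Ep /integral -[h *: (1 : R^o)]/(h * 1) mulr1.
have -> : (fun s => f (move_to (t + h *: 'e_a) s)) = (fun s => f (move_to t s)).
  by apply/funext => s; rewrite move_to_shift.
by rewrite !mxE !eqxx mulr1.
Qed.

Lemma integral_base t : B t -> t 0 a = 0 -> integral f t = 0.
Proof.
move=> Bt ta; rewrite /integral ta.
by have [] := integral_lineP Bt.
Qed.

End Continuous.
End Integral.

Section IntegralSmooth.
Context {R : realType} {n : nat} (delta : R) (a : 'I_n.+1).
Implicit Types (f g : 'rV[R]_n.+1 -> R) (t : 'rV[R]_n.+1).
Local Notation B := (ball (0 : 'rV[R]_n.+1) delta).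
Local Notation J := (integral delta a).

(** Bounds on all the derivatives are included so that Picard iterates can be
estimated on the whole ball; on a smaller ball they come for free. *)
Definition bsmooth {n} delta (f : 'rV[R]_n.+1 -> R) :=
  Cinf (ball (0 : 'rV[R]_n.+1) delta) (Cb (ball (0 : 'rV[R]_n.+1) delta)) (fun _ : unit => f).

Let oB : open B. Proof. exact: ball_open. Qed.
Let HB := Cb_is_class (I := unit) oB.

Lemma bsmoothP f : bsmooth delta f <->
  (smooth_on B f /\ forall s, exists C, forall t, B t -> `|partials s f t| <= C).
Proof.
rewrite /bsmooth (CinfP HB); split=> [sf|[sf bf] s].
  split=> [s m Bm|s]; last by have [[_ /(_ tt)]] := sf s.
  by have [[cf _] df] := sf s; split=> [|i]; [exact: (cf tt)|exact: (df tt)].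
split=> [|k t i Bt]; last by have [_] := sf s t Bt; exact.
split=> [k t Bt|_]; last exact: bf.
by have [] := sf s t Bt.
Qed.

Lemma bsmooth_partial f i : bsmooth delta f -> bsmooth delta (partial i f).
Proof. exact: Cinf_partial. Qed.

Lemma bsmooth_bound f : bsmooth delta f -> exists2 C, 0 < C & forall t, B t -> `|f t| <= C.
Proof.
move=> /bsmoothP[_ /(_ [::])[C HC]]; exists (`|C| + 1); first by rewrite ltr_wpDl.
by move=> t /HC H; rewrite (le_trans H)// (le_trans (ler_norm C))// lerDl.
Qed.

Lemma bsmooth_continuous f : bsmooth delta f -> forall t, B t -> {for t, continuous f}.
Proof. by move=> /bsmoothP[sf _] t; exact: smooth_continuous. Qed.

Lemma bsmooth_derivable f : bsmooth delta f -> forall t i, B t -> derivable f t 'e_i.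
Proof. by move=> /bsmoothP[sf _] t i; exact: smooth_derivable. Qed.

(** Meant for integrals, whose partial derivatives are known before their
continuity is. *)
Lemma bounded_derivative_continuous f C :
  (forall t i, B t -> derivable f t 'e_i /\ `|partial i f t| <= C) ->
  forall t, B t -> {for t, continuous f}.
Proof.
move=> H t Bt; apply/continuous_eps => e e0.
have [r r0 Hr] : exists2 r, 0 < r & forall s, ball t r s -> B s.
  by apply: near_ball; move: oB; rewrite openE => /(_ _ Bt).
have C0 : 0 <= C by have [_] := H t ord0 Bt; exact: le_trans.
pose K := C * n.+1%:R + 1.
have K0 : 0 < K by rewrite ltr_wpDl// mulr_ge0.
apply/nbhs_ballP; exists (Num.min r (e / K)) => [|s ts].
  by rewrite /= lt_min r0 divr_gt0.
have Bs : B s by apply: Hr; apply: le_ball ts; rewrite ge_min lexx.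
have /= := C1_estimate (m := 0) (r := delta) (f := f) (c := fun=> 0) (eps := fun=> C) _ Bt Bs.
have ts' : `|s - t| <= e / K.
  move: ts; rewrite -ball_normE/ball_/= distrC => /ltW ts.
  by rewrite (le_trans ts)// ge_min lexx orbT.
rewrite (eq_bigr (fun=> 0)); last by move=> i _; rewrite mul0r.
rewrite big1_eq subr0 distrC => /(_ _)/le_trans; apply.
  by move=> u Bu i; have [? ?] := H u i Bu; rewrite subr0.
apply: (@le_trans _ _ (\sum_(i < n.+1) C * `|s - t|)).
  apply: ler_sum => i _; rewrite ler_wpM2l//.
  by have := norm_coord_le (s - t) i; rewrite !mxE.
rewrite sumr_const card_ord -mulr_natr mulrAC.
apply: (@le_trans _ _ (K * (e / K))).
  by rewrite ler_pM ?mulr_ge0// /K lerDl.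
by rewrite mulrC divfK// gt_eqF.
Qed.

Lemma integral_bound f C : bsmooth delta f -> (forall t, B t -> `|f t| <= C) ->
  forall t, B t -> `|J f t| <= delta * C.
Proof.
move=> sf fC t Bt; have cf := bsmooth_continuous sf.
have /ball0_row[d0 /(_ a) ta] := Bt.
have C0 : 0 <= C by apply: le_trans (fC t Bt).
apply: (@le_trans _ _ (`|t 0 a| * C)); last by rewrite ler_wpM2r// ltW.
apply: bound_from_base => [s s01|].
  have Bs : B (move_to a t (s * t 0 a)).
    apply: ball_move_to => //; apply: le_lt_trans ta.
    by move/andP: s01 => [s0 s1]; rewrite normrM ger0_norm// ler_piMl.
  have [d E] := is_derive_integral a cf Bs; split=> //.
  by rewrite /partial E fC.
have B0 : B (move_to a t 0) by apply: ball_move_to => //; rewrite normr0.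
by apply: integral_base => //; rewrite move_toE eqxx.
Qed.

(** Differentiation under the integral sign. The error of the first-order
expansion of the integral vanishes on the hyperplane t_a = 0, and its
derivative in the direction a is the error for f, which is at most h^2 times a
bound for the second derivative. *)
Lemma is_derive_integral_other f l t : bsmooth delta f -> l != a -> B t ->
  is_derive t 'e_l (J f) (J (partial l f) t).
Proof.
move=> sf la Bt.
have sp := bsmooth_partial l sf; have spp := bsmooth_partial l sp.
have [C C0 HC] := bsmooth_bound spp.
have cf := bsmooth_continuous sf; have cp := bsmooth_continuous sp.
have /ball0_row[d0 Ht] := Bt; have ta := Ht a.
apply: is_derive_eps => e e0.
have K0 : 0 < delta * C by rewrite mulr_gt0.
exists (Num.min (delta - `|t 0 l|) (e / (delta * C))) => [|h].
  by rewrite lt_min subr_gt0 Ht divr_gt0.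
rewrite lt_min => /andP[hd he].
have Bsh u s : B u -> `|u 0 l| <= `|t 0 l| -> `|s| <= `|h| -> B (u + s *: 'e_l).
  move=> /ball0_row[_ Hu] ul sh; apply/ball0_row; split=> // i; rewrite !mxE eqxx/=.
  have [->|il] := eqVneq i l; last by rewrite mulr0 addr0.
  by rewrite mulr1 (le_lt_trans (ler_normD _ _))//; lra.
have Bm s : `|s| < delta -> B (move_to a t s) by exact: ball_move_to.
have ml s : `|(move_to a t s) 0 l| <= `|t 0 l| by rewrite move_toE (negbTE la).
(* The error of the first-order expansion of the integral in the direction l.
*)
pose Psi u := J f (u + h *: 'e_l) - J f u - h *: J (partial l f) u.
have shift u s : u + h *: 'e_l + s *: 'e_a = u + s *: 'e_a + h *: 'e_l.
  by rewrite addrAC.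
have dPsi s : `|s| < delta -> let u := move_to a t s in
    is_derive u 'e_a Psi (f (u + h *: 'e_l) - f u - h * partial l f u).
  move=> sd u; have Bu : B u := Bm s sd.
  have Buh : B (u + h *: 'e_l) by exact: Bsh (ml s) _.
  have [d1 E1] := is_derive_integral a cf Bu.
  have [d2 E2] := is_derive_integral a cp Bu.
  have [d3 E3] := is_derive_integral a cf Buh.
  have dsh : is_derive u 'e_a (fun u => J f (u + h *: 'e_l)) (f (u + h *: 'e_l)).
    apply: is_derive_eps => e' e'0; have [r r0 Hr] := derive_eps d3 e'0.
    by exists r => // k /Hr; rewrite E3 shift.
  have d2' : is_derive u 'e_a (fun u => h *: J (partial l f) u) (h *: partial l f u).
    by apply: is_deriveZ.
  by have := is_deriveB (is_deriveB dsh (DeriveDef d1 E1)) d2'; apply.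
have : `|Psi t| <= `|t 0 a| * (`|h| * (`|h| * C)).
  apply: bound_from_base => [s s01|].
    have sd : `|s * t 0 a| < delta.
      apply: le_lt_trans ta.
      by move/andP: s01 => [s0 s1]; rewrite normrM ger0_norm// ler_piMl.
    have [d E] := dPsi _ sd; split=> //; rewrite /partial E.
    set u := move_to a t _ in d E *; have Bu : B u := Bm _ sd.
    have hh s' : 0 <= s' <= 1 -> `|s' * h| <= `|h|.
      by move=> /andP[s0 s1]; rewrite normrM ger0_norm// ler_piMl.
    have d1 s' : 0 <= s' <= 1 -> derivable f (u + (s' * h) *: 'e_l) 'e_l.
      by move=> /hh sh; apply: (bsmooth_derivable sf); exact: Bsh (ml _) sh.
    have [c c01 ->] := MVT_line d1.
    have hc s' : 0 <= s' <= 1 -> `|s' * (c * h)| <= `|h|.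
      move=> /andP[s0 s1]; apply: le_trans (hh c c01).
      by rewrite normrM ger0_norm// ler_piMl.
    have d2 s' : 0 <= s' <= 1 ->
        derivable (partial l f) (u + (s' * (c * h)) *: 'e_l) 'e_l.
      by move=> /hc sh; apply: (bsmooth_derivable sp); exact: Bsh (ml _) sh.
    rewrite -mulrBr normrM ler_wpM2l//.
    have [c' c'01 E'] := MVT_line d2.
    rewrite -/(partial l f _) E'; rewrite normrM ler_pM// ?hh// HC//; exact: Bsh (ml _) (hc _ c'01).
  have z0 : `|0 : R| < delta by rewrite normr0.
  have B0 := Bm _ z0; have B0h := Bsh _ h B0 (ml _) (lexx _).
  have m0 : move_to a t 0 0 a = 0 by rewrite move_toE eqxx.
  have m0h : (move_to a t 0 + h *: 'e_l) 0 a = 0.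
    by rewrite mxE m0 !mxE eqxx/= eq_sym (negbTE la) mulr0 addr0.
  rewrite /Psi (integral_base cf B0h m0h) (integral_base cf B0 m0).
  by rewrite (integral_base cp B0 m0) scaler0 !subrr.
move=> /le_trans; apply; rewrite mulrA [leLHS]mulrA.
apply: (@le_trans _ _ (delta * C * `|h| * `|h|)).
  rewrite (_ : _ * C = `|t 0 a| * (C * `|h| * `|h|)); last by ring.
  by rewrite -!mulrA ler_wpM2r ?mulr_ge0 ?(ltW C0)// ltW.
by rewrite ler_wpM2r// mulrC -ler_pdivlMr// ltW.
Qed.

(** A derivative of the integral is f itself in the direction a, and the
integral of a derivative of f in the others: induction on the order. *)
Lemma bsmooth_integral f : bsmooth delta f -> bsmooth delta (J f).
Proof.
move: f; have dJ f t i : bsmooth delta f -> B t ->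
    is_derive t 'e_i (J f) (if i == a then f t else J (partial i f) t).
  move=> sf Bt; case: eqVneq => [->|ia]; last exact: is_derive_integral_other.
  by apply: is_derive_integral => // u; exact: bsmooth_continuous.
have CJ f : bsmooth delta f -> Cb B (fun _ : unit => J f).
  move=> sf; split=> [_|_]; last first.
    by have [C _ HC] := bsmooth_bound sf; exists (delta * C); exact: integral_bound.
  have /choice[D HD] : forall i, exists D, 0 <= D /\
      forall t, B t -> `|partial i (J f) t| <= D.
    move=> i; have [C C0 HC] := bsmooth_bound sf.
    have [C' C'0 HC'] := bsmooth_bound (bsmooth_partial i sf).
    have D0 : 0 <= `|delta| * C' by rewrite mulr_ge0// ltW.
    exists (C + `|delta| * C'); split=> [|t Bt]; first by rewrite addr_ge0// ltW.
    rewrite /partial (dJ f t i sf Bt).(derive_val); case: ifP => _.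
      by rewrite (le_trans (HC t Bt))// lerDl.
    rewrite (le_trans (integral_bound (bsmooth_partial i sf) HC' Bt))//.
    rewrite (@le_trans _ _ (`|delta| * C'))//; last by rewrite lerDr ltW.
    by rewrite ler_wpM2r ?ler_norm// ltW.
  apply: (@bounded_derivative_continuous _ (\sum_i D i)) => t i Bt.
  split; first by case: (dJ f t i sf Bt).
  have [_ /(_ t Bt) Hi] := HD i; apply: le_trans Hi _.
  by rewrite (bigD1 i)//= lerDl sumr_ge0// => j _; have [] := HD j.
move=> f sf r; elim: r f sf => [|r IH] f sf; split=> //; try exact: CJ.
split=> [k t i Bt|i]; first by case: (dJ f t i sf Bt).
have [ia|ia] := eqVneq i a.
  apply: (Cr_ext HB _ (sf r)) => k t Bt.
  by rewrite /partial (dJ f t i sf Bt).(derive_val) ia eqxx.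
apply: (Cr_ext HB _ (IH _ (bsmooth_partial i sf))) => k t Bt.
by rewrite [RHS]/partial (dJ f t i sf Bt).(derive_val) (negbTE ia).
Qed.

End IntegralSmooth.

(** * Linear integral equations *)

Lemma uniform_constant {R : realType} (J : finType) (Q : J -> R -> Prop) :
  (forall j C D, C <= D -> Q j C -> Q j D) ->
  (forall j, exists2 C, 0 <= C & Q j C) ->
  exists2 C, 0 <= C & forall j, Q j C.
Proof.
move=> mono H; have /choice[D HD] : forall j, exists C, 0 <= C /\ Q j C.
  by move=> j; have [C C0 QC] := H j; exists C.
exists (\sum_j D j) => [|j]; first by rewrite sumr_ge0// => j _; have [] := HD j.
apply: mono (HD j).2; rewrite (bigD1 j)//= lerDl sumr_ge0// => i _.
by have [] := HD i.
Qed.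

Lemma is_derive_sumf {R : realType} {V : normedModType R} (J : Type) (s : seq J)
    (Q : pred J) (F : J -> V -> R) t v (l : J -> R) :
  (forall j, is_derive t v (F j) (l j)) ->
  is_derive t v (fun u => \sum_(j <- s | Q j) F j u) (\sum_(j <- s | Q j) l j).
Proof.
move=> dF; elim: s => [|j s IH].
  rewrite big_nil (_ : (fun _ => _) = cst 0); first exact: is_derive_cst.
  by apply/funext => u; rewrite big_nil.
rewrite big_cons; have [Qj|Qj] := boolP (Q j).
  rewrite (_ : (fun _ => _) = F j \+ fun u => \sum_(j <- s | Q j) F j u).
    exact: is_deriveD.
  by apply/funext => u; rewrite big_cons Qj.
by rewrite (_ : (fun _ => _) = fun u => \sum_(j <- s | Q j) F j u)//;
  apply/funext => u; rewrite big_cons (negbTE Qj).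
Qed.

Lemma is_derive_mul {R : realType} {V : normedModType R} (f g : V -> R) t v (l k : R) :
  is_derive t v f l -> is_derive t v g k ->
  is_derive t v (fun u => f u * g u) (f t * k + g t * l).
Proof. by move=> df dg; exact: is_deriveM. Qed.

Section BSmooth.
Context {R : realType} {n : nat} (delta : R) (a : 'I_n.+1).
Implicit Types (f g : 'rV[R]_n.+1 -> R) (t : 'rV[R]_n.+1).
Local Notation B := (ball (0 : 'rV[R]_n.+1) delta).
Local Notation J := (integral delta a).

Let oB : open B. Proof. exact: ball_open. Qed.
Let HB := Cb_is_class (I := unit) oB.
Let HG := Cg_is_class oB.

Lemma bsmooth_sub f (delta' : R) : delta <= delta' -> bsmooth delta' f -> bsmooth delta f.
Proof.
move=> dd /bsmoothP[sf bf]; apply/bsmoothP; split.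
  by apply: smooth_sub sf => t; exact: le_ball.
by move=> s; have [C HC] := bf s; exists C => t Bt; apply: HC; exact: le_ball Bt.
Qed.

Lemma bsmooth_geometric f : bsmooth delta f -> Cinf B (Cg B) (fun=> f).
Proof.
move=> /bsmoothP[sf bf]; apply/(CinfP HG) => s; split=> [|k t i Bt].
  split=> [k t Bt|]; first by have [] := sf s t Bt.
  have [C HC] := bf s; exists `|C| => // k t Bt; rewrite subrr normr0.
  by rewrite mulr_ge0 ?exprn_ge0// (le_trans (HC t Bt))// ler_norm.
by have [_] := sf s t Bt; exact.
Qed.

(** Convergence does not depend on the first term of a sequence. *)
Lemma Cg_shift F : Cg B (fun k => F k.+1) -> Cb B (fun _ : unit => F 0%N) -> Cg B F.
Proof.
move=> [cF [C C0 HC]] [c0 /(_ tt)[D HD]]; split=> [[|k] t Bt|].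
- exact: (c0 tt).
- exact: cF.
pose E := `|D| + C; have E0 : 0 <= E by rewrite addr_ge0.
have DE : D <= E by rewrite (le_trans (ler_norm D))// lerDl.
have CE : C <= E by rewrite lerDr.
exists (2 * E) => [|[|k] t Bt]; first by rewrite mulr_ge0.
  have [H1 _] := HC 0%N t Bt; have H2 := HD t Bt; split; first lra.
  rewrite expr0 mulr1 (le_trans (ler_normB _ _))//; lra.
have [H1 H2] := HC k t Bt; split; first lra.
rewrite (le_trans H2)// exprS mulrA ler_wpM2r ?exprn_ge0//; lra.
Qed.

(** The derivative in the direction a of an iterate is the right-hand side
evaluated at the preceding iterate, so estimates are obtained for the shifted
sequence. *)
Lemma Cr_shift r F : Cr B (Cg B) r (fun k => F k.+1) -> bsmooth delta (F 0%N) ->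
  Cr B (Cg B) r F.
Proof.
elim: r F => [|r IH] F [gF HF] s0; split=> //; try by apply: Cg_shift => //; exact: (s0 0%N).1.
case: HF => dF pF; split=> [[|k] t i Bt|i].
- exact: bsmooth_derivable s0 _ _ Bt.
- exact: dF.
by apply: IH; [exact: pF | exact: bsmooth_partial].
Qed.

Lemma integral_sub_bound f g C : bsmooth delta f -> bsmooth delta g ->
  (forall t, B t -> `|f t - g t| <= C) ->
  forall t, B t -> `|J f t - J g t| <= delta * C.
Proof.
move=> sf sg fC t Bt; have cf := bsmooth_continuous sf; have cg := bsmooth_continuous sg.
have /ball0_row[d0 /(_ a) ta] := Bt.
have C0 : 0 <= C by apply: le_trans (fC t Bt).
apply: (@le_trans _ _ (`|t 0 a| * C)); last by rewrite ler_wpM2r// ltW.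
apply: (bound_from_base (f := fun u => J f u - J g u)) => [s s01|].
  have Bs : B (move_to a t (s * t 0 a)).
    apply: ball_move_to => //; apply: le_lt_trans ta.
    by move/andP: s01 => [s0 s1]; rewrite normrM ger0_norm// ler_piMl.
  have [d E] := is_deriveB (is_derive_integral a cf Bs) (is_derive_integral a cg Bs).
  by split=> //; rewrite /partial E fC.
have B0 : B (move_to a t 0) by apply: ball_move_to => //; rewrite normr0.
by rewrite !integral_base ?subrr// move_toE eqxx.
Qed.

Lemma integral_ext f g : bsmooth delta f -> bsmooth delta g ->
  (forall t, B t -> f t = g t) -> forall t, B t -> J f t = J g t.
Proof.
move=> sf sg fg t Bt; apply/eqP; rewrite -subr_eq0 -normr_le0 -(mulr0 delta).
by apply: integral_sub_bound => // u Bu; rewrite fg// subrr normr0.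
Qed.

Lemma bsmooth_partial_ext f g i t : (forall t, B t -> f t = g t) -> B t ->
  partial i f t = partial i g t.
Proof.
move=> fg Bt; apply: near_eq_derive.
by move: (Bt); have := oB; rewrite openE => oB' /oB'; apply: filterS.
Qed.

Lemma bsmooth_is_derive f i t : bsmooth delta f -> B t -> is_derive t 'e_i f (partial i f t).
Proof. by move=> sf Bt; apply: derivableP; exact: bsmooth_derivable. Qed.

Lemma bsmooth_move_to f : bsmooth delta f -> bsmooth delta (fun t => f (move_to a t 0)).
Proof.
have B0 t : B t -> B (move_to a t 0).
  by move=> Bt; apply: ball_move_to => //; have /ball0_row[? _] := Bt; rewrite normr0.
move: f; have dD f t l : bsmooth delta f -> B t -> is_derive t 'e_l (fun t => f (move_to a t 0))
    (if l == a then 0 else partial l f (move_to a t 0)).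
  move=> sf Bt; apply: is_derive_eps => e e0; case: eqVneq => [->|la].
    exists 1 => // h _; rewrite move_to_shift subrr scaler0 subrr normr0.
    by rewrite mulr_ge0// ltW.
  have [r r0 Hr] := derive_eps (bsmooth_derivable (i := l) sf (B0 t Bt)) e0.
  exists r => // h /Hr; rewrite (_ : move_to a (t + _) 0 = move_to a t 0 + h *: 'e_l)//.
  apply/rowP => i; rewrite !(move_toE, mxE) eqxx/=.
  by case: eqVneq => // ->; rewrite eq_sym (negbTE la) mulr0 addr0.
have cD f : bsmooth delta f -> Cb B (fun _ : unit => fun t => f (move_to a t 0)).
  move=> sf; split=> [_ t Bt|_].
    apply: (@continuous_comp _ _ _ (move_to a ^~ 0) f).
      apply/continuous_row => i; rewrite (_ : (fun _ => _) = fun t : 'rV[R]_n.+1 => if i == a then 0 else t 0 i).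
        case: (i == a); [exact: cst_continuous|exact: coord_continuous].
      by apply/funext => u; rewrite move_toE.
    by apply: bsmooth_continuous => //; exact: B0.
  by have [C _ HC] := bsmooth_bound sf; exists C => t /B0; exact: HC.
move=> f sf r; elim: r f sf => [|r IH] f sf; split=> //; try exact: cD.
split=> [k t l Bt|l]; first by case: (dD f t l sf Bt).
have [la|la] := eqVneq l a.
  apply: (Cr_ext HB _ (Cr_cst HB 0 r)) => k t Bt.
  by rewrite /partial (dD f t l sf Bt).(derive_val) la eqxx.
apply: (Cr_ext HB _ (IH _ (bsmooth_partial l sf))) => k t Bt.
by rewrite [RHS]/partial (dD f t l sf Bt).(derive_val) (negbTE la).
Qed.

End BSmooth.

Section Linear.
Context {R : realType} {n d : nat} (delta : R) (a : 'I_n.+1).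
Implicit Types (f g : 'rV[R]_n.+1 -> R) (t : 'rV[R]_n.+1).
Local Notation B := (ball (0 : 'rV[R]_n.+1) delta).
Local Notation J := (integral delta a).
Local Notation q := (3 / 4 : R).

Let oB : open B. Proof. exact: ball_open. Qed.
Let HB := Cb_is_class (I := unit) oB.
Let HG := Cg_is_class oB.

Hypothesis d0 : 0 < delta.

(** The right-hand side of the system W' = A W + b, with coefficients that
vary with the step k of the iteration. *)
Definition linear_rhs (A : 'I_d.+1 -> 'I_d.+1 -> nat -> 'rV[R]_n.+1 -> R)
    (b W : 'I_d.+1 -> nat -> 'rV[R]_n.+1 -> R) i k t :=
  \sum_j A i j k t * W j k t + b i k t.

(** The linear part of the integral operator has norm at most 1/2, and
coefficients converging at the rate q ^+ k add an error K q ^+ k at step k. An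
increment at most C q ^+ k leads to a next one at most (C / 2 + K) q ^+ k,
which is at most C q ^+ k.+1 for C = 4 K and beyond. *)
Lemma linear_iterates_Cg A b W (w0 : 'I_d.+1 -> 'rV[R]_n.+1 -> R) :
  (forall i, bsmooth delta (w0 i)) ->
  (forall i k, bsmooth delta (W i k)) ->
  (forall i k, bsmooth delta (linear_rhs A b W i k)) ->
  (forall i k t, B t -> W i k.+1 t = w0 i t + J (linear_rhs A b W i k) t) ->
  (forall i k t, B t -> delta * (\sum_j `|A i j k t|) <= 1 / 2) ->
  (forall i j, Cg B (A i j)) -> (forall i, Cg B (b i)) ->
  forall i, Cg B (W i).
Proof.
move=> sw sW sR WE small gA gb.
pose bd (F : nat -> 'rV[R]_n.+1 -> R) C :=
  forall k t, B t -> `|F k t| <= C /\ `|F k.+1 t - F k t| <= C * q ^+ k.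
have qk k : 0 <= q ^+ k by rewrite exprn_ge0.
have bd_mono F C D : C <= D -> bd F C -> bd F D.
  move=> CD H k t Bt; have [H1 H2] := H k t Bt; split; first exact: le_trans CD.
  by rewrite (le_trans H2)// ler_wpM2r.
have [CA CA0 HA] : exists2 C, 0 <= C & forall ij, bd (A ij.1 ij.2) C.
  apply: uniform_constant => [ij|[i j]]; first exact: bd_mono.
  by have [_ [C C0 HC]] := gA i j; exists C.
have [Cc Cc0 HC] : exists2 C, 0 <= C & forall i, bd (b i) C.
  apply: uniform_constant => [i|i]; first exact: bd_mono.
  by have [_ [C C0 HC]] := gb i; exists C.
have [M0 M00 HM0] : exists2 C, 0 <= C & forall i t, B t -> `|w0 i t| <= C /\ `|W i 0%N t| <= C.
  apply: (@uniform_constant _ _ (fun i C => forall t, B t -> `|w0 i t| <= C /\ `|W i 0%N t| <= C)).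
    by move=> i C D CD H t Bt; have [H1 H2] := H t Bt; split; exact: le_trans CD.
  move=> i; have [C C0 HC'] := bsmooth_bound (sw i).
  have [D D0 HD] := bsmooth_bound (sW i 0%N).
  exists (C + D) => [|t Bt]; first by rewrite addr_ge0 ?(ltW C0) ?(ltW D0).
  by have := HC' t Bt; have := HD t Bt; split; lra.
pose M := 2 * (M0 + delta * Cc).
have dC : 0 <= delta * Cc by rewrite mulr_ge0// ltW.
have M1 : M0 <= M by rewrite /M; lra.
have M_ge0 : 0 <= M by rewrite (le_trans M00).
have sumA i k t : B t -> \sum_j `|A i j k t| <= (2 * delta)^-1.
  move=> /(small i k); rewrite mulrC -ler_pdivlMr// div1r => /le_trans; apply.
  by rewrite invfM.
have WM k : forall i t, B t -> `|W i k t| <= M.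
  elim: k => [|k IH] i t Bt; first by apply: le_trans (HM0 i t Bt).2 M1.
  rewrite WE// (le_trans (ler_normD _ _))//.
  have : `|J (linear_rhs A b W i k) t| <= delta * ((2 * delta)^-1 * M + Cc).
    apply: integral_bound => // u Bu; rewrite (le_trans (ler_normD _ _))// lerD//.
      rewrite (le_trans (ler_norm_sum _ _ _))//.
      apply: (@le_trans _ _ (\sum_j `|A i j k u| * M)).
        by apply: ler_sum => j _; rewrite normrM ler_wpM2l// IH.
      by rewrite -mulr_suml ler_wpM2r// sumA.
    by have [] := HC i k u Bu.
  have -> : delta * ((2 * delta)^-1 * M + Cc) = M / 2 + delta * Cc.
    by field; rewrite gt_eqF.
  have [H _] := HM0 i t Bt; rewrite /M; lra.
have sumn (C : R) : \sum_(j < d.+1) C = d.+1%:R * C.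
  by rewrite sumr_const card_ord mulr_natl.
pose K := delta * (d.+1%:R * (CA * M) + Cc).
have K0 : 0 <= K.
  exact: mulr_ge0 (ltW d0) (addr_ge0 (mulr_ge0 (ler0n _ _) (mulr_ge0 CA0 M_ge0)) Cc0).
pose C' := 4 * K + 2 * M.
have C'0 : 0 <= C' by rewrite /C'; lra.
have diff k : forall i t, B t -> `|W i k.+1 t - W i k t| <= C' * q ^+ k.
  elim: k => [|k IH] i t Bt.
    rewrite expr0 mulr1 (le_trans (ler_normB _ _))//.
    have := WM 1%N i t Bt; have := WM 0%N i t Bt; rewrite /C'; lra.
  rewrite (WE i k.+1 t Bt) (WE i k t Bt) [X in `|X - _|]addrC addrKA.
  have : `|J (linear_rhs A b W i k.+1) t - J (linear_rhs A b W i k) t| <=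
     delta * ((2 * delta)^-1 * (C' * q ^+ k) + (d.+1%:R * (CA * M) + Cc) * q ^+ k).
    apply: integral_sub_bound => // u Bu.
    have -> : linear_rhs A b W i k.+1 u - linear_rhs A b W i k u =
      \sum_j A i j k.+1 u * (W j k.+1 u - W j k u) +
      (\sum_j (A i j k.+1 u - A i j k u) * W j k u + (b i k.+1 u - b i k u)).
      rewrite /linear_rhs addrA -big_split/= opprD addrACA -sumrB; congr (_ + _).
      by apply: eq_bigr => j _; ring.
    rewrite (le_trans (ler_normD _ _))// lerD//.
      rewrite (le_trans (ler_norm_sum _ _ _))//.
      apply: (@le_trans _ _ (\sum_j `|A i j k.+1 u| * (C' * q ^+ k))).
        by apply: ler_sum => j _; rewrite normrM ler_wpM2l// IH.
      by rewrite -mulr_suml ler_wpM2r ?mulr_ge0// sumA.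
    rewrite (le_trans (ler_normD _ _))// mulrDl lerD//; last by have [] := HC i k u Bu.
    rewrite (le_trans (ler_norm_sum _ _ _))// -mulrA -sumn ler_sum// => j _.
    rewrite normrM mulrAC; apply: ler_pM => //; last exact: WM.
    by have [] := HA (i, j) k u Bu.
  have -> : delta * ((2 * delta)^-1 * (C' * q ^+ k) +
      (d.+1%:R * (CA * M) + Cc) * q ^+ k) = (C' / 2 + K) * q ^+ k.
    by rewrite /K; field; rewrite gt_eqF.
  move=> /le_trans; apply; rewrite exprS mulrA ler_wpM2r// /C'; lra.
move=> i; split=> [k t Bt|]; first exact: bsmooth_continuous (sW i k) _ Bt.
exists (M + C') => [|k t Bt]; first by rewrite addr_ge0.
split; first by rewrite (le_trans (WM k i t Bt))// lerDl.
by rewrite (le_trans (diff k i t Bt))// ler_wpM2r// lerDr.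
Qed.

(** The derivatives of the iterates are again iterates of such an equation. In
the direction a they are the right-hand side; in the other directions,
differentiation under the integral sign keeps the matrix A and only changes b
into a term of lower order in W. *)
Lemma linear_iterates_Cr r A b W (w0 : 'I_d.+1 -> 'rV[R]_n.+1 -> R) :
  (forall i, bsmooth delta (w0 i)) ->
  (forall i k, bsmooth delta (W i k)) ->
  (forall i j k, bsmooth delta (A i j k)) -> (forall i k, bsmooth delta (b i k)) ->
  (forall i k t, B t -> W i k.+1 t = w0 i t + J (linear_rhs A b W i k) t) ->
  (forall i k t, B t -> delta * (\sum_j `|A i j k t|) <= 1 / 2) ->
  (forall i j, Cr B (Cg B) r (A i j)) -> (forall i, Cr B (Cg B) r (b i)) ->
  forall i, Cr B (Cg B) r (W i).
Proof.
have sRHS A' b' W' i k : (forall i j k, bsmooth delta (A' i j k)) ->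
    (forall i k, bsmooth delta (b' i k)) -> (forall i k, bsmooth delta (W' i k)) ->
    bsmooth delta (linear_rhs A' b' W' i k).
  move=> sA sb sW; apply: (CinfD HB); last exact: sb.
  by apply: (Cinf_sum HB) => j; apply: (CinfM HB); [exact: sA | exact: sW].
elim: r A b W w0 => [|r IH] A b W w0 sw sW sA sb WE small gA gb i.
  split=> //; apply: linear_iterates_Cg WE small _ _ i => //.
  - by move=> i k; exact: sRHS.
  - by move=> i j; exact: Cr0 (gA i j).
  - by move=> i; exact: Cr0 (gb i).
have gW : forall i, Cr B (Cg B) r (W i).
  apply: IH WE small _ _ => //; first by move=> *; exact: CrS.
  by move=> *; exact: CrS.
split; first exact: Cr0 (gW i).
split=> [k t l Bt|l]; first exact: bsmooth_derivable.
have dR i' k l' t : B t -> is_derive t 'e_l' (linear_rhs A b W i' k)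
    (\sum_j (A i' j k t * partial l' (W j k) t + W j k t * partial l' (A i' j k) t)
     + partial l' (b i' k) t).
  move=> Bt; apply: is_deriveD; last exact: bsmooth_is_derive.
  by apply: is_derive_sumf => j; apply: is_derive_mul; exact: bsmooth_is_derive.
have [->|la] := eqVneq l a.
  apply: Cr_shift; last exact: bsmooth_partial.
  apply: (Cr_ext HG (F := fun k t => partial a (w0 i) t + linear_rhs A b W i k t)).
    move=> k t Bt; rewrite (bsmooth_partial_ext (delta := delta) _ (WE i k) Bt).
    have cR : forall t, B t -> {for t, continuous (linear_rhs A b W i k)}.
      by apply: bsmooth_continuous; exact: sRHS.
    have := is_deriveD (bsmooth_is_derive a (sw i) Bt) (is_derive_integral a cR Bt).
    by move=> [_ E]; exact: esym.
  apply: (CrD HG).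
    by apply: Cr_partial; apply: bsmooth_geometric (sw i) _.
  apply: (CrD HG); last exact: CrS (gb i).
  by apply: (Cr_sum HG) => j; apply: (CrM HG); [exact: CrS (gA i j) | exact: gW].
pose b' i k t := \sum_j partial l (A i j k) t * W j k t + partial l (b i k) t.
have sb' i' k : bsmooth delta (b' i' k).
  apply: (CinfD HB); last exact: bsmooth_partial.
  apply: (Cinf_sum HB) => j.
  by apply: (CinfM HB); [exact: bsmooth_partial (sA i' j k) | exact: sW].
apply: (IH A b' (fun i k => partial l (W i k)) (fun i => partial l (w0 i))) => //.
- by move=> i'; exact: bsmooth_partial.
- by move=> i' k; exact: bsmooth_partial.
- move=> i' k t Bt; rewrite (bsmooth_partial_ext (delta := delta) _ (WE i' k) Bt).
  have sR : bsmooth delta (linear_rhs A b W i' k) by exact: sRHS.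
  have := is_deriveD (bsmooth_is_derive l (sw i') Bt)
    (is_derive_integral_other sR la Bt).
  move=> [_ E]; apply: (etrans E); congr (_ + _); apply: integral_ext => //.
  + exact: bsmooth_partial.
  + by apply: sRHS => // *; exact: bsmooth_partial.
  + move=> u Bu; rewrite {1}/partial (dR i' k l u Bu).(derive_val).
    rewrite /linear_rhs /b' addrA -big_split/=; congr (_ + _).
    by apply: eq_bigr => j _; congr (_ + _); rewrite mulrC.
- by move=> *; exact: CrS.
- move=> i'; apply: (CrD HG); last exact: Cr_partial.
  by apply: (Cr_sum HG) => j; apply: (CrM HG); [exact: Cr_partial | exact: gW].
Qed.

End Linear.

(** * Flows of smooth vector fields *)

(** The closed ball of half the radius is compact. The same rho serves all
functions and all orders. *)
Lemma smooth_local_bounds {R : realType} {d : nat} (O : set 'rV[R]_d.+1) m :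
  open O -> O m -> exists2 rho, 0 < rho & (forall y, ball m rho y -> O y) /\
  forall f : 'rV[R]_d.+1 -> R, smooth_on O f ->
  forall s, exists C, forall y, ball m rho y -> `|partials s f y| <= C.
Proof.
move=> oO Om; have [r r0 Hr] : exists2 r, 0 < r & forall s, ball m r s -> O s.
  by apply: near_ball; move: oO; rewrite openE => /(_ _ Om).
have r2 : r / 2 < r by rewrite ltr_pdivrMr// mulr_natr mulr2n ltrDl.
exists (r / 2); first by rewrite divr_gt0.
split=> [y my|f sf s]; first by apply: Hr; apply: le_ball my; exact: ltW.
pose K := closed_ball_ Num.norm m (r / 2).
have KO y : K y -> O y.
  by move=> Ky; apply: Hr; rewrite -ball_normE/ball_/=; exact: le_lt_trans Ky r2.
have bK : bounded_set K.
  exists (`|m| + r / 2); split; first exact: num_real.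
  move=> M /ltW rM y Ky /=; apply: le_trans rM.
  by rewrite -[y](subKr m) (le_trans (ler_normB _ _))// lerD2l.
have cK : compact K by apply: bounded_closed_compact => //; exact: closed_closed_ball_.
have cf : {within K, continuous (partials s f)}.
  apply: continuous_in_subspaceT => y; rewrite inE => /KO Oy.
  by have [] := sf s y Oy.
have /compact_bounded[C [_ HC]] := continuous_compact cf cK.
exists (C + 1) => y my; apply: (HC (C + 1)); [by rewrite ltrDl | exists y => //].
by move: my; rewrite -ball_normE/ball_/= => /ltW.
Qed.

Lemma bounded_lipschitz {R : realType} {d : nat} (f : 'rV[R]_d.+1 -> R) m rho C : smooth_on (ball m rho) f ->
  (forall i y, ball m rho y -> `|partial i f y| <= C) ->
  forall x y, ball m rho x -> ball m rho y ->
  `|f y - f x| <= \sum_i C * `|y 0 i - x 0 i|.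
Proof.
move=> sf bf x y mx my.
have /= := C1_estimate (m := m) (r := rho) (f := f) (c := fun=> 0) (eps := fun=> C) _ mx my.
rewrite (eq_bigr (fun=> 0)); last by move=> i _; rewrite mul0r.
rewrite big1_eq subr0; apply => t mt i; rewrite subr0; split; last exact: bf.
exact: smooth_derivable sf _.
Qed.

Lemma cvg_row {R : realType} {T : Type} {F : set_system T} {FF : Filter F} {m : nat}
    (f : T -> 'rV[R]_m) (v : 'rV[R]_m) :
  (forall j, (fun t => f t 0 j) @ F --> v 0 j) -> f @ F --> v.
Proof.
move=> cf; apply/cvgrPdist_le => e e0; near=> t; apply: row_norm_le; first exact: ltW.
move=> j; rewrite !mxE; move: j; near: t; apply: filter_forall => j.
by have /cvgrPdist_le := cf j; exact.
Unshelve. all: by end_near. Qed.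

Lemma smooth_partials {R : realType} {n : nat} {B : set 'rV[R]_n.+1}
    (f : 'rV[R]_n.+1 -> R) s : smooth_on B f -> smooth_on B (partials s f).
Proof. by move=> sf s'; have := sf (s' ++ s); rewrite /partials foldr_cat. Qed.

Section Flow.
Context {R : realType} {n d : nat} (delta : R) (a : 'I_n.+1).
Implicit Types (t : 'rV[R]_n.+1) (y : 'rV[R]_d.+1).
Local Notation B := (ball (0 : 'rV[R]_n.+1) delta).
Local Notation J := (integral delta a).
Local Notation q := (3 / 4 : R).

Let oB : open B. Proof. exact: ball_open. Qed.
Let HB := Cb_is_class (I := unit) oB.
Let HG := Cg_is_class oB.

Context (X : 'rV[R]_d.+1 -> 'rV[R]_d.+1) (m : 'rV[R]_d.+1) (rho CX L : R).
Local Notation Xc j := (fun y => X y 0 j).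
Context (w0 : 'rV[R]_n.+1 -> 'rV[R]_d.+1).
Hypotheses (d0 : 0 < delta) (rho0 : 0 < rho).
Hypothesis sX : forall j, smooth_on (ball m rho) (Xc j).
Hypothesis bX : forall s j, exists C, forall y, ball m rho y -> `|partials s (Xc j) y| <= C.
Hypothesis XC : forall j y, ball m rho y -> `|X y 0 j| <= CX.
Hypothesis XL : forall i j y, ball m rho y -> `|partial i (Xc j) y| <= L.
Hypothesis smallC : delta * CX <= rho / 4.
Hypothesis smallL : delta * (d.+1%:R * L) <= 1 / 2.
Hypothesis sw : forall j, bsmooth delta (fun t => w0 t 0 j).
Hypothesis w0m : forall t, B t -> `|w0 t - m| <= rho / 2.

Let iw t := w0 (move_to a t 0).

(** The initial values w0 are read on the hyperplane t_a = 0, and the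
coordinates other than a are parameters. *)
Fixpoint picard k : 'rV[R]_n.+1 -> 'rV[R]_d.+1 :=
  if k is k'.+1 then
    fun t => \row_j (iw t 0 j + J (fun u => X (picard k' u) 0 j) t)
  else iw.

Let siw j : bsmooth delta (fun t => iw t 0 j).
Proof. exact: (bsmooth_move_to a (sw j)). Qed.

Let Biw t : B t -> B (move_to a t 0).
Proof. by move=> Bt; apply: ball_move_to => //; rewrite normr0. Qed.

Let oM : open (ball m rho). Proof. exact: ball_open. Qed.

Let sComp (Phi : 'rV[R]_n.+1 -> 'rV[R]_d.+1) f :
  (forall j, bsmooth delta (fun t => Phi t 0 j)) ->
  (forall t, B t -> ball m rho (Phi t)) ->
  smooth_on (ball m rho) f ->
  (forall s, exists C, forall y, ball m rho y -> `|partials s f y| <= C) ->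
  bsmooth delta (fun t => f (Phi t)).
Proof.
move=> sP PM sf bf r.
apply: (Cr_comp HB (O := ball m rho) (X := f) (Phi := fun _ => Phi)) => //.
- move=> s; split=> [_ t Bt|_].
    apply: (@continuous_comp _ _ _ Phi (partials s f)).
      by apply/continuous_row => j; exact: bsmooth_continuous (sP j) _ Bt.
    by have [] := sf s _ (PM t Bt).
  by have [C HC] := bf s; exists C => t /PM; exact: HC.
- by move=> j; exact: sP.
Qed.

Lemma picard_inv k : (forall j, bsmooth delta (fun t => picard k t 0 j)) /\
  forall t, B t -> `|picard k t - m| <= 3 / 4 * rho.
Proof.
have r_gt0 := rho0; have sC := smallC.
elim: k => [|k [IH1 IH2]].
  split=> [//|t Bt]; rewrite (le_trans (w0m (Biw Bt)))//; lra.
have IH3 t : B t -> ball m rho (picard k t).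
  by move=> Bt; rewrite -ball_normE/ball_/= distrC (le_lt_trans (IH2 t Bt))//; lra.
have sXk j : bsmooth delta (fun t => X (picard k t) 0 j).
  by apply: (sComp (f := Xc j)) => // s; exact: bX.
split=> [j|t Bt].
  apply: (Cinf_ext HB (F := fun _ t => iw t 0 j + J (fun u => X (picard k u) 0 j) t)).
    by move=> _ t _; rewrite mxE.
  by apply: (CinfD HB); [exact: siw | exact: bsmooth_integral].
have r34 : 0 <= 3 / 4 * rho by rewrite mulr_ge0 ?ltW.
apply: row_norm_le => // j; rewrite !mxE addrAC.
have H1 : `|iw t 0 j - m 0 j| <= rho / 2.
  by apply: le_trans (w0m (Biw Bt)); have := norm_coord_le (iw t - m) j; rewrite !mxE.
have H2 : `|J (fun u => X (picard k u) 0 j) t| <= delta * CX.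
  by apply: integral_bound => // u Bu; apply: XC; exact: IH3.
rewrite (le_trans (ler_normD _ _))//; lra.
Qed.

Lemma picard_ball k t : B t -> ball m rho (picard k t).
Proof.
have r_gt0 := rho0.
move=> Bt; rewrite -ball_normE/ball_/= distrC (le_lt_trans ((picard_inv k).2 t Bt))//.
by lra.
Qed.

Lemma picard_bsmooth k (f : 'rV[R]_d.+1 -> R) : smooth_on (ball m rho) f ->
  (forall s, exists C, forall y, ball m rho y -> `|partials s f y| <= C) ->
  bsmooth delta (fun t => f (picard k t)).
Proof. by move=> sf bf; apply: sComp => //; [exact: (picard_inv k).1 | exact: picard_ball]. Qed.

Lemma picard_X k j : bsmooth delta (fun t => X (picard k t) 0 j).
Proof. by apply: (@picard_bsmooth k (Xc j)) => // s; exact: bX. Qed.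

Lemma picard_step k j t : B t ->
  `|picard k.+1 t 0 j - picard k t 0 j| <= 2 * rho * q ^+ k.
Proof.
have r_gt0 := rho0; have sL := smallL.
elim: k j t => [|k IH] j t Bt.
  have H i : `|picard i t 0 j - m 0 j| <= 3 / 4 * rho.
    apply: le_trans ((picard_inv i).2 t Bt).
    by have := norm_coord_le (picard i t - m) j; rewrite !mxE.
  rewrite expr0 mulr1 -(subrKA (m 0 j)) (le_trans (ler_normD _ _))//.
  rewrite [in X in _ + X]distrC; have := H 0%N; have := H 1%N; lra.
have E i : picard i.+1 t 0 j = iw t 0 j + J (fun u => X (picard i u) 0 j) t by rewrite mxE.
rewrite E (E k) [X in `|X - _|]addrC addrKA.
have L0 : 0 <= L by apply: le_trans (XL ord0 ord0 (picard_ball 0 Bt)).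
have : `|J (fun u => X (picard k.+1 u) 0 j) t - J (fun u => X (picard k u) 0 j) t|
    <= delta * (d.+1%:R * L * (2 * rho * q ^+ k)).
  apply: (integral_sub_bound a (picard_X k.+1 j) (picard_X k j) _ Bt).
  move=> u Bu; apply: le_trans (bounded_lipschitz (sX j) _ (picard_ball k Bu) (picard_ball k.+1 Bu)) _.
    by move=> i y; exact: XL.
  apply: (@le_trans _ _ (\sum_(i < d.+1) L * (2 * rho * q ^+ k))).
    by apply: ler_sum => i _; rewrite ler_wpM2l// IH.
  by rewrite sumr_const card_ord -[leLHS]mulr_natl mulrA.
move=> /le_trans; apply; rewrite mulrA exprS.
have -> : 2 * rho * (q * q ^+ k) = q * (2 * rho * q ^+ k) by ring.
rewrite ler_wpM2r ?mulr_ge0 ?exprn_ge0 ?(ltW rho0)//; lra.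
Qed.

Lemma picard_Cg (f : 'rV[R]_d.+1 -> R) : smooth_on (ball m rho) f ->
  (forall s, exists C, forall y, ball m rho y -> `|partials s f y| <= C) ->
  Cg B (fun k t => f (picard k t)).
Proof.
move=> sf bf; split=> [k t Bt|]; first exact: bsmooth_continuous (picard_bsmooth k sf bf) _ Bt.
have [C HC] := bf [::].
have [D D0 HD] : exists2 D, 0 <= D & forall i y, ball m rho y -> `|partial i f y| <= D.
  apply: (@uniform_constant _ _ (fun i D => forall y, ball m rho y -> `|partial i f y| <= D)).
    by move=> i D D' DD' H y /H /le_trans; apply.
  move=> i; have [D HD] := bf [:: i]; exists `|D| => // y my.
  by rewrite (le_trans (HD y my))// ler_norm.
pose E := `|C| + d.+1%:R * (D * (2 * rho)).
have E1 : 0 <= d.+1%:R * (D * (2 * rho)).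
  by rewrite mulr_ge0 ?ler0n// mulr_ge0// mulr_ge0// ltW.
exists E => [|k t Bt]; first by rewrite addr_ge0.
split.
  rewrite (le_trans (HC _ (picard_ball k Bt)))// (le_trans (ler_norm C))//.
  by rewrite lerDl.
apply: le_trans (bounded_lipschitz sf HD (picard_ball k Bt) (picard_ball k.+1 Bt)) _.
apply: (@le_trans _ _ (\sum_(i < d.+1) D * (2 * rho * q ^+ k))).
  by apply: ler_sum => i _; rewrite ler_wpM2l// picard_step.
rewrite sumr_const card_ord -[leLHS]mulr_natl.
have -> : d.+1%:R * (D * (2 * rho * q ^+ k)) = d.+1%:R * (D * (2 * rho)) * q ^+ k by ring.
by rewrite ler_wpM2r ?exprn_ge0// /E lerDr.
Qed.

Lemma iw_a j t : partial a (fun t => iw t 0 j) t = 0.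
Proof.
suff [_ E] : is_derive t 'e_a (fun t => iw t 0 j) 0 by exact: E.
apply: is_derive_eps => e e0; exists 1 => // h _.
by rewrite /iw move_to_shift subrr scaler0 subrr normr0 mulr_ge0// ltW.
Qed.

Lemma picard_is_derive k j l t : B t ->
  is_derive t 'e_l (fun t => picard k.+1 t 0 j)
    (partial l (fun t => iw t 0 j) t +
     (if l == a then X (picard k t) 0 j else
      J (partial l (fun t => X (picard k t) 0 j)) t)).
Proof.
move=> Bt; have sXk : bsmooth delta (fun t => X (picard k t) 0 j).
  exact: picard_X.
have -> : (fun t => picard k.+1 t 0 j) =
   (fun t => iw t 0 j) \+ J (fun t => X (picard k t) 0 j).
  by apply/funext => u; rewrite /= mxE.
apply: is_deriveD; first exact: (bsmooth_is_derive l (siw j) Bt).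
case: eqVneq => [->|la]; last exact: is_derive_integral_other.
by apply: is_derive_integral => // u; exact: bsmooth_continuous sXk _.
Qed.

(** The iterates converge because the operator contracts. A derivative of the
iterates in a direction other than a satisfies a linear integral equation
whose coefficients are derivatives of X at the iterates; those converge with
all derivatives up to the order already reached, and the order grows by one.
*)
Lemma picard_Cinf j : Cinf B (Cg B) (fun k t => picard k t 0 j).
Proof.
have r_gt0 := rho0.
have sXk i k : bsmooth delta (fun t => X (picard k t) 0 i).
  exact: picard_X.
have C0j i : Cg B (fun k t => picard k t 0 i).
  split=> [k t Bt|]; first exact: bsmooth_continuous ((picard_inv k).1 i) _ Bt.
  have E0 : 0 <= `|m| + 2 * rho by rewrite addr_ge0// mulr_ge0// ltW.
  exists (`|m| + 2 * rho) => [//|k t Bt]; split.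
    rewrite -[picard k t 0 i](subrK (m 0 i)) addrC (le_trans (ler_normD _ _))//.
    rewrite lerD ?norm_coord_le//; have := norm_coord_le (picard k t - m) i.
    by rewrite !mxE => /le_trans; apply; have := (picard_inv k).2 t Bt; lra.
  rewrite (le_trans (picard_step k i Bt))// ler_wpM2r ?exprn_ge0//.
  by rewrite lerDr.
move=> r; elim: r j => [|r IH] j; split=> //.
split=> [k t l Bt|l]; first by apply: bsmooth_derivable ((picard_inv k).1 j) _ _ Bt.
have CX' (f : 'rV[R]_d.+1 -> R) : smooth_on (ball m rho) f ->
    (forall s, exists C, forall y, ball m rho y -> `|partials s f y| <= C) ->
    Cr B (Cg B) r (fun k t => f (picard k t)).
  move=> sf bf; apply: (Cr_comp HG (O := ball m rho) (Phi := picard)) => //.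
    by move=> k t; exact: picard_ball.
  move=> s; apply: picard_Cg.
    exact: smooth_partials.
  by move=> s'; have [C HC] := bf (s' ++ s); exists C => y /HC; rewrite /partials foldr_cat.
have [->|la] := eqVneq l a.
  apply: Cr_shift; last by apply: bsmooth_partial; exact: (picard_inv 0%N).1.
  apply: (Cr_ext HG (F := fun k t => partial a (fun t => iw t 0 j) t + X (picard k t) 0 j)).
    move=> k t Bt; have [_ E] := picard_is_derive k j a Bt.
    by rewrite eqxx in E; exact: esym.
  apply: (CrD HG).
    by apply: bsmooth_geometric; apply: bsmooth_partial; exact: siw.
  by apply: (CX' (Xc j)) => // s; exact: bX.
have XE i k t : B t -> partial l (fun t => X (picard k t) 0 i) t =
    \sum_j partial j (Xc i) (picard k t) * partial l (fun t => picard k t 0 j) t.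
  move=> Bt.
  have dX := smooth_differentiable oM (sX i) (picard_ball k Bt).
  have dP i' := bsmooth_is_derive l ((picard_inv k).1 i') Bt.
  have [_ E] := is_derive_comp dX dP; apply: (etrans E).
  by apply: eq_bigr => i' _; rewrite mulrC.
pose A i j k t := partial j (Xc i) (picard k t).
have bpX i' i s : exists C, forall y, ball m rho y -> `|partials s (partial i' (Xc i)) y| <= C.
  by have := bX (rcons s i') i; rewrite partials_rcons.
apply: (linear_iterates_Cr d0 (A := A) (b := fun _ _ _ => 0)
   (W := fun j k => partial l (fun t => picard k t 0 j))
   (w0 := fun j => partial l (fun t => iw t 0 j))).
- by move=> i; apply: bsmooth_partial; exact: siw.
- by move=> i k; apply: bsmooth_partial; exact: (picard_inv k).1.
- move=> i i' k; apply: (@picard_bsmooth k (partial i' (Xc i))); last exact: bpX.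
  exact: smooth_partial.
- by move=> i k; exact: (Cinf_cst HB).
- move=> i k t Bt; have [_ E] := picard_is_derive k i l Bt; apply: (etrans E).
  rewrite (negbTE la); congr (_ + _); apply: integral_ext => //.
  + exact: bsmooth_partial.
  + apply: (CinfD HB); last exact: (Cinf_cst HB).
    apply: (Cinf_sum HB) => i'; apply: (CinfM HB).
      by apply: (@picard_bsmooth k (partial i' (Xc i))); [exact: smooth_partial | exact: bpX].
    by apply: bsmooth_partial; exact: (picard_inv k).1.
  + by move=> u Bu; rewrite XE// /linear_rhs addr0.
- move=> i k t Bt; apply: le_trans smallL; rewrite ler_wpM2l ?(ltW d0)//.
  apply: (@le_trans _ _ (\sum_(i' < d.+1) L)).
    by apply: ler_sum => i' _; apply: XL; exact: picard_ball.
  by rewrite sumr_const card_ord mulr_natl.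
- by move=> i i'; apply: CX'; [exact: smooth_partial | exact: bpX].
- by move=> i; exact: Cr_cst.
Qed.

Lemma picard_limit : exists u : 'rV[R]_n.+1 -> 'rV[R]_d.+1,
  [/\ forall j, bsmooth delta (fun t => u t 0 j),
      forall t, B t -> ball m rho (u t),
      forall t j, B t -> partial a (fun t => u t 0 j) t = X (u t) 0 j &
      forall t, B t -> t 0 a = 0 -> u t = w0 t].
Proof.
have r_gt0 := rho0.
pose v t := \row_j glim (fun k t => picard k t 0 j) t.
have vE j : (fun t => v t 0 j) = glim (fun k t => picard k t 0 j).
  by apply/funext => t; rewrite mxE.
have C0j j : Cg B (fun k t => picard k t 0 j) by exact: (picard_Cinf j 0%N).1.
have cv j t : B t -> (fun k => picard k t 0 j) @ \oo --> v t 0 j.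
  by move=> Bt; rewrite mxE; have [C _ HC] := Cg_glim (C0j j); have [] := HC t Bt.
have vm t : B t -> `|v t - m| <= 3 / 4 * rho.
  move=> Bt; apply: row_norm_le => [|j]; first by rewrite mulr_ge0// ltW.
  rewrite !mxE; have cj := cv j t Bt; rewrite mxE in cj.
  have c2 : (fun k => `|picard k t 0 j - m 0 j|) @ \oo --> `|glim (fun k t => picard k t 0 j) t - m 0 j|.
    by apply: cvg_norm; apply: cvgB => //; exact: cvg_cst.
  apply: (ler_cvg_to c2 (cvg_cst _)); apply: nearW => k.
  apply: le_trans ((picard_inv k).2 t Bt).
  by have := norm_coord_le (picard k t - m) j; rewrite !mxE.
have vB t : B t -> ball m rho (v t).
  move=> Bt; rewrite -ball_normE/ball_/= distrC (le_lt_trans (vm t Bt))//; lra.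
exists v; split=> //.
- by move=> j; rewrite vE; exact: (Cinf_glim oB (picard_Cinf j)).1.
- move=> t j Bt; rewrite vE.
  rewrite (_ : partial a _ t = partials [:: a] (glim (fun k t => picard k t 0 j)) t)//.
  rewrite (Cinf_glim oB (picard_Cinf j)).2//.
  have [/Cg_glim[C _ HC] _] := (CinfP HG _).1 (picard_Cinf j) [:: a].
  have [c _ _] := HC t Bt.
  have cS : (fun k => partials [:: a] (fun t => picard k.+1 t 0 j) t) @ \oo -->
      glim (fun k => partials [:: a] (fun t => picard k t 0 j)) t.
    by rewrite -(cvg_shiftS (fun k => partials [:: a] (fun t => picard k t 0 j) t)) in c.
  have cX : (fun k => partials [:: a] (fun t => picard k.+1 t 0 j) t) @ \oo --> X (v t) 0 j.
    have Xcv : (fun k => X (picard k t) 0 j) @ \oo --> X (v t) 0 j.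
      apply: (@cvg_comp _ _ _ (fun k => picard k t) (Xc j) _ (nbhs (v t))).
        by apply: cvg_row => i; exact: cv.
      exact: smooth_continuous (sX j) (vB t Bt).
    rewrite (_ : (fun k => _) = fun k => X (picard k t) 0 j)//.
    apply/funext => k; have [_ E] := picard_is_derive k j a Bt.
    rewrite eqxx in E; apply: (etrans E).
    by rewrite iw_a add0r.
  exact: (cvg_unique _ cS cX).
- move=> t Bt ta; apply/rowP => j; rewrite mxE.
  have mt : move_to a t 0 = t by rewrite -[in LHS]ta; exact: move_to_self.
  rewrite /glim (_ : (fun k => _) = fun=> w0 t 0 j) ?lim_cst//.
  apply/funext => -[|k]; first by rewrite /= /iw mt.
  rewrite mxE integral_base ?addr0 /iw ?mt//.
  apply: bsmooth_continuous.
  exact: picard_X.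
Qed.

End Flow.

(** The initial values w0 are prescribed on the hyperplane t_a = 0 of the
source; the other coordinates of the source are parameters, on which the
solution depends smoothly. *)
Lemma flow_exists {R : realType} {n d : nat} (a : 'I_n.+1) (O : set 'rV[R]_d.+1)
    (X : 'rV[R]_d.+1 -> 'rV[R]_d.+1) (w0 : 'rV[R]_n.+1 -> 'rV[R]_d.+1) (delta0 : R) :
  open O -> smooth_on O X -> 0 < delta0 ->
  (forall j, bsmooth delta0 (fun t => w0 t 0 j)) -> O (w0 0) ->
  exists (delta : R) (u : 'rV[R]_n.+1 -> 'rV[R]_d.+1),
  [/\ 0 < delta <= delta0,
      forall j, bsmooth delta (fun t => u t 0 j),
      forall t, ball (0 : 'rV[R]_n.+1) delta t -> O (u t),
      forall t j, ball (0 : 'rV[R]_n.+1) delta t -> partial a (fun t => u t 0 j) t = X (u t) 0 j &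
      forall t, ball (0 : 'rV[R]_n.+1) delta t -> t 0 a = 0 -> u t = w0 t].
Proof.
move=> oO /(smooth_rowP oO) sX d0 sw Ow; set m := w0 0 in Ow.
have [rho rho0 [rhoO bd]] := smooth_local_bounds oO Ow.
have sX' j : smooth_on (ball m rho) (fun y => X y 0 j) by exact: smooth_sub rhoO (sX j).
have [CX CX0 HCX] : exists2 C, 0 <= C & forall j y, ball m rho y -> `|X y 0 j| <= C.
  apply: (@uniform_constant _ _ (fun j C => forall y, ball m rho y -> `|X y 0 j| <= C)).
    by move=> j C D CD H y /H /le_trans; apply.
  move=> j; have [C HC] := bd _ (sX j) [::]; exists `|C| => // y my.
  by rewrite (le_trans (HC y my))// ler_norm.
have [L L0 HL] : exists2 L, 0 <= L & forall ij : 'I_d.+1 * 'I_d.+1, forall y,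
    ball m rho y -> `|partial ij.1 (fun y => X y 0 ij.2) y| <= L.
  apply: (@uniform_constant _ _ (fun ij C => forall y, ball m rho y -> _ <= C)).
    by move=> j C D CD H y /H /le_trans; apply.
  move=> [i j]; have [C HC] := bd _ (sX j) [:: i]; exists `|C| => // y my.
  by rewrite (le_trans (HC y my))// ler_norm.
have [d1 d10 Hd1] : exists2 d1, 0 < d1 & forall t, ball (0 : 'rV[R]_n.+1) d1 t -> `|w0 t - m| <= rho / 2.
  apply: near_ball; have B0 : ball (0 : 'rV[R]_n.+1) delta0 0 by exact: ballxx.
  have /cvgrPdist_le /(_ (rho / 2)) : {for 0, continuous w0}.
    by apply/continuous_row => j; exact: bsmooth_continuous (sw j) _ B0.
  by rewrite divr_gt0// => /(_ isT); apply: filterS => t; rewrite distrC.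
(* A radius below 1 / K keeps the iterates in the ball of radius rho and makes
the operator contract by 1/2. *)
pose K := 4 * CX / rho + 2 * (d.+1%:R * L) + 1.
have K1 : 0 <= 4 * CX / rho by rewrite mulr_ge0 ?invr_ge0 ?(ltW rho0)// mulr_ge0.
have K2 : 0 <= 2 * (d.+1%:R * L) by rewrite mulr_ge0// mulr_ge0.
have K0 : 0 < K by rewrite ltr_wpDl// addr_ge0.
pose delta := Num.min (Num.min delta0 d1) K^-1.
have delta0' : 0 < delta by rewrite !lt_min d0 d10 invr_gt0.
have dd0 : delta <= delta0 by rewrite !ge_min lexx.
have dd1 : delta <= d1 by rewrite !ge_min lexx !orbT.
have dK : delta * K <= 1 by rewrite -ler_pdivlMr// div1r ge_min lexx orbT.
have sC : delta * CX <= rho / 4.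
  have -> : delta * CX = delta * (4 * CX / rho) * (rho / 4) by field; rewrite gt_eqF.
  rewrite ler_piMl ?divr_ge0 ?(ltW rho0)//; apply: le_trans dK.
  by rewrite ler_wpM2l ?(ltW delta0')// /K; lra.
have sL : delta * (d.+1%:R * L) <= 1 / 2.
  have : delta * (2 * (d.+1%:R * L)) <= 1.
    by apply: le_trans dK; rewrite ler_wpM2l ?(ltW delta0')// /K; lra.
  lra.
have [u [u1 u2 u3 u4]] := @picard_limit R n d delta a X m rho CX L w0 delta0' rho0
  sX' (fun s j => bd _ (sX j) s) HCX (fun i j => HL (i, j)) sC sL
  (fun j => bsmooth_sub dd0 (sw j)) (fun t Bt => Hd1 t (le_ball dd1 Bt)).
exists delta, u; split=> //; first by rewrite delta0'.
by move=> t /u2 /rhoO.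
Qed.

(** * The inverse function theorem *)

(** The transpose of the usual Jacobian matrix: vectors are rows, and v *m jac
phi t is the image of v under the derivative of phi. *)
Definition jac {R : realType} {n d : nat} (phi : 'rV[R]_n.+1 -> 'rV[R]_d) t : 'M[R]_(n.+1, d) :=
  \matrix_(i, j) partial i (fun u => phi u 0 j) t.

Lemma near_forall {T : topologicalType} {J : finType} (Q : J -> T -> Prop) (x : T) :
  (forall j, \forall t \near x, Q j t) -> \forall t \near x, forall j, Q j t.
Proof. exact: filter_forall. Qed.

Section Inverse.
Context {R : realType} {n : nat}.
Implicit Types (x y z t m : 'rV[R]_n.+1).

Lemma open_near (O : set 'rV[R]_n.+1) t : open O -> O t -> \forall s \near t, O s.
Proof. by rewrite openE => oO /oO. Qed.

Lemma openP (O : set 'rV[R]_n.+1) : (forall t, O t -> \forall s \near t, O s) -> open O.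
Proof. by rewrite openE. Qed.

Lemma jac_smooth (O : set 'rV[R]_n.+1) (phi : 'rV[R]_n.+1 -> 'rV[R]_n.+1) i j :
  open O -> smooth_on O phi -> smooth_on O (fun t => jac phi t i j).
Proof.
move=> oO /(smooth_rowP oO) sphi.
rewrite (_ : (fun _ => _) = partial i (fun u => phi u 0 j)).
  exact: smooth_partial.
by apply/funext => t; rewrite mxE.
Qed.

Section NearId.
Context (g : 'rV[R]_n.+1 -> 'rV[R]_n.+1) (m : 'rV[R]_n.+1) (r : R).
Hypothesis dg : forall t, ball m r t -> forall i j,
  derivable (fun u => g u 0 j) t 'e_i /\
  `|partial i (fun u => g u 0 j) t - (i == j)%:R| <= (2 * n.+1%:R)^-1.

(** The bound 1 / (2 (n + 1)) on the entries of the derivative of g - id makes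
g - id contract distances by 1/2. *)
Lemma near_id x y : ball m r x -> ball m r y ->
  `|g y - g x - (y - x)| <= `|y - x| / 2.
Proof.
move=> mx my; apply: row_norm_le => [|j]; first by rewrite divr_ge0.
have := C1_estimate (f := fun u => g u 0 j) (fun t mt i => dg mt i j) mx my.
rewrite (bigD1 j)//= eqxx mul1r big1 ?addr0; last first.
  by move=> i /negbTE ij; rewrite ij mul0r.
rewrite !mxE => /le_trans; apply.
apply: (@le_trans _ _ (\sum_(i < n.+1) (2 * n.+1%:R)^-1 * `|y - x|)).
  apply: ler_sum => i _; rewrite ler_wpM2l ?invr_ge0 ?mulr_ge0//.
  by have := norm_coord_le (y - x) i; rewrite !mxE.
rewrite sumr_const card_ord -[leLHS]mulr_natl le_eqVlt; apply/orP; left; apply/eqP.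
have : n.+1%:R != 0 :> R by rewrite pnatr_eq0.
by move: n.+1%:R => N N0; field.
Qed.

Lemma near_id_inj x y : ball m r x -> ball m r y -> `|y - x| <= 2 * `|g y - g x|.
Proof.
move=> mx my; have := near_id mx my.
have : `|y - x| <= `|g y - g x| + `|g y - g x - (y - x)|.
  by rewrite -{1}[y - x](subKr (g y - g x)) ler_normB.
lra.
Qed.

Lemma near_id_continuous x : ball m r x -> {for x, continuous g}.
Proof.
move=> mx; apply/continuous_eps => e e0.
have [s s0 Hs] : exists2 s, 0 < s & forall y, ball x s y -> ball m r y.
  by apply: near_ball; apply: open_near => //; exact: ball_open.
apply/nbhs_ballP; exists (Num.min s (e / 2)) => [|y xy]; first by rewrite /= lt_min s0 divr_gt0.
have my : ball m r y by apply: Hs; apply: le_ball xy; rewrite ge_min lexx.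
have d2 : `|y - x| <= e / 2.
  move: xy; rewrite -ball_normE/ball_/= distrC => /ltW xy.
  by rewrite (le_trans xy)// ge_min lexx orbT.
rewrite distrC; have := near_id mx my.
have : `|g y - g x| <= `|g y - g x - (y - x)| + `|y - x|.
  by rewrite -{1}[g y - g x](subrK (y - x)) ler_normD.
lra.
Qed.

(** Newton's iteration with the identity in place of the derivative. *)
Lemma near_id_surj s z : 0 < s < r -> `|z - g m| < s / 2 ->
  exists2 x, ball m s x & g x = z.
Proof.
move=> /andP[s0 sr] zm; set c := `|z - g m| in zm.
have c0 : 0 <= c by exact: normr_ge0.
pose f k := iter k (fun x => x - (g x - z)) m.
have inr x : `|x - m| <= 2 * c -> ball m r x.
  by move=> xm; rewrite -ball_normE/ball_/= distrC (le_lt_trans xm)//; lra.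
have mm : ball m r m by apply: inr; rewrite subrr normr0 mulr_ge0.
have fm k : `|f k - m| <= 2 * c.
  elim: k => [|k IH]; first by rewrite subrr normr0 mulr_ge0.
  have -> : f k.+1 - m = (z - g m) - (g (f k) - g m - (f k - m)).
    by rewrite /f iterS -/(f k); apply/rowP => i; rewrite !mxE; ring.
  rewrite (le_trans (ler_normB _ _))// -/c; have := near_id mm (inr _ IH); lra.
have df k : `|f k.+1 - f k| <= c * (3 / 4) ^+ k.
  elim: k => [|k IH].
    rewrite expr0 mulr1 (_ : f 1%N - f 0%N = z - g m)//.
    by rewrite /f /=; apply/rowP => i; rewrite !mxE; ring.
  have -> : f k.+2 - f k.+1 = - (g (f k.+1) - g (f k) - (f k.+1 - f k)).
    by rewrite /f !iterS -/(f k); apply/rowP => i; rewrite !mxE; ring.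
  rewrite normrN (le_trans (near_id (inr _ (fm k)) (inr _ (fm k.+1))))//.
  rewrite exprS mulrCA; have : 0 <= c * (3 / 4) ^+ k by rewrite mulr_ge0// exprn_ge0.
  lra.
pose x := \row_j limn (fun k => f k 0 j).
have fx : f @ \oo --> x.
  apply: cvg_row => j; rewrite mxE.
  have [|//] := @geometric_cvg R (fun k => f k 0 j) (`|m| + 2 * c).
  move=> k; split.
    rewrite -[f k 0 j](subrK (m 0 j)) addrC (le_trans (ler_normD _ _))//.
    rewrite lerD ?norm_coord_le//; have := norm_coord_le (f k - m) j.
    by rewrite !mxE => /le_trans; apply.
  have := norm_coord_le (f k.+1 - f k) j; rewrite !mxE => /le_trans; apply.
  rewrite (le_trans (df k))// ler_wpM2r ?exprn_ge0//.
  have := normr_ge0 m; lra.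
have xm : `|x - m| <= 2 * c.
  have c2 : (fun k => `|f k - m|) @ \oo --> `|x - m|.
    by apply: cvg_norm; apply: cvgB => //; exact: cvg_cst.
  by apply: (ler_cvg_to c2 (cvg_cst _)); exact: nearW.
exists x.
  by rewrite -ball_normE/ball_/= distrC (le_lt_trans xm)//; lra.
have gf : g \o f @ \oo --> g x.
  by apply: cvg_comp fx _; exact: near_id_continuous (inr _ xm).
have fS : (fun k => f k.+1) @ \oo --> x by rewrite (cvg_shiftS f).
have fS' : (fun k => f k.+1) @ \oo --> x - (g x - z).
  rewrite (_ : (fun k => f k.+1) = fun k => f k - (g (f k) - z)); last first.
    by apply/funext => k; rewrite /f iterS.
  exact: cvgB fx (cvgB gf (cvg_cst z)).
have := cvg_unique (@norm_hausdorff _ _) fS fS'.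
by move=> E; have := subrr x; rewrite {2}E opprB addrCA subrr addr0 => /eqP; rewrite subr_eq0 => /eqP.
Qed.

End NearId.

(** Composing with the inverse of the derivative at m gives a map close to the
identity, hence bi-Lipschitz onto an open set. The derivative of psi is the
inverse of the matrix jac phi at the image under psi; this formula propagates
regularity from psi to its derivatives. *)
Theorem inverse_function (O : set 'rV[R]_n.+1) (phi : 'rV[R]_n.+1 -> 'rV[R]_n.+1) m :
  open O -> smooth_on O phi -> O m -> jac phi m \in unitmx ->
  exists (V : set 'rV[R]_n.+1) (psi : 'rV[R]_n.+1 -> 'rV[R]_n.+1),
  [/\ open V, V m & V `<=` O] /\
  [/\ open (phi @` V), smooth_on (phi @` V) psi,
      forall t, V t -> psi (phi t) = t &
      forall t, V t -> jac phi t \in unitmx].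
Proof.
move=> oO sphi Om um; have sphi' := (smooth_rowP oO phi).1 sphi.
pose A := invmx (jac phi m); pose g x := phi x *m A.
have gE j : (fun u => g u 0 j) = fun u => \sum_k phi u 0 k * A k j.
  by apply/funext => u; rewrite mxE.
have sg j : smooth_on O (fun u => g u 0 j).
  rewrite gE; apply: (smooth_sum oO) => k; apply: (smoothM oO) => //.
  exact: smooth_cst.
have dgE t i j : O t -> partial i (fun u => g u 0 j) t = (jac phi t *m A) i j.
  move=> Ot; have [] : is_derive t 'e_i (fun u => g u 0 j) ((jac phi t *m A) i j); last first.
    by move=> _ E; exact: E.
  rewrite gE mxE; apply: is_derive_sumf => k; rewrite mxE.
  rewrite [X in is_derive _ _ _ X](_ : _ = phi t 0 k * 0 + A k j * partial i (fun u => phi u 0 k) t); last first.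
    by rewrite mulr0 add0r mulrC.
  by apply: is_derive_mul; exact/derivableP/(smooth_derivable (sphi' k)).
have [r r0 Hr] : exists2 r, 0 < r & forall t, ball m r t -> O t /\
    (forall ij : 'I_n.+1 * 'I_n.+1,
      `|partial ij.1 (fun u => g u 0 ij.2) t - (ij.1 == ij.2)%:R| <= (2 * n.+1%:R)^-1) /\
    \det (jac phi t) != 0.
  apply: near_ball; apply: filterI; first exact: open_near.
  apply: filterI.
    apply: (near_forall (J := ('I_n.+1 * 'I_n.+1)%type) (Q := fun ij t =>
      `|partial ij.1 (fun u => g u 0 ij.2) t - (ij.1 == ij.2)%:R| <= (2 * n.+1%:R)^-1)) => -[i j] /=.
    have e0 : 0 < (2 * n.+1%:R)^-1 :> R by rewrite invr_gt0 mulr_gt0.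
    have /continuous_eps /(_ _ e0) : {for m, continuous (partial i (fun u => g u 0 j))}.
      by apply: smooth_continuous Om; apply: smooth_partial.
    by apply: filterS => t; rewrite distrC (dgE m i j Om) mulmxV// mxE.
  have sd : smooth_on O (fun t => \det (jac phi t)).
    by apply: (smooth_det oO) => i j; exact: jac_smooth.
  have d0 : 0 < `|\det (jac phi m)| by rewrite normr_gt0 -unitfE -unitmxE.
  have /continuous_eps /(_ _ (divr_gt0 d0 (ltr0n _ 2))) := smooth_continuous sd Om.
  apply: filterS => t; apply: contraPneq => ->; rewrite subr0 => H.
  by move: H; rewrite ler_pdivlMr// mulr_natr mulr2n; lra.
have dg t : ball m r t -> forall i j, derivable (fun u => g u 0 j) t 'e_i /\
  `|partial i (fun u => g u 0 j) t - (i == j)%:R| <= (2 * n.+1%:R)^-1.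
  move=> /Hr[Ot [H _]] i j; split; last exact: (H (i, j)).
  exact: smooth_derivable (sg j) Ot.
pose s := r / 2.
have s0 : 0 < s by rewrite divr_gt0.
have sr : s < r by rewrite /s; lra.
have s0r : 0 < s < r by rewrite s0.
have sub t : ball m s t -> ball m r t by apply: le_ball; exact: ltW.
pose V := [set x | ball m s x /\ `|g x - g m| < s / 2].
have phiE x : phi x = g x *m jac phi m by rewrite /g -mulmxA mulVmx// mulmx1.
have imE : phi @` V = [set y | `|y *m A - g m| < s / 2].
  apply/seteqP; split=> y /=; first by move=> [x [_ Vx] <-].
  move=> yA; have [x mx gx] := near_id_surj dg s0r yA.
  by exists x; [split=> //; rewrite gx | rewrite phiE gx -mulmxA mulVmx// mulmx1].
have oV : open V.
  apply: openP => t [mt gt]; apply: filterI; first by apply: open_near => //; exact: ball_open.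
  have e0 : 0 < (s / 2 - `|g t - g m|) / 2 by rewrite divr_gt0// subr_gt0.
  have /continuous_eps /(_ _ e0) := near_id_continuous dg (sub _ mt).
  apply: filterS => x; rewrite distrC => H; rewrite -(subrKA (g t)).
  rewrite (le_lt_trans (ler_normD _ _))//; lra.
have cA y : {for y, continuous (fun y : 'rV[R]_n.+1 => y *m A)}.
  apply/continuous_row => j.
  rewrite (_ : (fun _ => _) = fun y : 'rV[R]_n.+1 => \sum_k y 0 k * A k j); last first.
    by apply/funext => u; rewrite mxE.
  apply: continuous_sum => k.
  apply: (@continuousM _ _ (fun y : 'rV[R]_n.+1 => y 0 k) (cst _)).
    exact: coord_continuous.
  exact: cst_continuous.
have oW : open (phi @` V).
  rewrite imE; apply: openP => y /= yA.
  have e0 : 0 < (s / 2 - `|y *m A - g m|) / 2 by rewrite divr_gt0// subr_gt0.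
  have /continuous_eps /(_ _ e0) := cA y.
  apply: filterS => x; rewrite distrC => H; rewrite /= -(subrKA (y *m A)).
  rewrite (le_lt_trans (ler_normD _ _))//; lra.
pose psi y := xget m [set x | V x /\ phi x = y].
have psiP y : (phi @` V) y -> V (psi y) /\ phi (psi y) = y.
  by move=> [x Vx <-]; rewrite /psi; case: xgetP => [x' -> //|/(_ x)]; case.
have psiK t : V t -> psi (phi t) = t.
  move=> Vt; have [|Vp E] := psiP (phi t); first by exists t.
  have := near_id_inj dg (sub _ Vp.1) (sub _ Vt.1).
  rewrite /g E subrr normr0 mulr0 normr_le0 subr_eq0 => /eqP.
  exact: esym.
have lip y y' : (phi @` V) y -> (phi @` V) y' ->
    `|psi y' - psi y| <= 2 * `|y' *m A - y *m A|.
  move=> /psiP[Vy Ey] /psiP[Vy' Ey'].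
  by have := near_id_inj dg (sub _ Vy.1) (sub _ Vy'.1); rewrite /g Ey Ey'.
have cpsi y : (phi @` V) y -> {for y, continuous psi}.
  move=> Wy; apply/continuous_eps => e e0.
  have /continuous_eps /(_ _ (divr_gt0 e0 (ltr0n _ 2))) := cA y.
  apply: filterS2 (open_near oW Wy) => y' Wy' H.
  rewrite distrC (le_trans (lip y y' Wy Wy'))// distrC; lra.
have VO t : V t -> O t by move=> [/sub/Hr[]].
have uV t : V t -> jac phi t \in unitmx.
  by move=> [/sub/Hr[_ [_ d]] _]; rewrite unitmxE unitfE.
(* The expansion of phi at x = psi y, solved by the inverse matrix: the
Lipschitz bound on psi turns the error in x into an error in h. *)
have dpsi y i j : (phi @` V) y ->
    is_derive y 'e_i (fun u => psi u 0 j) (invmx (jac phi (psi y)) i j).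
  move=> Wy; have [Vx Ex] := psiP y Wy; set x := psi y in Vx Ex *.
  pose D := jac phi x; have uD : D \in unitmx by exact: uV.
  apply: is_derive_eps => e e0.
  pose K : R := 2 * `|('e_i : 'rV[R]_n.+1) *m A| + 1; have K0 : 0 < K by rewrite ltr_wpDl// mulr_ge0.
  pose S := \sum_k `|invmx D k j| + 1.
  have S0 : 0 < S by rewrite ltr_wpDl// sumr_ge0.
  pose eta := e / (n.+1%:R * K * S).
  have eta0 : 0 < eta by rewrite divr_gt0// !mulr_gt0.
  have [r1 r10 H1] : exists2 r1, 0 < r1 & forall t, ball x r1 t ->
      forall kl : 'I_n.+1 * 'I_n.+1, derivable (fun u => phi u 0 kl.2) t 'e_(kl.1) /\
      `|partial kl.1 (fun u => phi u 0 kl.2) t - D kl.1 kl.2| <= eta.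
    apply: near_ball; apply: (near_forall (J := ('I_n.+1 * 'I_n.+1)%type) (Q := fun kl t =>
      derivable (fun u => phi u 0 kl.2) t 'e_(kl.1) /\
      `|partial kl.1 (fun u => phi u 0 kl.2) t - D kl.1 kl.2| <= eta)) => -[k l] /=; apply: filterI.
      apply: filterS (open_near oO (VO _ Vx)) => t; exact: smooth_derivable (sphi' l).
    have /continuous_eps /(_ _ eta0) : {for x, continuous (partial k (fun u => phi u 0 l))}.
      by apply: smooth_continuous (VO _ Vx); apply: smooth_partial.
    by apply: filterS => t; rewrite distrC mxE.
  have [r2 r20 H2] := near_ball (open_near oW Wy).
  exists (Num.min r2 (r1 / K)) => [|h]; first by rewrite lt_min r20 divr_gt0.
  rewrite lt_min => /andP[hr2 hr1].
  have Wh : (phi @` V) (y + h *: 'e_i).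
    apply: H2; rewrite -ball_normE/ball_/= opprD addrA subrr sub0r normrN.
    rewrite (le_lt_trans _ hr2)// normrZ ler_piMr//.
    by apply: row_norm_le => // l; rewrite !mxE eqxx/=; case: (_ == _); rewrite ?normr1 ?normr0.
  have [Vh Eh] := psiP _ Wh; set x' := psi (y + _) in Vh Eh *; rewrite -/x.
  have vK : `|x' - x| <= K * `|h|.
    have E1 : (y + h *: 'e_i) *m A - y *m A = h *: (('e_i : 'rV[R]_n.+1) *m A).
      by rewrite -mulmxBl addrAC subrr add0r -scalemxAl.
    have := lip _ _ Wy Wh; rewrite -/x' -/x E1 normrZ mulrCA mulrC => /le_trans; apply.
    by rewrite ler_wpM2r// /K lerDl.
  have mx' : ball x r1 x'.
    rewrite -ball_normE/ball_/= distrC (le_lt_trans vK)// mulrC.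
    by rewrite -ltr_pdivlMr.
  pose w := \row_k (phi x' 0 k - phi x 0 k - \sum_l D l k * (x' 0 l - x 0 l)).
  have wb k : `|w 0 k| <= eta * (n.+1%:R * K) * `|h|.
    rewrite mxE; have := C1_estimate (f := fun u => phi u 0 k)
      (c := fun l => D l k) (eps := fun=> eta) (fun t mt l => H1 t mt (l, k)) (ballxx x r10) mx'.
    move=> /le_trans; apply.
    apply: (@le_trans _ _ (\sum_(l < n.+1) eta * (K * `|h|))).
      apply: ler_sum => l _; rewrite ler_wpM2l ?(ltW eta0)// (le_trans _ vK)//.
      by have := norm_coord_le (x' - x) l; rewrite !mxE.
    rewrite sumr_const card_ord -[leLHS]mulr_natl le_eqVlt; apply/orP; left; apply/eqP.
    by ring.
  have wE : w = h *: 'e_i - (x' - x) *m D.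
    apply/rowP => k; rewrite !mxE Eh Ex !mxE [y 0 k + _]addrC addrK; congr (_ - _).
    by apply: eq_bigr => l _; rewrite !mxE mulrC.
  have E : x' - x = (h *: 'e_i - w) *m invmx D.
    by rewrite wE opprB addrCA subrr addr0 -mulmxA mulmxV// mulmx1.
  have -> : x' 0 j - x 0 j - h *: invmx D i j = - \sum_k w 0 k * invmx D k j.
    have -> : x' 0 j - x 0 j = (x' - x) 0 j by rewrite !mxE.
    rewrite E mulmxBl -scalemxAl -rowE !mxE.
    by rewrite -[h *: invmx D i j]/(h * invmx D i j) addrAC subrr sub0r.
  rewrite normrN (le_trans (ler_norm_sum _ _ _))//.
  apply: (@le_trans _ _ (\sum_k eta * (n.+1%:R * K) * `|h| * `|invmx D k j|)).
    by apply: ler_sum => k _; rewrite normrM ler_wpM2r.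
  rewrite -mulr_sumr (@le_trans _ _ (eta * (n.+1%:R * K) * `|h| * S))//.
    apply: ler_wpM2l; last by rewrite /S lerDl.
    by apply: mulr_ge0 => //; apply: mulr_ge0 (ltW eta0) (mulr_ge0 (ler0n _ _) (ltW K0)).
  rewrite le_eqVlt; apply/orP; left; apply/eqP; rewrite /eta.
  have : n.+1%:R != 0 :> R by rewrite pnatr_eq0.
  by move: n.+1%:R => N N0; field; rewrite N0 !gt_eqF.
exists V, psi; split.
  split=> //; split; first exact: ballxx.
  by rewrite subrr normr0 divr_gt0.
split=> //.
pose kappa i j t := invmx (jac phi t) i j.
have sk i j : smooth_on V (kappa i j).
  apply: (smooth_invmx oV) => // a b.
  by apply: smooth_sub VO _; exact: jac_smooth.
have HW := C0_is_class (I := unit) oW.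
suff sp r' j : Cr (phi @` V) (C0 (phi @` V)) r' (fun _ : unit => fun y => psi y 0 j).
  by apply/(smooth_rowP oW) => j; apply/(smooth_Cinf _ oW) => r'; exact: sp.
have cj j' : C0 (phi @` V) (fun _ : unit => fun y => psi y 0 j').
  by move=> _ y /cpsi /continuous_row; exact.
elim: r' j => [|r' IH] j; split=> //; split=> [k y i Wy|i].
  by case: (dpsi y i j Wy).
apply: (Cr_ext HW (F := fun _ y => kappa i j (psi y))).
  by move=> k y Wy; have [_ E] := dpsi y i j Wy; exact: esym.
apply: (Cr_comp HW (O := V) (Phi := fun _ => psi)) => //.
  by move=> _ y /psiP[].
move=> s' k y Wy; apply: (@continuous_comp _ _ _ psi (partials s' (kappa i j))).
  exact: cpsi.
by have [] := sk i j s' (psi y) (psiP y Wy).1.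
Qed.

End Inverse.

(** * Rules for partial derivatives and Lie derivatives *)

Section Forms.
Context {R : realType} {n : nat}.
Implicit Types (f g : 'rV[R]_n.+1 -> R) (V : set 'rV[R]_n.+1).

Lemma partial_ext V f g i t : open V -> (forall t, V t -> f t = g t) -> V t ->
  partial i f t = partial i g t.
Proof.
by move=> oV fg Vt; apply: near_eq_derive; apply: filterS (open_near oV Vt).
Qed.

Lemma partial_row V {m} (F : 'rV[R]_n.+1 -> 'rV[R]_m) i t j :
  open V -> smooth_on V F -> V t -> (partial i F t) 0 j = partial i (fun u => F u 0 j) t.
Proof.
move=> oV sF Vt; rewrite /partial derive_mx ?mxE//.
by have [_] := sF [::] t Vt; exact.
Qed.

Lemma smooth_is_derive V f i t : smooth_on V f -> V t -> is_derive t 'e_i f (partial i f t).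
Proof. by move=> sf Vt; apply: derivableP; exact: smooth_derivable sf Vt. Qed.

Lemma partialD V f g i t : smooth_on V f -> smooth_on V g -> V t ->
  partial i (fun u => f u + g u) t = partial i f t + partial i g t.
Proof.
move=> sf sg Vt.
by have [_ E] := is_deriveD (smooth_is_derive i sf Vt) (smooth_is_derive i sg Vt).
Qed.

Lemma partialM V f g i t : smooth_on V f -> smooth_on V g -> V t ->
  partial i (fun u => f u * g u) t = f t * partial i g t + g t * partial i f t.
Proof.
move=> sf sg Vt.
by have [_ E] := is_derive_mul (smooth_is_derive i sf Vt) (smooth_is_derive i sg Vt).
Qed.

Lemma partial_sum V (J : Type) (s : seq J) (Q : pred J) (F : J -> 'rV[R]_n.+1 -> R) i t :
  (forall j, smooth_on V (F j)) -> V t ->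
  partial i (fun u => \sum_(j <- s | Q j) F j u) t = \sum_(j <- s | Q j) partial i (F j) t.
Proof.
move=> sF Vt.
by have [_ E] := is_derive_sumf s Q (fun j => smooth_is_derive i (sF j) Vt).
Qed.

Lemma partialC V f i j t : open V -> smooth_on V f -> V t ->
  partial i (partial j f) t = partial j (partial i f) t.
Proof.
move=> oV sf Vt; apply: schwarz.
- apply: filterS (open_near oV Vt) => s Vs; split.
  + exact: smooth_derivable sf Vs.
  + exact: smooth_derivable sf Vs.
  + exact: smooth_derivable (smooth_partial j sf) Vs.
  + exact: smooth_derivable (smooth_partial i sf) Vs.
- exact: smooth_continuous (smooth_partial i (smooth_partial j sf)) Vt.
- exact: smooth_continuous (smooth_partial j (smooth_partial i sf)) Vt.
Qed.

Lemma partial_cst (c : R) i t : partial i (fun _ : 'rV[R]_n.+1 => c) t = 0.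
Proof. exact: derive_cst. Qed.

Lemma partial_coord i j t : partial i (fun u : 'rV[R]_n.+1 => u 0 j) t = (i == j)%:R.
Proof.
suff [_ E] : is_derive t 'e_i (fun u : 'rV[R]_n.+1 => u 0 j) ((i == j)%:R) by exact: E.
apply: is_derive_eps => e e0; exists 1 => // h _.
rewrite !mxE eqxx/= eq_sym; set c := (_ == _)%:R.
by rewrite -[h *: c]/(h * c) [t 0 j + _]addrC addrK subrr normr0 mulr_ge0// ltW.
Qed.

Lemma derive_jac V {m} (phi : 'rV[R]_n.+1 -> 'rV[R]_m) (v : 'rV[R]_n.+1) t j :
  open V -> smooth_on V phi -> V t ->
  'D_v (fun u => phi u 0 j) t = (v *m jac phi t) 0 j.
Proof.
move=> oV /(smooth_rowP oV) sphi Vt.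
rewrite derive_sum_coord; last exact: smooth_differentiable oV (sphi j) Vt.
by rewrite mxE; apply: eq_bigr => i _; rewrite mxE.
Qed.

Lemma jac_inverse V (phi psi : 'rV[R]_n.+1 -> 'rV[R]_n.+1) t :
  open V -> smooth_on V phi -> open (phi @` V) -> smooth_on (phi @` V) psi ->
  (forall t, V t -> psi (phi t) = t) -> V t ->
  jac psi (phi t) *m jac phi t = 1%:M.
Proof.
move=> oV sphi oW spsi K Vt; apply/matrixP => i j.
have Wt : (phi @` V) (phi t) by exists t.
have sphi' := (smooth_rowP oV phi).1 sphi; have spsi' := (smooth_rowP oW psi).1 spsi.
have dX : differentiable (fun u => phi u 0 j) (psi (phi t)).
  by rewrite K//; exact: smooth_differentiable oV (sphi' j) Vt.
have [_ E] := is_derive_comp dX (fun k => smooth_is_derive i (spsi' k) Wt).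
rewrite [RHS]mxE -(partial_coord i j (phi t)).
rewrite -(partial_ext (V := phi @` V) (f := fun u => phi (psi u) 0 j) _ oW _ Wt); last first.
  by move=> u [s Vs <-]; rewrite K.
apply: esym; apply: (etrans E); rewrite K// mxE.
by apply: eq_bigr => k _; rewrite !mxE.
Qed.

End Forms.

Section Lie.
Context {R : realType}.
Implicit Types (X : vfield (R := R)) (w : oneform (R := R)) (f g : 'rV[R]_5 -> R).
Implicit Types (V : set 'rV[R]_5).

Lemma vapplyE V X f t : open V -> smooth_on V f -> V t ->
  vapply X f t = \sum_i X t 0 i * partial i f t.
Proof.
move=> oV sf Vt; rewrite /vapply derive_sum_coord//.
exact: smooth_differentiable oV sf Vt.
Qed.

Lemma vapply_ext V X f g t : open V -> (forall t, V t -> f t = g t) -> V t ->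
  vapply X f t = vapply X g t.
Proof.
by move=> oV fg Vt; apply: near_eq_derive; apply: filterS (open_near oV Vt).
Qed.

Lemma lie_formE V X w t j : open V -> smooth_on V X -> smooth_on V w -> V t ->
  lie_form X w t 0 j = vapply X (fun u => w u 0 j) t +
    \sum_i w t 0 i * partial j (fun u => X u 0 i) t.
Proof.
move=> oV sX sw Vt; rewrite mxE; congr (_ + _); apply: eq_bigr => i _.
by rewrite (partial_row _ _ oV sX Vt).
Qed.

Lemma vapply_smooth V X f : open V -> smooth_on V X -> smooth_on V f ->
  smooth_on V (vapply X f).
Proof.
move=> oV /(smooth_rowP oV) sX sf.
apply: (smooth_ext oV (f := fun t => \sum_i X t 0 i * partial i f t)).
  by move=> t Vt; rewrite (vapplyE _ oV sf Vt).
by apply: (smooth_sum oV) => i; apply: (smoothM oV); [exact: sX | exact: smooth_partial].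
Qed.

Lemma ext_d_smooth V f : open V -> smooth_on V f -> smooth_on V (ext_d f).
Proof.
move=> oV sf; apply/(smooth_rowP oV) => j.
apply: (smooth_ext oV (f := partial j f)) => [t _|]; first by rewrite mxE.
exact: (smooth_partial j sf).
Qed.

Lemma form_scale_smooth V f w : open V -> smooth_on V f -> smooth_on V w ->
  smooth_on V (fun t => f t *: w t : 'rV[R]_5).
Proof.
move=> oV sf /(smooth_rowP oV) sw; apply/(smooth_rowP oV) => j.
apply: (smooth_ext oV (f := fun t => f t * w t 0 j)) => [t _|]; first by rewrite mxE.
exact: (smoothM oV sf (sw j)).
Qed.

Lemma form_add_smooth V w w' : open V -> smooth_on V w -> smooth_on V w' ->
  smooth_on V (fun t => w t + w' t : 'rV[R]_5).
Proof.
move=> oV /(smooth_rowP oV) sw /(smooth_rowP oV) sw'; apply/(smooth_rowP oV) => j.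
apply: (smooth_ext oV (f := fun t => w t 0 j + w' t 0 j)) => [t _|]; first by rewrite mxE.
exact: (smoothD oV (sw j) (sw' j)).
Qed.

Lemma lie_form_smooth V X w : open V -> smooth_on V X -> smooth_on V w ->
  smooth_on V (lie_form X w).
Proof.
move=> oV sX sw; apply/(smooth_rowP oV) => j.
have sX' := (smooth_rowP oV X).1 sX; have sw' := (smooth_rowP oV w).1 sw.
apply: (smooth_ext oV (f := fun t => vapply X (fun u => w u 0 j) t +
    \sum_i w t 0 i * partial j (fun u => X u 0 i) t)).
  by move=> t Vt; rewrite (lie_formE _ oV sX sw Vt).
apply: (smoothD oV); first exact: vapply_smooth.
apply: (smooth_sum oV) => i; apply: (smoothM oV); first exact: sw'.
by apply: smooth_partial; exact: sX'.
Qed.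

Lemma lie_form_ext V X w w' t : open V -> (forall t, V t -> w t = w' t) -> V t ->
  lie_form X w t = lie_form X w' t.
Proof.
move=> oV ww Vt; apply/rowP => j; rewrite !mxE ww//; congr (_ + _).
by apply: (vapply_ext _ oV _ Vt) => u Vu; rewrite ww.
Qed.

Lemma vapplyD V X f g t : open V -> smooth_on V f -> smooth_on V g -> V t ->
  vapply X (fun u => f u + g u) t = vapply X f t + vapply X g t.
Proof.
move=> oV sf sg Vt; rewrite (vapplyE _ oV (smoothD oV sf sg) Vt) (vapplyE _ oV sf Vt) (vapplyE _ oV sg Vt).
by rewrite -big_split; apply: eq_bigr => i _; rewrite (partialD _ sf sg Vt) mulrDr.
Qed.

Lemma vapplyM V X f g t : open V -> smooth_on V f -> smooth_on V g -> V t ->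
  vapply X (fun u => f u * g u) t = f t * vapply X g t + g t * vapply X f t.
Proof.
move=> oV sf sg Vt; rewrite (vapplyE _ oV (smoothM oV sf sg) Vt) (vapplyE _ oV sf Vt) (vapplyE _ oV sg Vt).
rewrite !mulr_sumr -big_split; apply: eq_bigr => i _ /=.
by rewrite (partialM _ sf sg Vt); ring.
Qed.

Lemma vapplyN V X f t : open V -> smooth_on V f -> V t ->
  vapply X (fun u => - f u) t = - vapply X f t.
Proof.
move=> oV sf Vt; rewrite (vapply_ext X oV (g := fun u => -1 * f u) _ Vt); last first.
  by move=> u _; rewrite mulN1r.
rewrite (vapplyM X oV (smooth_cst oV (-1)) sf Vt).
by rewrite [X in _ + _ * X](_ : _ = 0) ?mulr0 ?addr0 ?mulN1r//; exact: derive_cst.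
Qed.

Lemma lie_formD V X w w' t : open V -> smooth_on V X -> smooth_on V w -> smooth_on V w' ->
  V t -> lie_form X (fun u => w u + w' u : 'rV[R]_5) t = lie_form X w t + lie_form X w' t.
Proof.
move=> oV sX sw sw' Vt; apply/rowP => j; rewrite [RHS]mxE.
rewrite (lie_formE _ oV sX (form_add_smooth oV sw sw') Vt).
rewrite (lie_formE _ oV sX sw Vt) (lie_formE _ oV sX sw' Vt).
have sw1 := (smooth_rowP oV w).1 sw; have sw1' := (smooth_rowP oV w').1 sw'.
rewrite (vapply_ext _ oV (g := fun u => w u 0 j + w' u 0 j) _ Vt); last by move=> u _; rewrite mxE.
rewrite (vapplyD _ oV (sw1 j) (sw1' j) Vt) addrACA -big_split; congr (_ + _).
by apply: eq_bigr => i _; rewrite mxE mulrDl.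
Qed.

Lemma lie_formZ V X f w t : open V -> smooth_on V X -> smooth_on V f -> smooth_on V w ->
  V t -> lie_form X (fun u => f u *: w u : 'rV[R]_5) t =
  vapply X f t *: w t + f t *: lie_form X w t.
Proof.
move=> oV sX sf sw Vt; apply/rowP => j.
rewrite [RHS]mxE [(_ *: w t) 0 j]mxE [(_ *: lie_form _ _ _) 0 j]mxE.
rewrite (lie_formE _ oV sX (form_scale_smooth oV sf sw) Vt) (lie_formE _ oV sX sw Vt).
have sw1 := (smooth_rowP oV w).1 sw.
rewrite (vapply_ext _ oV (g := fun u => f u * w u 0 j) _ Vt); last by move=> u _; rewrite mxE.
rewrite (vapplyM _ oV sf (sw1 j) Vt).
under eq_bigr do rewrite mxE -mulrA.
by rewrite -mulr_sumr; ring.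
Qed.

(** Lie derivatives commute with the exterior derivative, by the symmetry of
second derivatives. *)
Lemma lie_form_d V X f t : open V -> smooth_on V X -> smooth_on V f -> V t ->
  lie_form X (ext_d f) t = ext_d (vapply X f) t.
Proof.
move=> oV sX sf Vt; apply/rowP => j.
rewrite (lie_formE _ oV sX (ext_d_smooth oV sf) Vt) [RHS]mxE.
have sX' := (smooth_rowP oV X).1 sX.
rewrite (partial_ext (g := fun u => \sum_i X u 0 i * partial i f u) _ oV _ Vt); last first.
  by move=> u Vu; rewrite (vapplyE _ oV sf Vu).
rewrite (partial_sum _ _ _ _ Vt); last first.
  by move=> i; apply: (smoothM oV); [exact: sX' | exact: smooth_partial].
rewrite (vapply_ext _ oV (g := partial j f) _ Vt); last by move=> u _; rewrite mxE.
rewrite (vapplyE _ oV (smooth_partial j sf) Vt) -big_split; apply: eq_bigr => i _ /=.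
rewrite (partialM _ (sX' i) (smooth_partial i sf) Vt) mxE.
by rewrite (partialC _ _ oV sf Vt).
Qed.

End Lie.

(** * Ranks of the beginnings of a sequence *)

Lemma row_free_ker {F : fieldType} {m n : nat} (A : 'M[F]_(m, n)) :
  (forall v : 'rV_m, v *m A = 0 -> v = 0) -> row_free A.
Proof.
move=> H; rewrite -kermx_eq0; apply/eqP/row_matrixP => i.
by rewrite row0; apply: H; rewrite -row_mul mulmx_ker row0.
Qed.

Section Ranks.
Context {F : fieldType} {n : nat}.
Implicit Types (f : nat -> 'rV[F]_n).

(** lie_rank X k t is convertible to rank_upto applied to the sequence i |->
iter i (lie_form X) U t. *)
Definition rank_upto f k := \rank (\matrix_(i < k) f i).

Lemma rank_upto_mono f k l : (k <= l)%N -> (rank_upto f k <= rank_upto f l)%N.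
Proof.
move=> kl; apply: mxrankS; apply/row_subP => i.
have -> : row i (\matrix_(i < k) f i) = row (widen_ord kl i) (\matrix_(i < l) f i).
  by rewrite !rowK.
exact: row_sub.
Qed.

(** Ranks are computed on the coordinates (G, A, B) on three independent rows,
which form a triangular array. *)
Lemma rank_triangular f (G A B : nat -> F) (w0 w1 w2 : 'rV[F]_n) :
  (forall i, f i = G i *: w0 + A i *: w1 + B i *: w2) ->
  (forall x y z, x *: w0 + y *: w1 + z *: w2 = 0 -> [/\ x = 0, y = 0 & z = 0]) ->
  G 0%N != 0 -> A 0%N = 0 -> B 0%N = 0 -> A 1%N != 0 -> B 1%N = 0 ->
  [/\ rank_upto f 1 = 1%N, rank_upto f 2 = 2%N,
      B 2%N != 0 -> rank_upto f 3 = 3%N /\ rank_upto f 4 = 3%N &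
      forall k, (2 <= k)%N -> (forall i, (i < k)%N -> B i = 0) -> rank_upto f k = 2%N].
Proof.
move=> fE free G0 A0 B0 A1 B1.
pose N : 'M[F]_(3, n) := \matrix_(l < 3) (if l == 0 then w0 else if l == 1 then w1 else w2).
pose C k : 'M[F]_(k, 3) := \matrix_(i < k, l < 3) (if l == 0 then G i else if l == 1 then A i else B i).
have NE (v : 'rV_3) : v *m N = v 0 0 *: w0 + v 0 1 *: w1 + v 0 2%:R *: w2.
  rewrite mulmx_sum_row !big_ord_recr big_ord0 /= add0r !rowK/=.
  by congr (_ *: _ + _ *: _ + _ *: _); congr (v _ _); apply: val_inj.
have freeN : row_free N.
  apply: row_free_ker => v; rewrite NE => /free[v0 v1 v2].
  apply/rowP => -[[|[|[|//]]] li]; rewrite mxE.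
  - by rewrite -v0; congr (v _ _); apply: val_inj.
  - by rewrite -v1; congr (v _ _); apply: val_inj.
  - by rewrite -v2; congr (v _ _); apply: val_inj.
have rE k : rank_upto f k = \rank (C k).
  rewrite -(mxrankMfree _ freeN) /rank_upto; congr (\rank _).
  apply/row_matrixP => i; rewrite rowK row_mul NE fE !mxE/=.
  by [].
have free_k k : (k <= 3)%N -> (forall i, (i < k)%N -> (if i is 0%N then G 0%N else if i is 1%N then A 1%N else B 2%N) != 0) ->
   rank_upto f k = k.
  move=> k3 H; rewrite rE; apply/eqP; change (row_free (C k)).
  apply: row_free_ker => v vC.
  have col (l : 'I_3) : \sum_i v 0 i * C k i l = 0.
    by have := congr1 (fun M : 'rV_3 => M 0 l) vC; rewrite !mxE.
  have c0 := col ord0; have c1 := col (Ordinal (isT : 1 < 3)%N).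
  have c2 := col (Ordinal (isT : 2 < 3)%N).
  have solve i x : (i < k)%N -> x * (if i is 0%N then G 0%N else if i is 1%N then A 1%N else B 2%N) = 0 -> x = 0.
    by move=> ik /eqP; rewrite mulf_eq0 (negbTE (H i ik)) orbF => /eqP.
  case: k k3 v H vC col c0 c1 c2 solve => [|[|[|[|//]]]] _ v H vC col c0 c1 c2 solve;
    apply/rowP => -[i li]; rewrite mxE => //.
  - rewrite !big_ord_recr big_ord0 /= !mxE/= add0r in c0.
    by case: i li => // li; rewrite -(solve 0%N _ isT c0); congr (v _ _); apply: val_inj.
  - rewrite !big_ord_recr big_ord0 /= !mxE/= add0r in c0.
    rewrite !big_ord_recr big_ord0 /= !mxE/= add0r in c1.
    rewrite A0 mulr0 add0r in c1; have v1 := solve 1%N _ isT c1.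
    rewrite v1 mul0r addr0 in c0; have v0 := solve 0%N _ isT c0.
    by case: i li => [|[|//]] li; [rewrite -v0|rewrite -v1]; congr (v _ _); apply: val_inj.
  - rewrite !big_ord_recr big_ord0 /= !mxE/= add0r in c0.
    rewrite !big_ord_recr big_ord0 /= !mxE/= add0r in c1.
    rewrite !big_ord_recr big_ord0 /= !mxE/= add0r in c2.
    rewrite B0 B1 !mulr0 !add0r in c2; have v2 := solve 2%N _ isT c2.
    rewrite A0 mulr0 add0r v2 mul0r addr0 in c1; have v1 := solve 1%N _ isT c1.
    rewrite v1 v2 !mul0r !addr0 in c0; have v0 := solve 0%N _ isT c0.
    by case: i li => [|[|[|//]]] li; [rewrite -v0|rewrite -v1|rewrite -v2];
      congr (v _ _); apply: val_inj.
have le2 k : (forall i, (i < k)%N -> B i = 0) -> (rank_upto f k <= 2)%N.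
  move=> Bk; rewrite rE; have -> : C k = C k *m pid_mx 2.
    apply/matrixP => i l; rewrite [RHS]mxE (bigD1 l)//= big1 ?addr0; last first.
      by move=> j jl; rewrite !mxE (inj_eq val_inj) (negbTE jl) mulr0.
    rewrite !mxE eqxx/=; case: l => -[|[|[|//]]] li /=; rewrite ?mulr1//.
    by rewrite mulr0 Bk.
  by rewrite (leq_trans (mxrankM_maxr _ _))// rank_pid_mx.
have r2 : rank_upto f 2 = 2%N by apply: free_k => // -[|[|]].
split=> //.
- by apply: free_k => // -[|].
- move=> B2; have r3 : rank_upto f 3 = 3%N by apply: free_k => // -[|[|[|]]].
  have r4 : (rank_upto f 4 <= 3)%N by rewrite rE; exact: rank_leq_col.
  have r34 : (3 <= rank_upto f 4)%N by rewrite -[X in (X <= _)%N]r3; exact: rank_upto_mono.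
  by split=> //; apply/eqP; rewrite eqn_leq r4 r34.
- move=> k k2 Bk; apply/eqP; rewrite eqn_leq le2//= -[X in (X <= _)%N]r2.
  exact: rank_upto_mono.
Qed.

End Ranks.

Section BasisExtension.
Context {F : fieldType} {n : nat}.
Implicit Types (f : nat -> 'rV[F]_n).

Lemma rank_upto_step f k : rank_upto f k = k ->
  ~~ (f k <= \matrix_(i < k) f i)%MS -> rank_upto f k.+1 = k.+1.
Proof.
move=> rk nin; apply/eqP; change (row_free (\matrix_(i < k.+1) f i)).
apply: row_free_ker => v; rewrite mulmx_sum_row big_ord_recr /= rowK => H.
set M := \matrix_(i < k) f i in nin.
pose w : 'rV_k := \row_i v 0 (widen_ord (leqnSn k) i).
have E : w *m M = - (v 0 ord_max *: f k).
  rewrite mulmx_sum_row; apply/eqP; rewrite -subr_eq0 opprK; apply/eqP.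
  rewrite -[RHS]H; congr (_ + _); apply: eq_bigr => i _.
  by rewrite !rowK mxE.
have vk : v 0 ord_max = 0.
  apply/eqP; apply: contraNT nin => nz; apply/submxP; exists (- (v 0 ord_max)^-1 *: w).
  by rewrite -scalemxAl E scalerN scaleNr opprK scalerA mulVf// scale1r.
have fM : row_free M by rewrite /row_free -[X in _ == X]rk.
have w0 : w = 0.
  by apply: (row_free_inj fM); rewrite mul0mx E vk scale0r oppr0.
apply/rowP => i; rewrite mxE; case: (unliftP ord_max i) => [j ->|-> //].
have := congr1 (fun w : 'rV_k => w 0 j) w0; rewrite !mxE => <-.
by congr (v _ _); apply: val_inj; rewrite /= /bump leqNgt ltn_ord.
Qed.

Lemma rank_upto_sub f k : rank_upto f k = k -> rank_upto f k.+1 = k ->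
  (f k <= \matrix_(i < k) f i)%MS.
Proof.
move=> rk rk1; apply/negPn/negP => /(rank_upto_step rk); rewrite rk1.
by move/eqP; rewrite eqn_leq ltnn andbF.
Qed.

Lemma rank_upto_ext f g k : (forall i, (i < k)%N -> f i = g i) ->
  rank_upto f k = rank_upto g k.
Proof.
by move=> fg; congr (\rank _); apply/row_matrixP => i; rewrite !rowK fg.
Qed.

Lemma basis_extension f k : (k <= n)%N -> rank_upto f k = k ->
  exists2 g : nat -> 'rV[F]_n, forall i, (i < k)%N -> g i = f i & rank_upto g n = n.
Proof.
move=> kn; have [l El] : exists l, (k + l = n)%N by exists (n - k)%N; rewrite subnKC.
elim: l k kn El f => [|l IH] k kn El f rk.
  by exists f => //; move: El rk; rewrite addn0 => ->.
have kn' : (k < n)%N by rewrite -El addnS ltnS leq_addr.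
set M := \matrix_(i < k) f i.
have [j nj] : exists j : 'I_n, ~~ (('e_j : 'rV[F]_n) <= M)%MS.
  apply/existsP; rewrite -negb_forall; apply/negP => /forallP H.
  have : (1%:M <= M)%MS by apply/row_subP => j; rewrite row1; exact: H.
  move=> /mxrankS; rewrite mxrank1 => /leq_trans /(_ (eq_leq rk)).
  by rewrite leqNgt kn'.
pose f1 i := if (i < k)%N then f i else 'e_j.
have f1E i : (i < k)%N -> f1 i = f i by move=> ik; rewrite /f1 ik.
have rk1 : rank_upto f1 k.+1 = k.+1.
  apply: rank_upto_step; first by rewrite (rank_upto_ext f1E).
  rewrite {1}/f1 ltnn (_ : \matrix_(i < k) f1 i = M)//.
  by apply/row_matrixP => i; rewrite !rowK f1E.
have [|g gE rg] := IH k.+1 kn' _ f1 rk1; first by rewrite addSnnS.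
by exists g => // i ik; rewrite gE ?f1E// ltnS ltnW.
Qed.

End BasisExtension.

(** * Ranks in a chart adapted to the field *)

Section Chart.
Context {R : realType}.
Implicit Types (X : vfield (R := R)) (w : oneform (R := R)) (f g : 'rV[R]_5 -> R).
Implicit Types (V : set 'rV[R]_5) (phi psi : 'rV[R]_5 -> 'rV[R]_5).

Lemma pairing_delta (w : 'rV[R]_5) j : pairing w 'e_j = w 0 j.
Proof.
rewrite /pairing (bigD1 j)//= big1 ?addr0; last first.
  by move=> i /negbTE ij; rewrite mxE eqxx/= ij mulr0.
by rewrite mxE !eqxx mulr1.
Qed.

Lemma UE (m : 'rV[R]_5) j :
  U m 0 j = (j == iz)%:R - m 0 ip * (j == ix)%:R - m 0 iq * (j == iy)%:R.
Proof. by rewrite !mxE !partial_coord !(eq_sym j). Qed.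

(** The vector e_j - u_j e_z lies in the kernel of u, since u_z = 1; that w
vanishes on it gives w_j = w_z u_j. As e_z is not in the kernel, w_z <> 0. *)
Lemma same_kernel_proportional (w u : 'rV[R]_5) : u 0 iz = 1 ->
  [set v | pairing w v = 0] = [set v | pairing u v = 0] ->
  w = w 0 iz *: u /\ w 0 iz != 0.
Proof.
move=> uz ker.
have kerE v : pairing u v = 0 -> pairing w v = 0.
  by move=> uv; have : [set v | pairing u v = 0] v by []; rewrite -ker.
have pD (a : 'rV[R]_5) v v' c : pairing a (v - c *: v') = pairing a v - c * pairing a v'.
  rewrite /pairing mulr_sumr -sumrB; apply: eq_bigr => i _; rewrite !mxE; ring.
have wE : w = w 0 iz *: u.
  apply/rowP => j; rewrite mxE.
  have := kerE ('e_j - u 0 j *: 'e_iz); rewrite !pD !pairing_delta uz mulr1 subrr.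
  by move=> /(_ erefl)/eqP; rewrite subr_eq0 => /eqP ->; rewrite mulrC.
split=> //; apply/eqP => wz.
have : [set v | pairing w v = 0] 'e_iz by rewrite /= pairing_delta.
by rewrite ker /= pairing_delta uz => /eqP; rewrite oner_eq0.
Qed.

Let proportional_inv (w u : 'rV[R]_5) : w = w 0 iz *: u -> w 0 iz != 0 ->
  u = (w 0 iz)^-1 *: w.
Proof. by move=> E n0; rewrite {2}E scalerA mulVf// scale1r. Qed.

Let lie_combination (u v w : 'rV[R]_5) (p q r s x y z k : R) :
  p *: u + x *: (- k *: v) + (q *: v + y *: (r *: w)) + (s *: w + z *: 0) =
  p *: u + (q - x * k) *: v + (s + y * r) *: w.
Proof. by apply/rowP => j; rewrite !mxE; ring. Qed.

Context (V : set 'rV[R]_5) (phi psi : 'rV[R]_5 -> 'rV[R]_5) (X : vfield (R := R)).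
Context (a b : 'rV[R]_5 -> R).
Hypothesis chart : contact_chart V phi psi.
Hypothesis sX : smooth_on V X.
Hypothesis (sa : smooth_on V a) (sb : smooth_on V b).
Hypothesis a0 : forall t, V t -> a t != 0.
Hypothesis XE : forall t, V t ->
  X t = a t *: coord_field phi psi ip t + b t *: coord_field phi psi iq t.

Let oV := chart_open chart.
Let sphi := chart_smooth chart.
Let sphi' := (smooth_rowP oV phi).1 sphi.

Let jinv t : V t -> jac psi (phi t) *m jac phi t = 1%:M.
Proof.
move=> Vt; apply: (jac_inverse oV sphi (chart_open_image chart)) => //.
- exact: chart_inv_smooth chart.
- exact: chart_invK chart.
Qed.

Lemma coord_field_jac k t : V t -> coord_field phi psi k t = row k (jac psi (phi t)).
Proof.
move=> Vt; apply/rowP => j.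
have Wt : (phi @` V) (phi t) by exists t.
rewrite [LHS](partial_row k j (chart_open_image chart) (chart_inv_smooth chart) Wt).
by rewrite !mxE.
Qed.

Lemma vapply_coord i t : V t -> vapply X (fun u => phi u 0 i) t =
  a t * (ip == i)%:R + b t * (iq == i)%:R.
Proof.
move=> Vt; rewrite /vapply (derive_jac _ _ oV sphi Vt) XE// !coord_field_jac//.
rewrite mulmxDl -!scalemxAl -!row_mul jinv// !mxE.
by [].
Qed.

Let c u := b u / a u.
Let sc : smooth_on V c.
Proof. by apply: (smoothM oV sb); exact: (smoothV oV a0 sa). Qed.

Let dx := ext_d (fun u => phi u 0 ix).
Let dy := ext_d (fun u => phi u 0 iy).
Let dz := ext_d (fun u => phi u 0 iz).
Let U' := contact_form phi.
Let theta t := dx t + c t *: dy t.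
Let g t := (U' t 0 iz)^-1.

Let sdx : smooth_on V dx. Proof. exact: (ext_d_smooth oV (sphi' _)). Qed.
Let sdy : smooth_on V dy. Proof. exact: (ext_d_smooth oV (sphi' _)). Qed.
Let sdz : smooth_on V dz. Proof. exact: (ext_d_smooth oV (sphi' _)). Qed.
Let stheta : smooth_on V theta.
Proof. exact: (form_add_smooth oV sdx (form_scale_smooth oV sc sdy)). Qed.

Let U'E t : U' t = (dz t + (- phi t 0 ip) *: dx t) + (- phi t 0 iq) *: dy t.
Proof. by rewrite /U' /contact_form !scaleNr. Qed.

Let sU' : smooth_on V U'.
Proof.
apply/(smooth_rowP oV) => j; apply: (smooth_ext oV (f := fun t =>
  ((dz t + (- phi t 0 ip) *: dx t) + (- phi t 0 iq) *: dy t) 0 j)).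
  by move=> t _; rewrite U'E.
move: j; apply/(smooth_rowP oV).
exact: (form_add_smooth oV (form_add_smooth oV sdz
  (form_scale_smooth oV (smoothN oV (sphi' ip)) sdx))
  (form_scale_smooth oV (smoothN oV (sphi' iq)) sdy)).
Qed.

Let U'U t : V t -> U' t = U' t 0 iz *: U t /\ U' t 0 iz != 0.
Proof.
move=> Vt; have H := chart_contact chart Vt.
have Uz : U t 0 iz = 1 by rewrite UE !eqxx/= !mulr0 !subr0.
exact: (same_kernel_proportional Uz H).
Qed.

Let sg : smooth_on V g.
Proof.
apply: (smoothV oV) => [t Vt|]; first exact: (U'U Vt).2.
exact: ((smooth_rowP oV U').1 sU' iz).
Qed.

Let lie_d0 f t : smooth_on V f -> (forall u, V u -> vapply X f u = 0) -> V t ->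
  lie_form X (ext_d f) t = 0.
Proof.
move=> sf Xf Vt; rewrite (lie_form_d oV sX sf Vt); apply/rowP => j; rewrite !mxE.
by rewrite (partial_ext (g := fun=> 0) j oV Xf Vt) partial_cst.
Qed.

Let lie_dx t : V t -> lie_form X dx t = 0.
Proof.
move=> Vt; apply: (lie_d0 (sphi' ix) _ Vt) => u Vu.
by rewrite (vapply_coord ix Vu) /= !mulr0 addr0.
Qed.
Let lie_dy t : V t -> lie_form X dy t = 0.
Proof.
move=> Vt; apply: (lie_d0 (sphi' iy) _ Vt) => u Vu.
by rewrite (vapply_coord iy Vu) /= !mulr0 addr0.
Qed.
Let lie_dz t : V t -> lie_form X dz t = 0.
Proof.
move=> Vt; apply: (lie_d0 (sphi' iz) _ Vt) => u Vu.
by rewrite (vapply_coord iz Vu) /= !mulr0 addr0.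
Qed.

Let lie_theta t : V t -> lie_form X theta t = vapply X c t *: dy t.
Proof.
move=> Vt; rewrite (lie_formD oV sX sdx (form_scale_smooth oV sc sdy) Vt).
by rewrite (lie_formZ oV sX sc sdy Vt) (lie_dx Vt) (lie_dy Vt) scaler0 add0r addr0.
Qed.

Let lie_U' t : V t -> lie_form X U' t = - a t *: theta t.
Proof.
move=> Vt; have sp := smoothN oV (sphi' ip); have sq := smoothN oV (sphi' iq).
rewrite (lie_form_ext X oV (w' := fun t => (dz t + (- phi t 0 ip) *: dx t) + (- phi t 0 iq) *: dy t) _ Vt); last first.
  by move=> u _; exact: U'E.
rewrite (lie_formD oV sX (form_add_smooth oV sdz (form_scale_smooth oV sp sdx)) (form_scale_smooth oV sq sdy) Vt).
rewrite (lie_formD oV sX sdz (form_scale_smooth oV sp sdx) Vt).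
rewrite (lie_formZ oV sX sp sdx Vt) (lie_formZ oV sX sq sdy Vt).
rewrite (lie_dx Vt) (lie_dy Vt) (lie_dz Vt) !scaler0 add0r !addr0.
rewrite (vapplyN X oV (sphi' ip) Vt) (vapplyN X oV (sphi' iq) Vt).
rewrite (vapply_coord ip Vt) (vapply_coord iq Vt) !eqxx !mulr1 !mulr0 addr0 add0r /theta scalerDr scalerA.
by rewrite /c mulNr mulrCA mulfV ?mulr1// a0.
Qed.

(** The coordinates of the iterated Lie derivatives of U on dz - p dx - q dy,
dx + c dy and dy: X sends the first form to - a times the second, the second
to X(c) dy, and dy to 0. *)
Fixpoint coefs i : ('rV[R]_5 -> R) * ('rV[R]_5 -> R) * ('rV[R]_5 -> R) :=
  if i is i'.+1 then
    let '(G, A, B) := coefs i' in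
    (vapply X G, fun t => vapply X A t - G t * a t, fun t => vapply X B t + A t * vapply X c t)
  else (g, fun=> 0, fun=> 0).

Let cG i := (coefs i).1.1.
Let cA i := (coefs i).1.2.
Let cB i := (coefs i).2.

Let coefsS i : [/\ cG i.+1 = vapply X (cG i),
  cA i.+1 = (fun t => vapply X (cA i) t - cG i t * a t) &
  cB i.+1 = (fun t => vapply X (cB i) t + cA i t * vapply X c t)].
Proof. by rewrite /cG /cA /cB /=; case: (coefs i) => [[]]. Qed.

Let coefs_smooth i : [/\ smooth_on V (cG i), smooth_on V (cA i) & smooth_on V (cB i)].
Proof.
elim: i => [|i [sG sA sB]].
  exact: And3 sg (smooth_cst oV 0) (smooth_cst oV 0).
have [-> -> ->] := coefsS i; split.
- exact: (vapply_smooth oV sX sG).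
- exact: (smoothB oV (vapply_smooth oV sX sA) (smoothM oV sG sa)).
- exact: (smoothD oV (vapply_smooth oV sX sB) (smoothM oV sA (vapply_smooth oV sX sc))).
Qed.

Let iter_coefs i t : V t -> iter i (lie_form X) U t =
  cG i t *: U' t + cA i t *: theta t + cB i t *: dy t.
Proof.
elim: i t => [|i IH] t Vt.
  have [E n0] := U'U Vt.
  have -> : cA 0 t *: theta t = 0 by exact: scale0r.
  have -> : cB 0 t *: dy t = 0 by exact: scale0r.
  by rewrite !addr0; exact: proportional_inv E n0.
have [sG sA sB] := coefs_smooth i.
rewrite iterS (lie_form_ext X oV IH Vt).
have s1 := form_scale_smooth oV sG sU'; have s2 := form_scale_smooth oV sA stheta.
have s3 := form_scale_smooth oV sB sdy.
rewrite (lie_formD oV sX (form_add_smooth oV s1 s2) s3 Vt) (lie_formD oV sX s1 s2 Vt).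
rewrite (lie_formZ oV sX sG sU' Vt) (lie_formZ oV sX sA stheta Vt) (lie_formZ oV sX sB sdy Vt).
rewrite (lie_U' Vt) (lie_theta Vt) (lie_dy Vt).
have [-> -> ->] := coefsS i; exact: lie_combination.
Qed.

Let chart_free t x y z : V t ->
  x *: U' t + y *: theta t + z *: dy t = 0 -> [/\ x = 0, y = 0 & z = 0].
Proof.
move=> Vt H.
have dE i : ext_d (fun u => phi u 0 i) t *m (jac psi (phi t))^T = 'e_i.
  have -> : ext_d (fun u => phi u 0 i) t = row i (jac phi t)^T.
    by apply/rowP => j; rewrite !mxE.
  by rewrite -row_mul -trmx_mul jinv// trmx1 row1.
have := congr1 (fun w : 'rV[R]_5 => w *m (jac psi (phi t))^T) H.
rewrite mul0mx U'E /theta !mulmxDl -!scalemxAl !mulmxDl -!scalemxAl !dE => E.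
have Ej j := congr1 (fun w : 'rV[R]_5 => w 0 j) E.
have x0 : x = 0 by have := Ej iz; rewrite !mxE/= => <-; ring.
have y0 : y = 0 by have := Ej ix; rewrite x0 !mxE/= => <-; ring.
by split=> //; have := Ej iy; rewrite x0 y0 !mxE/= => <-; ring.
Qed.

(** The coordinates of U, X(U) and X^2(U) are triangular, with diagonal g, - g
a and - g a X(c). Four forms in the span of three have rank at most 3. *)
Lemma chart_lie_rank t : V t ->
  [/\ lie_rank X 1 t = 1%N, lie_rank X 2 t = 2%N,
      vapply X c t = 0 -> lie_rank X 3 t = 2%N &
      vapply X c t != 0 -> lie_rank X 3 t = 3%N /\ lie_rank X 4 t = 3%N].
Proof.
move=> Vt; have [_ g0] := U'U Vt; have gn0 : g t != 0 by rewrite invr_eq0.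
have X0 u : vapply X (fun=> 0) u = 0 by exact: derive_cst.
have A1 u : cA 1 u = - (g u * a u) by have [_ -> _] := coefsS 0; rewrite X0 sub0r.
have B1 u : cB 1 u = 0 by have [_ _ ->] := coefsS 0; rewrite X0 add0r mul0r.
have B2 u : cB 2 u = - (g u * a u) * vapply X c u.
  have [_ _ ->] := coefsS 1; rewrite A1 (_ : cB 1 = fun=> 0) ?X0 ?add0r//.
  by apply/funext => s; rewrite B1.
have A1n0 : cA 1 t != 0 by rewrite A1 oppr_eq0 (mulf_neq0 gn0 (a0 Vt)).
have [r1 r2 r3 r4] := rank_triangular (f := fun i => iter i (lie_form X) U t)
  (G := fun i => cG i t) (A := fun i => cA i t) (B := fun i => cB i t)
  (fun i => iter_coefs i Vt) (fun x y z => @chart_free t x y z Vt)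
  gn0 erefl erefl A1n0 (B1 t).
have r3' : vapply X c t = 0 -> lie_rank X 3 t = 2%N.
  move=> c0; apply: (r4 3%N isT) => -[|[|[|//]]] _; [exact: erefl|exact: B1|].
  by rewrite B2 c0 mulr0.
have r4' : vapply X c t != 0 -> lie_rank X 3 t = 3%N /\ lie_rank X 4 t = 3%N.
  by move=> c0; apply: r3; rewrite B2 mulf_neq0// -A1.
exact: And4 r1 r2 r3' r4'.
Qed.

(** The coordinate on dy is created by X(c) only. The vanishing of X(c) at the
single point t would not suffice, since it is differentiated along X. *)
Lemma chart_lie_rank2 : (forall t, V t -> vapply X c t = 0) ->
  forall k t, (2 <= k)%N -> V t -> lie_rank X k t = 2%N.
Proof.
move=> Xc k t k2 Vt; have [_ g0] := U'U Vt; have gn0 : g t != 0 by rewrite invr_eq0.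
have X0 u : vapply X (fun=> 0) u = 0 by exact: derive_cst.
have A1 u : cA 1 u = - (g u * a u) by have [_ -> _] := coefsS 0; rewrite X0 sub0r.
have B0 i : forall u, V u -> cB i u = 0.
  elim: i => [//|i IH] u Vu; have [_ _ ->] := coefsS i.
  by rewrite Xc// mulr0 addr0 (vapply_ext X oV IH Vu) X0.
have A1n0 : cA 1 t != 0 by rewrite A1 oppr_eq0 (mulf_neq0 gn0 (a0 Vt)).
have [_ _ _ r4] := rank_triangular (f := fun i => iter i (lie_form X) U t)
  (G := fun i => cG i t) (A := fun i => cA i t) (B := fun i => cB i t)
  (fun i => iter_coefs i Vt) (fun x y z => @chart_free t x y z Vt)
  gn0 erefl erefl A1n0 (B0 1%N t Vt).
by apply: (r4 k k2) => i _; exact: (B0 i t Vt).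
Qed.

End Chart.

(** * Contact charts made of first integrals *)

Section ContactGeometry.
Context {R : realType}.
Implicit Types (X : vfield (R := R)) (w : oneform (R := R)) (f g : 'rV[R]_5 -> R).
Implicit Types (V W : set 'rV[R]_5) (t m : 'rV[R]_5).

Lemma sum5 (G : 'I_5 -> R) : \sum_i G i = G ix + G iy + G iz + G ip + G iq.
Proof.
rewrite !big_ord_recr big_ord0 /= add0r.
by congr (G _ + G _ + G _ + G _ + G _); apply: val_inj.
Qed.

Lemma ord5P (P : 'I_5 -> Prop) : P ix -> P iy -> P iz -> P ip -> P iq ->
  forall j, P j.
Proof.
move=> hx hy hz hp hq [[|[|[|[|[|//]]]]] li].
- by rewrite (_ : Ordinal li = ix); last exact: val_inj.
- by rewrite (_ : Ordinal li = iy); last exact: val_inj.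
- by rewrite (_ : Ordinal li = iz); last exact: val_inj.
- by rewrite (_ : Ordinal li = ip); last exact: val_inj.
- by rewrite (_ : Ordinal li = iq); last exact: val_inj.
Qed.

Lemma row5P (v w : 'rV[R]_5) : v 0 ix = w 0 ix -> v 0 iy = w 0 iy ->
  v 0 iz = w 0 iz -> v 0 ip = w 0 ip -> v 0 iq = w 0 iq -> v = w.
Proof. by move=> hx hy hz hp hq; apply/rowP; apply: ord5P. Qed.

Lemma UjE j : (fun m : 'rV[R]_5 => U m 0 j) = (fun m : 'rV[R]_5 =>
  (j == iz)%:R - m 0 ip * (j == ix)%:R - m 0 iq * (j == iy)%:R).
Proof. by apply/funext => m; exact: UE. Qed.

Lemma U_smooth V : open V -> smooth_on V (@U R).
Proof.
move=> oV; apply/(smooth_rowP oV) => j; rewrite UjE.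
apply: (smoothB oV); [apply: (smoothB oV)|].
- exact: (smooth_cst oV).
- exact: (smoothM oV (smooth_coord oV _) (smooth_cst oV _)).
- exact: (smoothM oV (smooth_coord oV _) (smooth_cst oV _)).
Qed.

Let opT : open [set: 'rV[R]_5]. Proof. exact: openT. Qed.

Lemma partial_U i j m : partial i (fun m : 'rV[R]_5 => U m 0 j) m =
  - ((i == ip)%:R * (j == ix)%:R) - (i == iq)%:R * (j == iy)%:R.
Proof.
rewrite UjE.
have s0 := smooth_cst (opT) ((j == iz)%:R : R).
have s1 := smoothM opT (smooth_coord opT ip) (smooth_cst opT ((j == ix)%:R : R)).
have s2 := smoothM opT (smooth_coord opT iq) (smooth_cst opT ((j == iy)%:R : R)).
have mT : [set: 'rV[R]_5] m by [].
rewrite (partialD i (smoothD opT s0 (smoothN opT s1)) (smoothN opT s2) mT).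
rewrite (partialD i s0 (smoothN opT s1) mT) partial_cst add0r.
have pN f : smooth_on [set: 'rV[R]_5] f -> partial i (fun u => - f u) m = - partial i f m.
  by move=> sf; have [_ E] := is_deriveN (smooth_is_derive i sf mT).
rewrite (pN _ s1) (pN _ s2).
rewrite (partialM i (smooth_coord opT ip) (smooth_cst opT _) mT).
rewrite (partialM i (smooth_coord opT iq) (smooth_cst opT _) mT).
by rewrite !partial_cst !partial_coord !mulr0 !add0r ![(_ == _)%:R * (i == _)%:R]mulrC.
Qed.

(** As U(X) = 0, this is the contraction of X with dU = dx ^ dp + dy ^ dq. *)
Lemma lie_U V X m : open V -> smooth_on V X -> (forall t, V t -> contact t (X t)) -> V m ->
  lie_form X U m = \row_j (- X m 0 ip * (j == ix)%:R - X m 0 iq * (j == iy)%:R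
    + X m 0 ix * (j == ip)%:R + X m 0 iy * (j == iq)%:R).
Proof.
move=> oV sX cX Vm; have sX' := (smooth_rowP oV X).1 sX.
have sU' := (smooth_rowP oV _).1 (U_smooth oV).
apply/rowP => j; rewrite (lie_formE _ oV sX (U_smooth oV) Vm) mxE.
have : partial j (fun u => \sum_i U u 0 i * X u 0 i) m = 0.
  by rewrite (partial_ext (g := fun=> 0) j oV _ Vm) ?partial_cst.
rewrite (partial_sum _ _ _ (fun i => smoothM oV (sU' i) (sX' i)) Vm).
under eq_bigr => i _ do rewrite (partialM j (sU' i) (sX' i) Vm).
rewrite big_split /= => /eqP; rewrite addr_eq0 => /eqP ->.
rewrite (vapplyE X oV (sU' j) Vm) !sum5 !partial_U.
by rewrite !eqxx /=; ring.
Qed.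

Lemma lie_U_components V X m : open V -> smooth_on V X ->
  (forall t, V t -> contact t (X t)) -> V m ->
  [/\ lie_form X U m 0 ix = - X m 0 ip, lie_form X U m 0 iy = - X m 0 iq,
      lie_form X U m 0 iz = 0, lie_form X U m 0 ip = X m 0 ix &
      lie_form X U m 0 iq = X m 0 iy].
Proof.
by move=> oV sX cX Vm; split; rewrite (lie_U oV sX cX Vm) mxE/=; ring.
Qed.

(** dU is non-degenerate on the contact distribution, and the contraction of X
with dU has no dz component: it is not a multiple of U unless X = 0. *)
Lemma lie_rank2 V X m : open V -> smooth_on V X -> (forall t, V t -> contact t (X t)) -> V m ->
  X m != 0 -> lie_rank X 2 m = 2%N.
Proof.
move=> oV sX cX Vm X0; apply/eqP; change (row_free (\matrix_(i < 2) iter i (lie_form X) U m)).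
have [Lx Ly Lz Lp Lq] := lie_U_components oV sX cX Vm.
apply: row_free_ker => v; rewrite mulmx_sum_row !big_ord_recr big_ord0 /= add0r !rowK /=.
set v0 := v 0 _; set v1 := v 0 _ => H.
have Hj j : v0 * U m 0 j + v1 * lie_form X U m 0 j = 0.
  have := congr1 (fun w : 'rV[R]_5 => w 0 j) H.
  by rewrite [(0 : 'rV[R]_5) 0 j]mxE => <-; rewrite [RHS]mxE; congr (_ + _); rewrite [RHS]mxE.
have e0 : v0 = 0.
  by rewrite -[RHS](Hj iz) Lz UE/=; ring.
have e1 : v1 = 0.
  apply/eqP; apply: contraNT X0 => n1.
  have K j : (lie_form X U m) 0 j = 0.
    by have := Hj j; rewrite e0 mul0r add0r => /eqP; rewrite mulf_eq0 (negbTE n1)/= => /eqP.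
  have xp : X m 0 ip = 0 by apply/eqP; rewrite -oppr_eq0 -Lx K.
  have xq : X m 0 iq = 0 by apply/eqP; rewrite -oppr_eq0 -Ly K.
  have xx : X m 0 ix = 0 by rewrite -Lp K.
  have xy : X m 0 iy = 0 by rewrite -Lq K.
  have xz : X m 0 iz = 0.
    by have := cX m Vm; rewrite /contact/= /pairing sum5 xx xy xp xq !UE/= => <-; ring.
  by apply/eqP/row5P; rewrite mxE.
apply/rowP => -[[|[|//]] li]; rewrite mxE.
- by rewrite -e0 /v0; congr (v _ _); apply: val_inj.
- by rewrite -e1 /v1; congr (v _ _); apply: val_inj.
Qed.

Lemma rowZ (u : 'rV[R]_5) p j : (p *: u) 0 j = p * u 0 j.
Proof. by rewrite mxE. Qed.

Lemma row_comb2 (u v : 'rV[R]_5) p q j :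
  (p *: u + q *: v) 0 j = p * u 0 j + q * v 0 j.
Proof. by rewrite !mxE. Qed.

Lemma d_comb (A B C : 'rV[R]_5 -> R) t p q j :
  (ext_d A t + p *: ext_d B t + q *: ext_d C t) 0 j =
  partial j A t + p * partial j B t + q * partial j C t.
Proof. by rewrite !mxE. Qed.

Let dF_alg (a b c d e p q : R) :
  a + (p * b + 0 * c) + (q * d + 0 * e) = a + p * b + q * d.
Proof. by ring. Qed.

(** For the constant field Y with value v, the contraction of v with dU is L_Y
U - d(U(Y)). If v kills the five functions, this is Y(g) / g times U at m.
Having no dz component, it vanishes, so that v is a multiple of d/dz; and U(v)
= 0 forces v = 0. *)
Lemma contact_functions_free W (fx fy fz p q g : 'rV[R]_5 -> R) m : 
  open W -> smooth_on W fx -> smooth_on W fy -> smooth_on W fz -> smooth_on W p ->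
  smooth_on W q -> smooth_on W g -> W m -> g m != 0 ->
  (forall t, W t -> U t = g t *: (ext_d fz t - p t *: ext_d fx t - q t *: ext_d fy t)) ->
  forall v : 'rV[R]_5, 'D_v fx m = 0 -> 'D_v fy m = 0 -> 'D_v fz m = 0 ->
    'D_v p m = 0 -> 'D_v q m = 0 -> v = 0.
Proof.
move=> oW sfx sfy sfz sp sq sg Wm g0 UE' v vx vy vz vp vq.
pose Y : vfield (R := R) := cst v.
have sY : smooth_on W Y by apply/(smooth_rowP oW) => j; exact: (smooth_cst oW (v 0 j)).
pose w t := (ext_d fz t + (- p t) *: ext_d fx t) + (- q t) *: ext_d fy t.
have UW t : W t -> U t = g t *: w t by move=> Wt; rewrite UE'// /w !scaleNr.
have Yx : vapply Y fx m = 0 by exact: vx.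
have Yy : vapply Y fy m = 0 by exact: vy.
have Yz : vapply Y fz m = 0 by exact: vz.
have sdx := ext_d_smooth oW sfx; have sdy := ext_d_smooth oW sfy.
have sdz := ext_d_smooth oW sfz.
have snp := smoothN oW sp; have snq := smoothN oW sq.
have spx := form_scale_smooth oW snp sdx; have sqy := form_scale_smooth oW snq sdy.
have sw : smooth_on W w by exact: (form_add_smooth oW (form_add_smooth oW sdz spx) sqy).
pose F t := (vapply Y fz t + (- p t) * vapply Y fx t) + (- q t) * vapply Y fy t.
  have sYx := vapply_smooth oW sY sfx; have sYy := vapply_smooth oW sY sfy.
  have sYz := vapply_smooth oW sY sfz.
  have sFx := smoothM oW snp sYx; have sFy := smoothM oW snq sYy.
  have sFz := smoothD oW sYz sFx.
  have sF : smooth_on W F by exact: (smoothD oW sFz sFy).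
  have F0 : F m = 0 by rewrite /F Yx Yy Yz !mulr0 !addr0.
  have dF j : partial j F m = partial j (vapply Y fz) m + (- p m) * partial j (vapply Y fx) m
      + (- q m) * partial j (vapply Y fy) m.
    rewrite (partialD j sFz sFy Wm) (partialD j sYz sFx Wm).
    rewrite (partialM j snp sYx Wm) (partialM j snq sYy Wm) Yx Yy.
    exact: dF_alg.
  have YN f : smooth_on W f -> vapply Y f m = 0 -> vapply Y (fun u => - f u) m = 0.
    by move=> sf h; rewrite (vapplyN Y oW sf Wm) h oppr0.
  have lw j : lie_form Y w m 0 j = partial j F m.
    rewrite (lie_formD oW sY (form_add_smooth oW sdz spx) sqy Wm) (lie_formD oW sY sdz spx Wm).
    rewrite (lie_formZ oW sY snp sdx Wm) (lie_formZ oW sY snq sdy Wm).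
    rewrite (YN p sp vp) (YN q sq vq) !scale0r !add0r.
    rewrite (lie_form_d oW sY sfx Wm) (lie_form_d oW sY sfy Wm) (lie_form_d oW sY sfz Wm).
    by rewrite dF (d_comb (vapply Y fz) (vapply Y fx) (vapply Y fy)).
  have lU j : lie_form Y U m 0 j = vapply Y g m * w m 0 j + g m * partial j F m.
    by rewrite (lie_form_ext Y oW UW Wm) (lie_formZ oW sY sg sw Wm) -lw row_comb2.
  have sU' := (smooth_rowP oW _).1 (U_smooth oW).
  have lU' j : lie_form Y U m 0 j = \sum_i v 0 i * partial i (fun t => U t 0 j) m.
    rewrite (lie_formE _ oW sY (U_smooth oW) Wm) (vapplyE Y oW (sU' j) Wm).
    by rewrite [X in _ + X]big1 ?addr0// => i _; rewrite /Y/= partial_cst mulr0.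
  have Uv t : W t -> \sum_i U t 0 i * v 0 i = g t * F t.
    move=> Wt; rewrite /F (vapplyE Y oW sfx Wt) (vapplyE Y oW sfy Wt) (vapplyE Y oW sfz Wt).
    rewrite UW// !mulr_sumr -!big_split mulr_sumr; apply: eq_bigr => i _.
    by rewrite !mxE /Y/=; ring.
  have dUv j : \sum_i v 0 i * partial j (fun t => U t 0 i) m = g m * partial j F m.
    have <- : partial j (fun t => g t * F t) m = g m * partial j F m.
      by rewrite (partialM j sg sF Wm) F0 mul0r addr0.
    rewrite -(partial_ext j oW Uv Wm).
    have sUv i : smooth_on W (fun t => U t 0 i * v 0 i).
      exact: (smoothM oW (sU' i) (smooth_cst oW (v 0 i))).
    rewrite (partial_sum _ _ _ sUv Wm); apply: eq_bigr => i _.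
    by rewrite (partialM j (sU' i) (smooth_cst oW (v 0 i)) Wm) partial_cst mulr0 add0r.
  have main j : \sum_i v 0 i * partial i (fun t => U t 0 j) m -
      \sum_i v 0 i * partial j (fun t => U t 0 i) m = vapply Y g m * w m 0 j.
    by rewrite dUv -lU' lU addrK.
  have wU j : w m 0 j = (g m)^-1 * U m 0 j by rewrite UW// rowZ mulrA mulVf// mul1r.
  have Yg : vapply Y g m = 0.
    have := main iz; rewrite !sum5 !partial_U wU UE /= => h.
    have : vapply Y g m * (g m)^-1 = 0 by rewrite !mulr0 !subr0 !mulr1 in h; rewrite -h; ring.
    by move/eqP; rewrite mulf_eq0 invr_eq0 (negbTE g0) orbF => /eqP.
  have main0 j : \sum_i v 0 i * partial i (fun t => U t 0 j) m -
      \sum_i v 0 i * partial j (fun t => U t 0 i) m = 0 by rewrite main Yg mul0r.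
  have vvp : v 0 ip = 0.
    by have := main0 ix; rewrite !sum5 !partial_U /= => h; rewrite -[RHS]oppr0 -h; ring.
  have vvq : v 0 iq = 0.
    by have := main0 iy; rewrite !sum5 !partial_U /= => h; rewrite -[RHS]oppr0 -h; ring.
  have vvx : v 0 ix = 0.
    by have := main0 ip; rewrite !sum5 !partial_U /= => <-; ring.
  have vvy : v 0 iy = 0.
    by have := main0 iq; rewrite !sum5 !partial_U /= => <-; ring.
  have vvz : v 0 iz = 0.
    by have := Uv m Wm; rewrite F0 mulr0 sum5 vvp vvq vvx vvy !UE/= => <-; ring.
  by apply: row5P; rewrite mxE.
Qed.

Lemma open_neq0 (O : set 'rV[R]_5) f : open O -> smooth_on O f ->
  open (O `&` [set t | f t != 0]).
Proof.
move=> oO sf; apply: openP => t [Ot ft]; have cf := smooth_continuous sf Ot.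
have n0 : 0 < `|f t| by rewrite normr_gt0.
have ltr0n2 : 0 < 2 :> R by [].
apply: filterS2 (open_near oO Ot) ((continuous_eps _ _).1 cf (`|f t| / 2) (divr_gt0 n0 ltr0n2)) => s Os h.
split=> //=; apply: contraTneq h => ->; rewrite subr0 -ltNge.
by rewrite ltr_pdivrMr// ltr_pMr// ltr1n.
Qed.

Lemma pairingZ (c : R) (w v : 'rV[R]_5) : pairing (c *: w) v = c * pairing w v.
Proof. by rewrite /pairing mulr_sumr; apply: eq_bigr => i _; rewrite mxE mulrA. Qed.

(** The normal form without the condition on X(b / a), common to types 2 and
3. *)
Definition adapted_chart (O : set 'rV[R]_5) X m :=
  exists (V : set 'rV[R]_5) (phi psi : 'rV[R]_5 -> 'rV[R]_5) (a b : 'rV[R]_5 -> R),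
    [/\ V m, V `<=` O & contact_chart V phi psi] /\
    [/\ smooth_on V a, smooth_on V b & forall t, V t -> a t != 0] /\
    (forall t, V t ->
       X t = a t *: coord_field phi psi ip t + b t *: coord_field phi psi iq t).

Let five (a b c d e : R) : 'rV[R]_5 := \row_(i < 5) nth 0 [:: a; b; c; d; e] i.

(** fx, fy and fz being killed by X, only d/dp and d/dq occur in X. *)
Lemma contact_functions_chart W X (fx fy fz p q g : 'rV[R]_5 -> R) m :
  open W -> smooth_on W X -> smooth_on W fx -> smooth_on W fy -> smooth_on W fz ->
  smooth_on W p -> smooth_on W q -> smooth_on W g -> W m ->
  (forall t, W t -> g t != 0) ->
  (forall t, W t -> U t = g t *: (ext_d fz t - p t *: ext_d fx t - q t *: ext_d fy t)) ->
  (forall t, W t -> vapply X fx t = 0) -> (forall t, W t -> vapply X fy t = 0) ->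
  (forall t, W t -> vapply X fz t = 0) -> vapply X p m != 0 -> adapted_chart W X m.
Proof.
move=> oW sX sfx sfy sfz sp sq sg Wm g0 UW Xx Xy Xz a0.
pose a := vapply X p; pose b := vapply X q.
have sa : smooth_on W a := vapply_smooth oW sX sp.
have sb : smooth_on W b := vapply_smooth oW sX sq.
pose phi t := five (fx t) (fy t) (fz t) (p t) (q t).
have px : (fun t => phi t 0 ix) = fx by apply/funext => t; rewrite mxE.
have py : (fun t => phi t 0 iy) = fy by apply/funext => t; rewrite mxE.
have pz : (fun t => phi t 0 iz) = fz by apply/funext => t; rewrite mxE.
have pp : (fun t => phi t 0 ip) = p by apply/funext => t; rewrite mxE.
have pq : (fun t => phi t 0 iq) = q by apply/funext => t; rewrite mxE.
have sphi : smooth_on W phi.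
  apply/(smooth_rowP oW).
  have hx : smooth_on W (fun t => phi t 0 ix) by rewrite px; exact: sfx.
  have hy : smooth_on W (fun t => phi t 0 iy) by rewrite py; exact: sfy.
  have hz : smooth_on W (fun t => phi t 0 iz) by rewrite pz; exact: sfz.
  have hp : smooth_on W (fun t => phi t 0 ip) by rewrite pp; exact: sp.
  have hq : smooth_on W (fun t => phi t 0 iq) by rewrite pq; exact: sq.
  exact: (@ord5P (fun j => smooth_on W (fun t => phi t 0 j)) hx hy hz hp hq).
pose O' := W `&` [set t | a t != 0].
have oO' : open O' by exact: open_neq0.
have O'W : O' `<=` W by move=> t [].
have O'm : O' m by [].
have um : jac phi m \in unitmx.
  rewrite -row_free_unit; apply: row_free_ker => v vJ.
  have D j : 'D_v (fun t => phi t 0 j) m = 0.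
    by rewrite (derive_jac v j oW sphi Wm) vJ mxE.
  have Dx := D ix; have Dy := D iy; have Dz := D iz; have Dp := D ip; have Dq := D iq.
  rewrite px in Dx; rewrite py in Dy; rewrite pz in Dz; rewrite pp in Dp; rewrite pq in Dq.
  exact: (contact_functions_free oW sfx sfy sfz sp sq sg Wm (g0 m Wm) UW Dx Dy Dz Dp Dq).
have [V [psi [[oV Vm VO] [oI spsi K _]]]] := inverse_function oO' (smooth_sub O'W sphi) O'm um.
have VW : V `<=` W by move=> t /VO /O'W.
have sphiV := smooth_sub VW sphi.
have ch : contact_chart V phi psi.
  apply: (Build_contact_chart oV oI sphiV spsi K) => t Vt.
  have Wt := VW t Vt; apply/seteqP.
  have E : U t = g t *: contact_form phi t.
    rewrite (UW t Wt) /contact_form px py pz.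
    by rewrite -[p t]/((fun t => p t) t) -pp -[q t]/((fun t => q t) t) -pq.
  split=> v /=; rewrite /contact /= E pairingZ; first by move=> ->; rewrite mulr0.
  by move=> /eqP; rewrite mulf_eq0 (negbTE (g0 t Wt)) /= => /eqP.
exists V, phi, psi, a, b; split; first by [].
split; first by split; [exact: (smooth_sub VW sa)|exact: (smooth_sub VW sb)|move=> t /VO []].
move=> t Vt; have Wt := VW t Vt.
rewrite !(coord_field_jac ch)//.
have J1 := jac_inverse oV sphiV oI spsi K Vt; have J2 := mulmx1C J1.
rewrite -[LHS]mulmx1 -J2 mulmxA; set J := jac psi (phi t).
have -> : X t *m jac phi t = a t *: 'e_ip + b t *: 'e_iq.
  have D j : (X t *m jac phi t) 0 j = vapply X (fun t => phi t 0 j) t.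
    by rewrite /vapply (derive_jac (X t) j oV sphiV Vt).
  apply: row5P; rewrite D row_comb2 !mxE.
  - by rewrite px Xx//= !mulr0 addr0.
  - by rewrite py Xy//= !mulr0 addr0.
  - by rewrite pz Xz//= !mulr0 addr0.
  - by rewrite pp /= mulr1 mulr0 addr0.
  - by rewrite pq /= mulr1 mulr0 add0r.
by rewrite mulmxDl -!scalemxAl -!rowE.
Qed.

Let normalize (u v w : 'rV[R]_5) (x y z : R) : z != 0 ->
  z *: u + x *: v + y *: w = z *: (u - - (x * z^-1) *: v - - (y * z^-1) *: w).
Proof. by move=> z0; apply/rowP => j; rewrite !mxE; field. Qed.

(** X m <> 0 cannot be killed by five independent differentials, so X(p) or
X(q) is non-zero at m; the roles of fx and fy are exchanged in the second
case. *)
Lemma first_integrals_chart O X (fx fy fz Ax Ay Az : 'rV[R]_5 -> R) m :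
  open O -> smooth_on O X -> smooth_on O fx -> smooth_on O fy -> smooth_on O fz ->
  smooth_on O Ax -> smooth_on O Ay -> smooth_on O Az -> O m -> X m != 0 -> Az m != 0 ->
  (forall t, O t -> U t = Az t *: ext_d fz t + Ax t *: ext_d fx t + Ay t *: ext_d fy t) ->
  (forall t, O t -> vapply X fx t = 0) -> (forall t, O t -> vapply X fy t = 0) ->
  (forall t, O t -> vapply X fz t = 0) -> adapted_chart O X m.
Proof.
move=> oO sX0 sfx0 sfy0 sfz0 sAx0 sAy0 sAz0 Om X0 Az0 UO Xx0 Xy0 Xz0.
pose W := O `&` [set t | Az t != 0].
have oW : open W by exact: open_neq0.
have WO : W `<=` O by move=> t [].
have Wm : W m by [].
have g0 t : W t -> Az t != 0 by case.
have sX := smooth_sub WO sX0; have sfx := smooth_sub WO sfx0.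
have sfy := smooth_sub WO sfy0; have sfz := smooth_sub WO sfz0.
have sAx := smooth_sub WO sAx0; have sAy := smooth_sub WO sAy0.
have sg := smooth_sub WO sAz0; have sgV := smoothV oW g0 sg.
pose p t := - (Ax t * (Az t)^-1); pose q t := - (Ay t * (Az t)^-1).
have sp : smooth_on W p := smoothN oW (smoothM oW sAx sgV).
have sq : smooth_on W q := smoothN oW (smoothM oW sAy sgV).
have Xx t : W t -> vapply X fx t = 0 by move=> /WO; exact: Xx0.
have Xy t : W t -> vapply X fy t = 0 by move=> /WO; exact: Xy0.
have Xz t : W t -> vapply X fz t = 0 by move=> /WO; exact: Xz0.
have UW t : W t -> U t = Az t *: (ext_d fz t - p t *: ext_d fx t - q t *: ext_d fy t).
  by move=> Wt; rewrite (UO t (WO t Wt)) /p /q (normalize _ _ _ _ _ (g0 t Wt)).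
have UW' t : W t -> U t = Az t *: (ext_d fz t - q t *: ext_d fy t - p t *: ext_d fx t).
  by move=> Wt; rewrite (UW t Wt) addrAC.
suff [V [phi [psi [a [b [[Vm VW ch] H]]]]]] : adapted_chart W X m.
  by exists V, phi, psi, a, b; split=> //; split=> // t /VW /WO.
have [a0|a0] := eqVneq (vapply X p m) 0; last first.
  exact: (contact_functions_chart oW sX sfx sfy sfz sp sq sg Wm g0 UW Xx Xy Xz a0).
apply: (contact_functions_chart oW sX sfy sfx sfz sq sp sg Wm g0 UW' Xy Xx Xz).
apply: contra X0 => /eqP b0; apply/eqP.
exact: (contact_functions_free oW sfx sfy sfz sp sq sg Wm (g0 m Wm) UW
  (Xx m Wm) (Xy m Wm) (Xz m Wm) a0 b0).
Qed.

End ContactGeometry.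

(** * Linear systems of differential equations on a box *)

Section Box.
Context {R : realType} {n : nat}.
Implicit Types (f g : 'rV[R]_n.+1 -> R) (t : 'rV[R]_n.+1) (O : set 'rV[R]_n.+1).

Lemma smooth_bsmooth O : open O -> O 0 ->
  exists delta, [/\ 0 < delta, forall t, ball (0 : 'rV[R]_n.+1) delta t -> O t &
    forall f, smooth_on O f -> bsmooth delta f].
Proof.
move=> oO O0; have [rho rho0 [rhoO bd]] := smooth_local_bounds oO O0.
exists rho; split=> [//|//|f sf]; apply/bsmoothP; split; last exact: bd.
exact: smooth_sub rhoO sf.
Qed.

(** The hyperplane contains the segment on which the derivative is taken. *)
Lemma partial_hyperplane (delta : R) (a l : 'I_n.+1) f g t :
  (forall t, ball (0 : 'rV[R]_n.+1) delta t -> t 0 a = 0 -> f t = g t) ->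
  derivable g t 'e_l -> l != a -> ball (0 : 'rV[R]_n.+1) delta t -> t 0 a = 0 ->
  partial l f t = partial l g t.
Proof.
move=> fg dg la Bt ta.
suff [_ E] : is_derive t 'e_l f (partial l g t) by exact: E.
have [r r0 Hr] := near_ball (open_near (ball_open (0 : 'rV[R]_n.+1) delta) Bt).
apply: is_derive_eps => e e0; have [d d0 Hd] := derive_eps dg e0.
exists (Num.min d r) => [|h]; first by rewrite lt_min d0.
rewrite lt_min => /andP[/Hd {}Hd hr].
rewrite (fg t Bt ta) fg //; last by rewrite !mxE ta eq_sym (negbTE la) andbF mulr0 addr0.
apply: Hr; apply/ball_row; split=> // i; rewrite !mxE opprD addrA subrr sub0r normrN.
by case: (i == l) => /=; rewrite ?mulr1// mulr0 normr0.
Qed.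

(** Uniqueness of solutions. On a ball so small that the system contracts by
1/2, a bound on h can be halved indefinitely. *)
Lemma linear_system_zero (a : 'I_n.+1) (J : finType) O
    (h : J -> 'rV[R]_n.+1 -> R) (c : J -> J -> 'rV[R]_n.+1 -> R) :
  open O -> O 0 -> (forall i, smooth_on O (h i)) -> (forall i l, smooth_on O (c i l)) ->
  (forall i t, O t -> partial a (h i) t = \sum_l c i l t * h l t) ->
  (forall i t, O t -> t 0 a = 0 -> h i t = 0) ->
  exists2 rho, 0 < rho & (forall t, ball (0 : 'rV[R]_n.+1) rho t -> O t) /\
    forall i t, ball (0 : 'rV[R]_n.+1) rho t -> h i t = 0.
Proof.
move=> oO O0 sh sc dh h0.
have [rho rho0 [rhoO bd]] := smooth_local_bounds oO O0.
have bound (I : finType) (F : I -> 'rV[R]_n.+1 -> R) : (forall i, smooth_on O (F i)) ->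
    exists2 C, 0 <= C & forall i t, ball (0 : 'rV[R]_n.+1) rho t -> `|F i t| <= C.
  move=> sF; apply: (@uniform_constant _ _ (fun i C => forall t, ball (0 : 'rV[R]_n.+1) rho t -> `|F i t| <= C)).
    by move=> i C D CD H t /H /le_trans; apply.
  move=> i; have [C HC] := bd _ (sF i) [::]; exists `|C| => // t Bt.
  by rewrite (le_trans (HC t Bt))// ler_norm.
have [M M0 HM] := bound _ _ sh.
have [C C0 HC] := bound _ (fun il : J * J => c il.1 il.2) (fun il => sc il.1 il.2).
pose K := #|J|%:R * C + 1.
have K0 : 0 < K by rewrite ltr_wpDl// mulr_ge0.
pose eps := Num.min rho (2 * K)^-1.
have eps0 : 0 < eps by rewrite lt_min rho0 invr_gt0 mulr_gt0.
have sub t : ball (0 : 'rV[R]_n.+1) eps t -> ball (0 : 'rV[R]_n.+1) rho t.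
  by move=> Bt; apply: le_ball Bt; rewrite ge_min lexx.
exists eps => //; split=> [t /sub /rhoO //|i t Bt].
have halving k i' s : ball (0 : 'rV[R]_n.+1) eps s -> `|h i' s| <= geometric M (2^-1) k.
  elim: k i' s => [|k IH] i' s Bs; first by rewrite /= expr0 mulr1; exact: HM (sub _ Bs).
  have [_ sa] := (ball0_row _ _).1 Bs.
  apply: (@le_trans _ _ (`|s 0 a| * (K * geometric M (2^-1) k))); last first.
    have g0 : 0 <= geometric M (2^-1) k by rewrite /= mulr_ge0// exprn_ge0.
    apply: (@le_trans _ _ ((2 * K)^-1 * (K * geometric M (2^-1) k))).
      rewrite ler_wpM2r ?mulr_ge0 ?(ltW K0)//.
      by rewrite (le_trans (ltW (sa a)))// ge_min lexx orbT.
    rewrite /= exprS; move: (2^-1 ^+ k) => z; have Kn0 : K != 0 by rewrite gt_eqF.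
    by rewrite (_ : (2 * K)^-1 * (K * (M * z)) = M * (2^-1 * z))//; field.
  apply: bound_from_base => [r r01|].
    have Br : ball (0 : 'rV[R]_n.+1) eps (move_to a s (r * s 0 a)).
      apply: ball_move_to => //; apply: le_lt_trans (sa a).
      by move/andP: r01 => [r0 r1]; rewrite normrM ger0_norm// ler_piMl.
    have Or := rhoO _ (sub _ Br); split; first exact: smooth_derivable (sh i') Or.
    rewrite (dh i' _ Or) (le_trans (ler_norm_sum _ _ _))//.
    apply: (@le_trans _ _ (\sum_(l : J) C * geometric M (2^-1) k)).
      by apply: ler_sum => l _; rewrite normrM ler_pM// ?IH//; exact: (HC (i', l) _ (sub _ Br)).
    rewrite sumr_const -[leLHS]mulr_natl mulrA ler_wpM2r//; last by rewrite lerDl.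
    by rewrite /= mulr_ge0// exprn_ge0.
  apply: h0; last by rewrite move_toE eqxx.
  by apply/rhoO/sub/ball_move_to => //; rewrite normr0.
have half1 : `|2^-1 : R| < 1 by rewrite ger0_norm// invf_lt1// ltr1n.
apply/eqP; rewrite -normr_le0.
apply: (ler_cvg_to (cvg_cst _) (cvg_geometric M half1)).
by apply: nearW => k; exact: halving.
Qed.

End Box.

(** * First integrals of a field of type 2 or 3 *)

Section Characteristics.
Context {R : realType}.
Implicit Types (X : vfield (R := R)) (w : oneform (R := R)) (f g : 'rV[R]_5 -> R).
Implicit Types (V W O : set 'rV[R]_5) (t m : 'rV[R]_5).

Lemma iter_lie_smooth O X i : open O -> smooth_on O X ->
  smooth_on O (iter i (lie_form X) U).
Proof.
move=> oO sX; elim: i => [|i IH]; first exact: (U_smooth oO).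
exact: (lie_form_smooth oO sX IH).
Qed.

(** The value of L_X w on X is the derivative X(w(X)), as [X, X] = 0. *)
Lemma lie_form_self O X w : open O -> smooth_on O X -> smooth_on O w ->
  (forall t, O t -> pairing (w t) (X t) = 0) ->
  forall t, O t -> pairing (lie_form X w t) (X t) = 0.
Proof.
move=> oO sX sw wX t Ot.
have sX' := (smooth_rowP oO X).1 sX; have sw' := (smooth_rowP oO w).1 sw.
have d0 k : \sum_i (w t 0 i * partial k (fun t => X t 0 i) t + X t 0 i * partial k (fun t => w t 0 i) t) = 0.
  have E := partial_sum (index_enum 'I_5) xpredT k (fun i => smoothM oO (sw' i) (sX' i)) Ot.
  rewrite (partial_ext (g := fun=> 0) k oO wX Ot) partial_cst in E.
  apply: (etrans _ (esym E)).
  by apply: eq_bigr => i _; rewrite (partialM k (sw' i) (sX' i) Ot).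
transitivity (\sum_k X t 0 k * 0); last by rewrite big1// => k _; rewrite mulr0.
under [RHS]eq_bigr => k _ do rewrite -(d0 k) mulr_sumr.
under [RHS]eq_bigr => k _ do under eq_bigr => i _ do rewrite mulrDr.
under [RHS]eq_bigr => k _ do rewrite big_split /=.
rewrite /pairing; under [LHS]eq_bigr => j _ do
  rewrite (lie_formE j oO sX sw Ot) (vapplyE X oO (sw' j) Ot) mulrDl !mulr_suml.
rewrite !big_split /= addrC; congr (_ + _).
  by apply: eq_bigr => j _; apply: eq_bigr => i _; rewrite mulrC.
rewrite exchange_big; apply: eq_bigr => k _; apply: eq_bigr => j _ /=.
by rewrite [X t 0 j * _]mulrC mulrA.
Qed.

(** The field d/dt_a commutes with d/dt_l, and u maps it to X. The derivative
in the direction a of the component of a pulled back form on d/dt_l is thus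
the same component for its Lie derivative. *)
Lemma pullback_lie {n} O X w (B : set 'rV[R]_n.+1) (u : 'rV[R]_n.+1 -> 'rV[R]_5) (a l : 'I_n.+1) :
  open O -> smooth_on O X -> smooth_on O w ->
  open B -> (forall j, smooth_on B (fun s => u s 0 j)) -> (forall s, B s -> O (u s)) ->
  (forall s j, B s -> partial a (fun s => u s 0 j) s = X (u s) 0 j) ->
  forall s, B s ->
  partial a (fun s => \sum_j w (u s) 0 j * partial l (fun s => u s 0 j) s) s =
  \sum_j lie_form X w (u s) 0 j * partial l (fun s => u s 0 j) s.
Proof.
move=> oO sX sw oB su uO du s Bs; have Ou := uO s Bs.
have sX' := (smooth_rowP oO X).1 sX; have sw' := (smooth_rowP oO w).1 sw.
have swu j : smooth_on B (fun s => w (u s) 0 j) := smooth_comp oB oO (sw' j) uO su.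
have spu j : smooth_on B (partial l (fun s => u s 0 j)) := smooth_partial l (su j).
have chain F i : smooth_on O F ->
    partial i (fun s => F (u s)) s = \sum_k partial i (fun s => u s 0 k) s * partial k F (u s).
  move=> sF; have dF := smooth_differentiable oO sF Ou.
  by have [_ E] := is_derive_comp dF (fun k => smooth_is_derive i (su k) Bs).
rewrite (partial_sum _ _ _ (fun j => smoothM oB (swu j) (spu j)) Bs).
under eq_bigr => j _.
  rewrite (partialM a (swu j) (spu j) Bs) (partialC a l oB (su j) Bs).
  rewrite (partial_ext l oB (fun s Bs => du s j Bs) Bs).
  rewrite (chain _ a (sw' j)) (chain _ l (sX' j)).
  over.
under [RHS]eq_bigr => j _ do rewrite (lie_formE j oO sX sw Ou) (vapplyE X oO (sw' j) Ou) mulrDl.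
rewrite !big_split /= addrC; congr (_ + _).
  apply: eq_bigr => j _; rewrite mulrC; congr (_ * _).
  by apply: eq_bigr => k _; rewrite (du s k Bs).
under eq_bigr => j _ do rewrite mulr_sumr.
under [RHS]eq_bigr => j _ do rewrite mulr_suml.
rewrite exchange_big; apply: eq_bigr => k _; apply: eq_bigr => j _ /=.
by rewrite mulrA mulrAC.
Qed.

Lemma iter_lie_self O X i : open O -> smooth_on O X -> (forall t, O t -> contact t (X t)) ->
  forall t, O t -> pairing (iter i (lie_form X) U t) (X t) = 0.
Proof.
move=> oO sX cX; elim: i => [|i IH]; first exact: cX.
exact: (lie_form_self oO sX (iter_lie_smooth i oO sX) IH).
Qed.

(** Constant forms complete the k given ones to a basis at m, hence near m.
The dual frame is given by the inverse matrix. *)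
Lemma adapted_frame k (f : nat -> oneform (R := R)) O m : open O -> (forall i, smooth_on O (f i)) ->
  O m -> (k <= 5)%N -> rank_upto (fun i => f i m) k = k ->
  exists (W : set 'rV[R]_5) (M v : 'I_5 -> 'rV[R]_5 -> 'rV[R]_5),
  [/\ open W, W m & W `<=` O] /\
  [/\ forall i : 'I_5, (i < k)%N -> M i = f i,
      forall j, smooth_on W (v j),
      forall i j t, W t -> pairing (M i t) (v j t) = (i == j)%:R &
      forall t (y : 'rV[R]_5), W t -> (forall i, pairing (M i t) y = 0) -> y = 0].
Proof.
move=> oO sf Om k5 rk; have [g gE rg] := basis_extension k5 rk.
pose M (i : 'I_5) : 'rV[R]_5 -> 'rV[R]_5 := if (i < k)%N then f i else fun=> g i.
pose A t : 'M[R]_5 := \matrix_i M i t.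
have sM i : smooth_on O (M i).
  rewrite /M; case: ifP => _; first exact: sf.
  by apply/(smooth_rowP oO) => j; exact: (smooth_cst oO (g i 0 j)).
have sA i j : smooth_on O (fun t => A t i j).
  apply: (smooth_ext oO (f := fun t => M i t 0 j)) => [t _|]; first by rewrite mxE.
  exact: ((smooth_rowP oO _).1 (sM i) j).
have oW := open_neq0 oO (smooth_det oO sA).
set W := _ `&` _ in oW.
have WO : W `<=` O by move=> t [].
have uA t : W t -> A t \in unitmx by case=> _ /=; rewrite unitmxE unitfE.
have Am : A m \in unitmx.
  rewrite -row_free_unit /row_free -[X in _ == X]rg; apply/eqP; congr (\rank _).
  apply/row_matrixP => i; rewrite !rowK /M; case: ifP => // /gE ->.
  by [].
pose v j t := row j (invmx (A t))^T.
exists W, M, v; split.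
  by split=> //; split=> //=; move: Am; rewrite unitmxE unitfE.
have sinv i j : smooth_on W (fun t => invmx (A t) i j).
  apply: (smooth_invmx oW uA) => i' j'; exact: (smooth_sub WO (sA i' j')).
split.
- by move=> i ik; rewrite /M ik.
- move=> j; apply/(smooth_rowP oW) => l.
  apply: (smooth_ext oW (f := fun t => invmx (A t) l j)) => [t _|]; first by rewrite !mxE.
  exact: sinv.
- move=> i j t Wt; have := congr1 (fun B : 'M[R]_5 => B i j) (mulmxV (uA t Wt)).
  by rewrite !mxE => <-; apply: eq_bigr => l _; rewrite !mxE.
- move=> t w Wt H; have : A t *m w^T = 0.
    apply/matrixP => i j; rewrite ord1 [RHS]mxE -[RHS](H i) mxE.
    by apply: eq_bigr => l _; rewrite !mxE.
  by move/(congr1 (mulmx (invmx (A t)))); rewrite mulKmx ?uA// mulmx0 => /eqP; rewrite trmx_eq0 => /eqP.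
Qed.

Lemma pairingZr (c : R) (w v : 'rV[R]_5) : pairing w (c *: v) = c * pairing w v.
Proof. by rewrite /pairing mulr_sumr; apply: eq_bigr => i _; rewrite mxE mulrCA. Qed.

Lemma pairing_suml (J : finType) (Q : pred J) (F : J -> 'rV[R]_5) v :
  pairing (\sum_(i | Q i) F i) v = \sum_(i | Q i) pairing (F i) v.
Proof.
rewrite /pairing exchange_big; apply: eq_bigr => i _.
by rewrite summxE mulr_suml.
Qed.

Lemma pairing_sumr (J : finType) (Q : pred J) (F : J -> 'rV[R]_5) (w : 'rV[R]_5) :
  pairing w (\sum_(i | Q i) F i) = \sum_(i | Q i) pairing w (F i).
Proof.
rewrite /pairing exchange_big; apply: eq_bigr => i _.
by rewrite summxE mulr_sumr.
Qed.

(** The coefficients of a combination of the first k forms are its values on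
the dual vectors. *)
Lemma next_form k (f : nat -> oneform (R := R)) (v : nat -> 'rV[R]_5) t :
  rank_upto (fun i => f i t) k = k -> rank_upto (fun i => f i t) k.+1 = k ->
  (forall i j, (i < k)%N -> (j < k)%N -> pairing (f i t) (v j) = (i == j)%:R) ->
  f k t = \sum_(i < k) pairing (f k t) (v i) *: f i t.
Proof.
move=> rk rk1 dual; have /submxP[D E] := rank_upto_sub rk rk1.
rewrite mulmx_sum_row in E.
have Di i : D 0 i = pairing (f k t) (v i).
  rewrite E pairing_suml (bigD1 i)//= big1 ?addr0; last first.
    by move=> l li; rewrite rowK pairingZ dual// (inj_eq val_inj) (negbTE li) mulr0.
  by rewrite rowK pairingZ dual// eqxx mulr1.
by rewrite [LHS]E; apply: eq_bigr => i _; rewrite rowK Di.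
Qed.

(** The first k forms annihilate X, and X maps them to combinations of
themselves. The field v j1 of the dual frame is annihilated by them; w0 is
moved along v j1, then along X. On the hypersurface t_j0 = 0 the forms vanish
on d/dt_j1. Along X, their values on d/dt_j1 satisfy a linear system, so they
vanish everywhere. *)
Lemma characteristic_box O X k m : open O -> smooth_on O X ->
  (forall t, O t -> contact t (X t)) -> O m -> X m != 0 -> (0 < k <= 3)%N ->
  (forall t, O t -> lie_rank X k t = k) -> (forall t, O t -> lie_rank X k.+1 t = k) ->
  exists (j0 j1 : 'I_5) (rho : R) (u : 'rV[R]_5 -> 'rV[R]_5),
  let B := ball (0 : 'rV[R]_5) rho in
  [/\ j1 != j0, 0 < rho, smooth_on B u & forall s, B s -> O (u s)] /\
  [/\ u 0 = m, jac u 0 \in unitmx,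
      forall s, B s -> row j0 (jac u s) = X (u s) &
      forall s, B s -> pairing (U (u s)) (row j1 (jac u s)) = 0].
Proof.
move=> oO sX cX Om X0 /andP[k0 k3] rk rk1.
pose f i := iter i (lie_form X) U.
have sf i : smooth_on O (f i) := iter_lie_smooth i oO sX.
have fX i t : O t -> pairing (f i t) (X t) = 0 := @iter_lie_self O X i oO sX cX t.
have k5 : (k <= 5)%N by rewrite (leq_trans k3).
have [W [M [v [[oW Wm WO] [Mf sv dual free]]]]] := adapted_frame oO sf Om k5 (rk m Om).
have [j0 Xj0] : exists j0, pairing (M j0 m) (X m) != 0.
  apply/existsP; apply: contraNT X0; rewrite negb_exists => /forallP H.
  by apply/eqP/(free m _ Wm) => i; apply/eqP; rewrite -[_ == _]negbK.
have kj0 : (k <= j0)%N.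
  by rewrite leqNgt; apply: contra Xj0 => jk; rewrite (Mf j0 jk) fX.
(* As k <= 3, the indices of p and q both belong to completing forms; j1 is
one of the two that differs from j0. *)
pose j1 := if j0 == iq then ip else iq.
have j10 : j1 != j0 by rewrite /j1; case: (eqVneq j0 iq) => [->//|]; rewrite eq_sym.
have kj1 : (k <= j1)%N by rewrite (leq_trans k3)// /j1; case: ifP.
have sW := smooth_sub WO sX.
pose Q l := (l != j0) && (l != j1).
(* An affine map with derivative v l m in each direction other than j0 and j1.
*)
pose w0 (s : 'rV[R]_5) : 'rV[R]_5 := m + \sum_(l | Q l) s 0 l *: v l m.
have w0E j : (fun s => w0 s 0 j) = fun s => m 0 j + \sum_(l | Q l) s 0 l * v l m 0 j.
  by apply/funext => s; rewrite mxE summxE; congr (_ + _); apply: eq_bigr => l _; rewrite mxE.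
have oT : open [set: 'rV[R]_5] by exact: openT.
have slin l j := smoothM oT (smooth_coord oT l) (smooth_cst oT (v l m 0 j)).
have sw0 j : smooth_on [set: 'rV[R]_5] (fun s => w0 s 0 j).
  rewrite w0E; apply: (smoothD oT (smooth_cst oT _)); apply: (smooth_sum oT) => l; exact: slin.
have [d0 [d00 _ bs]] := smooth_bsmooth oT (I : [set: 'rV[R]_5] 0).
have w00 : w0 0 = m.
  by rewrite /w0 big1 ?addr0// => l _; rewrite mxE scale0r.
have Ww0 : W (w0 0) by rewrite w00.
have [d1 [u1 [/andP[d10 d1d0] su1 Wu1 du1 u1w]]] :=
  flow_exists j1 oW (sv j1) d00 (fun j => bs _ (sw0 j)) Ww0.
have B10 : ball (0 : 'rV[R]_5) d1 0 by exact: ballxx.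
have [d [u [/andP[dd dd1] bu Wu du uu1]]] := flow_exists j0 oW sW d10 su1 (Wu1 0 B10).
pose B := ball (0 : 'rV[R]_5) d.
have oB : open B by exact: ball_open.
have B0 : B 0 by exact: ballxx.
have BB1 s : B s -> ball (0 : 'rV[R]_5) d1 s by apply: le_ball.
have su j : smooth_on B (fun s => u s 0 j) by have /bsmoothP[] := bu j.
have su1' j : smooth_on (ball 0 d1) (fun s => u1 s 0 j) by have /bsmoothP[] := su1 j.
have um : u 0 = m by rewrite uu1 ?mxE// u1w ?mxE.
(* The value of the form f i on d/dt_j1. *)
pose h i s := \sum_j f i (u s) 0 j * partial j1 (fun s => u s 0 j) s.
have sfu i j : smooth_on B (fun s => f i (u s) 0 j).
  exact: (smooth_comp oB oO ((smooth_rowP oO _).1 (sf i) j) (fun s Bs => WO _ (Wu s Bs)) su).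
have sh i : smooth_on B (h i).
  apply: (smooth_sum oB) => j; exact: (smoothM oB (sfu i j) (smooth_partial j1 (su j))).
have dh i s : B s -> partial j0 (h i) s = h i.+1 s.
  exact: (pullback_lie j1 oO sX (sf i) oB su (fun s Bs => WO _ (Wu s Bs)) (fun s j Bs => du s j Bs)).
pose vn i := v (inord i).
pose cf (i : nat) s := pairing (f k (u s)) (vn i (u s)).
have hk s : B s -> h k s = \sum_(i < k) cf i s * h i s.
  move=> Bs; have Ws := Wu s Bs.
  have E : f k (u s) = \sum_(i < k) cf i s *: f i (u s).
    apply: (next_form (f := f) (v := fun i => vn i (u s)) (rk _ (WO _ Ws)) (rk1 _ (WO _ Ws))).
    move=> i j ik jk; have i5 := leq_trans ik k5; have j5 := leq_trans jk k5.
    rewrite -{1}(inordK i5) -(Mf (inord i)) ?inordK// dual//.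
    by rewrite -(inj_eq val_inj) /= !inordK.
  rewrite {1}/h E.
  under eq_bigr => j _ do rewrite summxE mulr_suml.
  rewrite exchange_big; apply: eq_bigr => i _ /=; rewrite mulr_sumr.
  by apply: eq_bigr => j _; rewrite mxE mulrA.
(* The companion matrix of the system: the derivative of h i is h i.+1, and
the last one is a combination of all. *)
pose c (i l : 'I_k) s := if (i.+1 < k)%N then (l == i.+1 :> nat)%:R else cf l s.
have sc i l : smooth_on B (c i l).
  rewrite /c; case: (i.+1 < k)%N; first exact: (smooth_cst oB _).
  apply: (smooth_sum oB) => j; apply: (smoothM oB (sfu k j)).
  exact: (smooth_comp oB oW ((smooth_rowP oW _).1 (sv (inord l)) j) Wu su).
have dhc (i : 'I_k) s : B s -> partial j0 (h i) s = \sum_l c i l s * h l s.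
  move=> Bs; rewrite dh// /c; case: (ltnP i.+1 k) => ik.
    rewrite (bigD1 (Ordinal ik))//= eqxx mul1r big1 ?addr0// => l.
    by rewrite -(inj_eq val_inj) /= => /negbTE ->; rewrite mul0r.
  have -> : i.+1 = k by apply/eqP; rewrite eqn_leq ltn_ord ik.
  exact: hk.
have pj1 s j : B s -> s 0 j0 = 0 -> partial j1 (fun s => u s 0 j) s = v j1 (u s) 0 j.
  move=> Bs s0; rewrite (uu1 s Bs s0) -(du1 s j (BB1 s Bs)).
  apply: (@partial_hyperplane _ _ d j0 j1 _ _ s _ _ j10 Bs s0).
    by move=> t Bt t0; rewrite (uu1 t Bt t0).
  exact: (smooth_derivable (su1' j) (BB1 s Bs)).
have h0 (i : 'I_k) s : B s -> s 0 j0 = 0 -> h i s = 0.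
  move=> Bs s0; have i5 := leq_trans (ltn_ord i) k5.
  transitivity (pairing (M (inord i) (u s)) (v j1 (u s))).
    rewrite Mf ?inordK//; apply: eq_bigr => j _; congr (_ * _); exact: pj1.
  rewrite (dual _ _ _ (Wu s Bs)) -(inj_eq val_inj) /= inordK// (ltn_eqF _)//.
  exact: leq_trans (ltn_ord i) kj1.
have [rho rho0 [rhoB hz]] := linear_system_zero oB B0 (fun i : 'I_k => sh i) sc dhc h0.
exists j0, j1, rho, u; split.
  split=> //; last by move=> s /rhoB /Wu /WO.
  by apply/(smooth_rowP (ball_open _ _)) => j; exact: (smooth_sub rhoB (su j)).
split=> //.
- rewrite -row_free_unit; apply: row_free_ker => y yJ.
  have pl l j : l != j0 -> partial l (fun s => u s 0 j) 0 = v l m 0 j.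
    move=> lj0; have [->|lj1] := eqVneq l j1.
      by rewrite pj1 ?mxE// um.
    have -> : partial l (fun s => u s 0 j) 0 = partial l (fun s => u1 s 0 j) 0.
      apply: (@partial_hyperplane _ _ d j0 l _ _ 0 _ _ lj0 B0); last by rewrite mxE.
        by move=> t Bt t0; rewrite (uu1 t Bt t0).
      exact: (smooth_derivable (su1' j) B10).
    have -> : partial l (fun s => u1 s 0 j) 0 = partial l (fun s => w0 s 0 j) 0.
      apply: (@partial_hyperplane _ _ d1 j1 l _ _ 0 _ _ lj1 B10); last by rewrite mxE.
        by move=> t Bt t0; rewrite (u1w t Bt t0).
      exact: (smooth_derivable (sw0 j) I).
    rewrite w0E (partialD l (smooth_cst oT _) (smooth_sum oT _ _ (fun l => slin l j)) I) partial_cst add0r.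
    rewrite (partial_sum _ _ l (fun l => slin l j) I) (bigD1 l) /=; last by rewrite /Q lj0.
    rewrite big1 ?addr0 => [|i /andP[_ il]].
      by rewrite (partialM l (smooth_coord oT l) (smooth_cst oT _) I) partial_cst partial_coord eqxx mulr0 add0r mulr1.
    by rewrite (partialM l (smooth_coord oT i) (smooth_cst oT _) I) partial_cst partial_coord eq_sym (negbTE il) !mulr0 addr0.
  have yE : y 0 j0 *: X m + \sum_(l | l != j0) y 0 l *: v l m = 0.
    rewrite -[RHS]yJ mulmx_sum_row [RHS](bigD1 j0)//=; congr (_ + _).
      by congr (_ *: _); apply/rowP => j; rewrite !mxE du// um.
    by apply: eq_bigr => l lj0; congr (_ *: _); apply/rowP => j; rewrite !mxE pl.
  have pE i : y 0 j0 * pairing (M i m) (X m) + (if i == j0 then 0 else y 0 i) = 0.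
    have := congr1 (pairing (M i m)) yE.
    have p0 : pairing (M i m) 0 = 0 by rewrite /pairing big1// => j _; rewrite mxE mulr0.
    have pD a b : pairing (M i m) (a + b) = pairing (M i m) a + pairing (M i m) b.
      by rewrite /pairing -big_split; apply: eq_bigr => j _; rewrite mxE mulrDr.
    rewrite p0 pD pairingZr pairing_sumr => E0; rewrite -[RHS]E0; congr (_ + _).
    have E l : pairing (M i m) (y 0 l *: v l m) = y 0 l * (i == l)%:R.
      by rewrite pairingZr dual.
    under eq_bigr => l _ do rewrite E.
    case: eqVneq => [->|ij]; first by rewrite big1// => l /negbTE lj; rewrite eq_sym lj mulr0.
    rewrite (bigD1 i)//= eqxx mulr1 big1 ?addr0// => l /andP[_ /negbTE li].
    by rewrite eq_sym li mulr0.
  have y0 : y 0 j0 = 0.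
    have := pE j0; rewrite eqxx addr0 => /eqP; rewrite mulf_eq0 (negbTE Xj0) orbF.
    by move/eqP.
  apply/rowP => i; rewrite mxE; have := pE i; rewrite y0 mul0r add0r.
  by case: eqVneq => [->|].
- by move=> s /rhoB Bs; apply/rowP => j; rewrite !mxE du.
- move=> s Bs; rewrite -[RHS](hz (Ordinal k0) s Bs).
  by apply: eq_bigr => j _; rewrite !mxE.
Qed.

Lemma complement_pair (j0 j1 l0 : 'I_5) : j1 != j0 -> l0 != j0 -> l0 != j1 ->
  exists lx ly : 'I_5, [/\ lx != j0, ly != j0 &
    forall (V : zmodType) (G : 'I_5 -> V),
      \sum_l G l = G j0 + (G j1 + (G l0 + G lx + G ly))].
Proof.
move=> j10 l00 l01; pose A := (j0 |: (j1 |: [set l0]))%SET.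
have cA : #|A| = 3%N.
  rewrite /A !cardsU1 cards1 !inE negb_or (eq_sym j0 j1) j10.
  by rewrite (eq_sym j0) l00 (eq_sym j1) l01.
have /eqP/cards2P[lx [ly [lxy AE]]] : #|(~: A)%SET| = 2%N.
  by apply: (@addnI #|A|); rewrite cardsC cA card_ord.
have inA l : (l \notin A) = (l == lx) || (l == ly) by rewrite -finset.in_setC AE !inE.
have nA l : l \notin A = (l != j0) && (l != j1) && (l != l0).
  by rewrite !inE !negb_or andbA.
have := inA lx; rewrite eqxx nA => /andP[/andP[lx0 lx1] lxl].
have := inA ly; rewrite eqxx orbT nA => /andP[/andP[ly0 ly1] lyl].
exists lx, ly; split=> // V G.
rewrite (bigD1 j0)//= (bigD1 j1)//= (bigD1 l0) /=; last by rewrite l00 l01.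
rewrite (bigD1 lx) /=; last by rewrite lx0 lx1 lxl.
rewrite (bigD1 ly) /=; last by rewrite ly0 ly1 lyl eq_sym.
rewrite big1 ?addr0 ?addrA// => l /andP[/andP[lA lnx] lny].
by have := inA l; rewrite nA lA (negbTE lnx) (negbTE lny).
Qed.

(** In the coordinates y inverse to the box, U = sum_l A_l dy_l, where A_l is
the value of U on the l-th coordinate field; so A_j0 = U(X) = 0 and A_j1 = 0.
Three terms remain, in coordinates killed by X = d/dt_j0. *)
Lemma chart_exists O X k m : open O -> smooth_on O X ->
  (forall t, O t -> contact t (X t)) -> O m -> X m != 0 -> (0 < k <= 3)%N ->
  (forall t, O t -> lie_rank X k t = k) -> (forall t, O t -> lie_rank X k.+1 t = k) ->
  adapted_chart O X m.
Proof.
move=> oO sX cX Om X0 k03 rk rk1.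
have [j0 [j1 [rho [u [[j10 rho0 su uO] [um Ju uX Uu]]]]]] :=
  characteristic_box oO sX cX Om X0 k03 rk rk1.
have oB : open (ball (0 : 'rV[R]_5) rho) by exact: ball_open.
have B0 : ball (0 : 'rV[R]_5) rho 0 by exact: ballxx.
have [V [y [[oV V0 VB] [oW sy yu _]]]] := inverse_function oB su B0 Ju.
pose W := u @` V.
have WO : W `<=` O by move=> _ [s Vs <-]; exact/uO/VB.
have Wm : W m by exists 0.
have suV := smooth_sub VB su.
have sy' := (smooth_rowP oW y).1 sy; have su' := (smooth_rowP oV u).1 suV.
have sU' := (smooth_rowP oO _).1 (U_smooth oO).
have J1 s : V s -> jac y (u s) *m jac u s = 1%:M.
  by move=> Vs; exact: (jac_inverse oV suV oW sy yu Vs).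
have J2 s : V s -> jac u s *m jac y (u s) = 1%:M by move=> /J1; exact: mulmx1C.
pose A l t := \sum_i U t 0 i * partial l (fun s => u s 0 i) (y t).
have yV t : W t -> V (y t) by move=> [s Vs <-]; rewrite yu.
have sA l : smooth_on W (A l).
  apply: (smooth_sum oW) => i; apply: (smoothM oW (smooth_sub WO (sU' i))).
  exact: (smooth_comp oW oV (smooth_partial l (su' i)) yV sy').
have AE l s : V s -> A l (u s) = pairing (U (u s)) (row l (jac u s)).
  by move=> Vs; rewrite /A yu//; apply: eq_bigr => i _; rewrite !mxE.
have Uexp t : W t -> U t = \sum_l A l t *: ext_d (fun t => y t 0 l) t.
  move=> [s Vs <-]; rewrite -[LHS]mulmx1 -[1%:M]trmx1 -(J1 s Vs) trmx_mul mulmxA.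
  rewrite mulmx_sum_row; apply: eq_bigr => l _; congr (_ *: _).
    by rewrite (AE l s Vs) mxE; apply: eq_bigr => i _; rewrite !mxE.
  by apply/rowP => i; rewrite !mxE.
have A0 t : W t -> A j0 t = 0.
  move=> [s Vs <-]; rewrite (AE _ s Vs) uX; last exact: VB.
  exact: (cX _ (uO s (VB s Vs))).
have A1 t : W t -> A j1 t = 0.
  by move=> [s Vs <-]; rewrite (AE _ s Vs) Uu//; exact: VB.
have Xy l : l != j0 -> forall t, W t -> vapply X (fun t => y t 0 l) t = 0.
  move=> lj0 _ [s Vs <-]; have Ws : W (u s) by exists s.
  rewrite /vapply (derive_jac _ _ oW sy Ws) -uX; last exact: VB.
  by rewrite -row_mul (J2 s Vs) !mxE eq_sym (negbTE lj0).
have [l0 Al0] : exists l, A l m != 0.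
  apply/existsP; apply: contraT; rewrite negb_exists => /forallP H.
  have : U m 0 iz = 1 by rewrite UE !eqxx/= !mulr0 !subr0.
  rewrite (Uexp m Wm) big1 ?mxE => [/eqP|l _]; first by rewrite eq_sym oner_eq0.
  by have /eqP -> := negbNE (H l); rewrite scale0r.
have l00 : l0 != j0 by apply: contraNneq Al0 => ->; rewrite A0.
have l01 : l0 != j1 by apply: contraNneq Al0 => ->; rewrite A1.
have [lx [ly [lx0 ly0 sumE]]] := complement_pair j10 l00 l01.
have UW t : W t -> U t = A l0 t *: ext_d (fun t => y t 0 l0) t +
    A lx t *: ext_d (fun t => y t 0 lx) t + A ly t *: ext_d (fun t => y t 0 ly) t.
  move=> Wt; rewrite [LHS](Uexp t Wt) sumE (A0 t Wt) (A1 t Wt).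
  by rewrite !scale0r !add0r.
have [V' [phi [psi [a [b [[Vm VW ch] H]]]]]] := first_integrals_chart oW (smooth_sub WO sX)
  (sy' lx) (sy' ly) (sy' l0) (sA lx) (sA ly) (sA l0) Wm X0 Al0 UW (Xy lx lx0) (Xy ly ly0) (Xy l0 l00).
by exists V', phi, psi, a, b; split=> //; split=> // t /VW /WO.
Qed.

End Characteristics.

(** * Types and normal forms *)

Theorem theorem3p17 (R : realType) (O : set 'rV[R]_5)
    (X : 'rV[R]_5 -> 'rV[R]_5)
    (O_open : open O) (X_smooth : smooth_on O X)
    (X_contact : forall m, O m -> contact m (X m))
    (X_neq0 : forall m, O m -> X m != 0) :
  (of_type 2 O X <->
     forall m, O m -> normal_form_at O X (fun c => c = 0) m) /\
  (of_type 3 O X <->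
     forall m, O m -> normal_form_at O X (fun c => c != 0) m).
Proof.
have rank2 m : O m -> lie_rank X 2 m = 2%N.
  move=> Om; exact: (lie_rank2 O_open X_smooth X_contact Om (X_neq0 m Om)).
have mono m k l : (k <= l)%N -> (lie_rank X k m <= lie_rank X l m)%N.
  exact: (rank_upto_mono (fun i => iter i (lie_form X) U m)).
have exist k m : (0 < k <= 3)%N -> O m -> (forall t, O t -> lie_rank X k t = k) ->
    (forall t, O t -> lie_rank X k.+1 t = k) -> adapted_chart O X m.
  move=> k03 Om; exact: (chart_exists O_open X_smooth X_contact Om (X_neq0 m Om) k03).
split; split.
- move=> [r [r3 rE]] m Om.
  have r2 t : O t -> lie_rank X 3 t = 2%N.
    move=> Ot; have le := mono t 3%N 4%N isT; have ge := mono t 2%N 3%N isT.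
    rewrite (rE t Ot 3%N isT) r3 in le; rewrite (rank2 t Ot) in ge.
    by apply/eqP; rewrite eqn_leq le ge.
  have [V [phi [psi [a [b [[Vm VO ch] [[sa sb a0] XE]]]]]]] := exist 2%N m isT Om rank2 r2.
  exists V, phi, psi, a, b; split; first by split.
  split; first by split.
  split; first exact: XE.
  move=> t Vt; apply/eqP; apply: contraT => c0.
  have [_ _ _ /(_ c0)[]] := chart_lie_rank ch (smooth_sub VO X_smooth) sa sb a0 XE Vt.
  by rewrite (r2 t (VO t Vt)).
- move=> nf; exists (fun j => if j is 0%N then 1%N else 2%N); split=> // m Om j j3.
  have [V [phi [psi [a [b [[Vm VO ch] [[sa sb a0] [XE Xc]]]]]]]] := nf m Om.
  case: j j3 => [|j] j3.
    by have [] := chart_lie_rank ch (smooth_sub VO X_smooth) sa sb a0 XE Vm.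
  exact: (chart_lie_rank2 ch (smooth_sub VO X_smooth) sa sb a0 XE Xc (isT : 2 <= j.+2)%N Vm).
- move=> [r [r3 rE]] m Om.
  have le3 := mono m 3%N 4%N isT; have ge2 := mono m 2%N 3%N isT.
  rewrite (rE m Om 3%N isT) (rE m Om 2%N isT) r3 in le3.
  rewrite (rank2 m Om) (rE m Om 2%N isT) in ge2.
  have r2 : r 2%N = 3%N.
    move: ge2; rewrite leq_eqVlt => /orP[/eqP r22|ge3]; last first.
      by apply/eqP; rewrite eqn_leq le3 ge3.
    (* If the rank of U, X(U), X^2(U) were 2, the chart obtained from these
    forms would have X(b / a) = 0, and X^3(U) could not raise the rank. *)
    have R2 t : O t -> lie_rank X 3 t = 2%N by move=> Ot; rewrite (rE t Ot 2%N).
    have [V [phi [psi [a [b [[Vm VO ch] [[sa sb a0] XE]]]]]]] := exist 2%N m isT Om rank2 R2.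
    have Xc t : V t -> vapply X (fun u => b u / a u) t = 0.
      move=> Vt; apply/eqP; apply: contraT => c0.
      have [_ _ _ /(_ c0)[]] := chart_lie_rank ch (smooth_sub VO X_smooth) sa sb a0 XE Vt.
      by rewrite (R2 t (VO t Vt)).
    have := chart_lie_rank2 ch (smooth_sub VO X_smooth) sa sb a0 XE Xc (isT : 2 <= 4)%N Vm.
    by rewrite (rE m Om 3%N)// r3.
  have R3 t : O t -> lie_rank X 3 t = 3%N by move=> Ot; rewrite (rE t Ot 2%N).
  have R4 t : O t -> lie_rank X 4 t = 3%N by move=> Ot; rewrite (rE t Ot 3%N).
  have [V [phi [psi [a [b [[Vm VO ch] [[sa sb a0] XE]]]]]]] := exist 3%N m isT Om R3 R4.
  exists V, phi, psi, a, b; split; first by split.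
  split; first by split.
  split; first exact: XE.
  move=> t Vt; apply/eqP => c0.
  have [_ _ /(_ c0) + _] := chart_lie_rank ch (smooth_sub VO X_smooth) sa sb a0 XE Vt.
  by rewrite (R3 t (VO t Vt)).
- move=> nf; exists (fun j => if j is 0%N then 1%N else if j is 1%N then 2%N else 3%N).
  split=> // m Om j j3.
  have [V [phi [psi [a [b [[Vm VO ch] [[sa sb a0] [XE Xc]]]]]]]] := nf m Om.
  have [h1 h2 _ /(_ (Xc m Vm))[h3 h4]] := chart_lie_rank ch (smooth_sub VO X_smooth) sa sb a0 XE Vm.
  by case: j j3 => [|[|[|[|//]]]] _.
Qed.
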